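(* Let $0<\varrho<\infty$ and let $f\not\equiv0$ be meromorphic in a domain containing $\overline{D(0,\varrho)}$. Then there exists a positive constant $C$, which depends only on the initial values of $f$ at the origin, such that $$\int_{r'<|z|<r}\left|\frac{f'(z)}{f(z)}\right|dm(z)\lesssim\left(4\varrho\,\frac{r-r'}{\varrho-r'}\left(2+\log2+\log\frac{\varrho-r'}{r-r'}\right)+(2\pi+2)(r-r')+3\varrho\log\frac{\varrho-r'}{\varrho-r}\right)\big(2T(\varrho,f)+C\big)$$ for all $0\le r'<r<\varrho$.
   Context: $D(0,\varrho)=\{z\in\mathbb{C}:|z|<\varrho\}$; $m$ is Lebesgue area measure. The constant implied in $\lesssim$ is absolute. ''Initial values of $f$ at the origin'' refers to data of the Laurent expansion of $f$ at $0$; in particular $C$ is independent of $\varrho$, $r'$ and $r$. $T(r,f)$ is the Nevanlinna characteristic, $T(r,f)=m(r,f)+N(r,f)$, with $m(r,f)=\frac1{2\pi}\int_0^{2\pi}\log^+|f(re^{i\theta})|\,d\theta$ and $N(r,f)=\int_0^r\frac{n(t,f)-n(0,f)}{t}\,dt+n(0,f)\log r$, where $n(t,f)$ is the number of poles of $f$ in $|z|\le t$ counted with multiplicity. *)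

(* Defs.v *)
From HB Require Import structures.
From mathcomp Require Import all_boot all_order all_algebra.
From mathcomp Require Import all_classical all_reals all_analysis.
From mathcomp.real_closed Require Export complex.
Set Implicit Arguments.
Unset Strict Implicit.
Unset Printing Implicit Defensive.
Import Order.TTheory GRing.Theory Num.Theory.
Import numFieldTopology.Exports numFieldNormedType.Exports.
Local Open Scope classical_set_scope.
Local Open Scope ring_scope.

(* [R[i]] packaged as a [numClosedFieldType], so that its topology, its normed
   module structure and the complex derivative [f^`()] are inferred. *)
Definition Cplx (R : realType) : numClosedFieldType := R[i].

Section Meromorphic.
Variable R : realType.
Implicit Types (f g : Cplx R -> Cplx R) (a z : Cplx R) (U : set (Cplx R)).

(* The library norm [`|z|] of a complex number is itself a complex number. *)
Definition modulus z : R := complex.Re (`|z| : Cplx R).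

Definition closed_disc (rho : R) : set (Cplx R) := [set z | modulus z <= rho].

Definition holomorphic_at f a : Prop := \forall z \near a, derivable f z 1.

Definition has_pole_of_order f a (k : nat) : Prop :=
  (0 < k)%N /\
  exists g, [/\ holomorphic_at g a, g a != 0 &
    \forall z \near a^', f z = g z / (z - a) ^+ k].

(* A meromorphic function is represented by a total function whose values at
   its poles are irrelevant. *)
Definition meromorphic_on U f : Prop :=
  forall a, U a -> holomorphic_at f a \/ exists k, has_pole_of_order f a k.

Definition is_domain U : Prop := [/\ open U, connected U & U !=set0].

(* The order of a pole is unique; the default 0 is taken where there is no pole. *)
Definition pole_order f a : nat := xget 0%N [set k | has_pole_of_order f a k].

(* [\big[_/_]_(_ \in _)] is a finitely supported sum: a function meromorphic
   near the closed disc of radius [t] has finitely many poles there. *)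
Definition nevanlinna_n (t : R) f : nat :=
  \big[addn/0%N]_(a \in closed_disc t) pole_order f a.

Definition logp (x : R) : R := Num.max (ln x) 0.

Definition circle_pt (r theta : R) : Cplx R := Complex (r * cos theta) (r * sin theta).

Definition nevanlinna_m (r : R) f : R :=
  (2 * pi)^-1 *
  \int[@lebesgue_measure R]_(theta in `[0, 2 * pi]) logp (modulus (f (circle_pt r theta))).

Definition nevanlinna_N (r : R) f : R :=
  \int[@lebesgue_measure R]_(t in `[0, r])
     (((nevanlinna_n t f)%:R - (nevanlinna_n 0 f)%:R) / t)
  + (nevanlinna_n 0 f)%:R * ln r.

Definition nevanlinna_T (r : R) f : R := nevanlinna_m r f + nevanlinna_N r f.

(* [c] is the two-sided coefficient sequence of the Laurent expansion of [f]
   at the origin, with a principal part of length at most [k]. *)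
Definition is_laurent_expansion0 f (c : int -> Cplx R) : Prop :=
  exists k : nat,
    (forall n : int, n < - k%:Z -> c n = 0) /\
    \forall z \near (0 : Cplx R)^',
      series (fun n : nat => c (n%:Z - k%:Z) * z ^ (n%:Z - k%:Z)) @ \oo --> f z.

(* The two-sided coefficient sequence is unique, and exists whenever [f] is
   holomorphic or has a pole at the origin. *)
Definition laurent_coef0 f : int -> Cplx R :=
  xget (fun=> 0) [set c | is_laurent_expansion0 f c].

Definition annulus (r' r : R) : set (R * R) :=
  [set p | r' < modulus (Complex p.1 p.2) < r].

(* Extended-real area integral of [|f'/f|]; the plane is identified with
   [R * R] under the product Lebesgue measure.  With [0^-1 = 0] the integrand
   takes the value 0 at the zeros of [f], which form a null set. *)
Definition log_derivative_integral (r' r : R) f : \bar R :=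
  \int[(@lebesgue_measure R \x @lebesgue_measure R)%E]_(p in annulus r' r)
     (modulus (derive1 f (Complex p.1 p.2) / f (Complex p.1 p.2)))%:E.

End Meromorphic.

(* Main.v *)
Require Import Defs.
From HB Require Import structures.
From mathcomp Require Import all_boot all_order all_algebra.
From mathcomp Require Import all_classical all_reals all_analysis.
From mathcomp Require Import measurable_realfun ring lra.
Set Implicit Arguments.
Unset Strict Implicit.
Unset Printing Implicit Defensive.
Import Order.TTheory GRing.Theory Num.Theory.
Import numFieldTopology.Exports numFieldNormedType.Exports.
Local Open Scope classical_set_scope.
Local Open Scope ring_scope.

(** The proof represents f'/f on the disc of radius rho by boundary values of
    ln |f| and by the zeros and poles, and integrates the resulting kernels
    over the annulus.

    Let b run over the zeros and poles of f in the closed disc, with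
    multiplicities m b (negative at poles), and let p be the order of f at the
    origin. Then f = prod (z - b)^(m b) h with h holomorphic and zero-free on a
    larger disc ([zero_pole_factorization]). Differentiating the Schwarz
    formula for log h, and treating each linear factor through its reflection
    rho^2 - conj b z, which has the same modulus on the circle up to the factor
    rho, gives the differentiated Poisson-Jensen formula
    ([log_deriv_circle]): f'/f (z) is the mean over |zeta| = rho of G times
    2 zeta / (zeta - z)^2, where G = ln |f / z^p|, plus the sum of
    m b (rho^2 - |b|^2) / ((z - b) (rho^2 - conj b z)).

    Both kernels are controlled by [kappa], which has an area integral over
    r' < |z| < r of the size of [radial_factor], uniformly in b
    ([kernel_integral]). This is a sum over dyadic discs around b, each meeting
    the annulus in area at most a constant times min (r - r', t) t
    ([area_annulus_disc]), when the annulus is thin compared with rho - r';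
    a thick annulus is first cut into thin ones. Tonelli's theorem then bounds
    the integral of |f'/f| by rho times the radial factor times the mean of |G|
    plus the total weight of zeros and poles, in which a point b other than 0
    counts |m b| ln (rho / |b|) and the origin counts |p|
    ([log_deriv_area_bound], [log_deriv_weight_bound]).

    By Jensen's formula the negative part of G and the zeros can be traded for
    the positive part and the poles, at the price of the leading coefficient c
    of f at 0. The positive part and the poles are what T (rho, f) measures,
    except that passing from f to f / z^p may cost |p| times the negative part
    of ln rho ([proximity_le_nevanlinna_T]). This error is not bounded as rho
    tends to 0. On the other hand, the Laurent coefficients determine the germ
    of f at 0, hence p, c and, by the identity theorem, f itself on every disc
    about 0 in its domain; for rho below a radius depending only on the
    germ, f / z^p is zero-free and of bounded modulus, and the weight is bounded
    directly ([germ_constant]).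

    Holomorphy is developed from complex differentiability alone: Goursat's
    theorem for a parametrized square gives Cauchy's formula by deforming
    circles, and primitives along rays give the logarithm of a zero-free
    function. *)

(** * Complex numbers with a real-valued modulus *)

Section ComplexBasics.
Variable R : realType.
Local Notation C := (Cplx R).
Implicit Types (z w a b l : C) (f g : C -> C) (x y : R).

Definition cR (x : R) : C := Complex x 0.
Definition cRe (z : C) : R := complex.Re z.
Definition cIm (z : C) : R := complex.Im z.
Definition cconj (z : C) : C := conjc (z : R[i]).

Lemma modulusE x y : modulus (Complex x y : C) = Num.sqrt (x ^+ 2 + y ^+ 2).
Proof. by []. Qed.

Lemma norm_modulus z : `|z| = cR (modulus z).
Proof. by case: z. Qed.

Lemma modulus_ge0 z : 0 <= modulus z.
Proof. by case: z => x y; rewrite modulusE sqrtr_ge0. Qed.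

Lemma cR_inj : injective cR.
Proof. by move=> x y []. Qed.

Lemma cRM x y : cR (x * y) = cR x * cR y.
Proof. by rewrite /cR; apply/eqP; rewrite eq_complex /= !(mul0r, mulr0, subr0, addr0) !eqxx. Qed.

Lemma cRD x y : cR (x + y) = cR x + cR y.
Proof. by apply/eqP; rewrite eq_complex /= addr0 !eqxx. Qed.

Lemma cRN x : cR (- x) = - cR x.
Proof. by apply/eqP; rewrite eq_complex /= oppr0 !eqxx. Qed.

Lemma cRB x y : cR (x - y) = cR x - cR y.
Proof. by rewrite cRD cRN. Qed.

Lemma cR0 : cR 0 = 0. Proof. by []. Qed.
Lemma cR1 : cR 1 = 1. Proof. by []. Qed.

Lemma modulusM z w : modulus (z * w) = modulus z * modulus w.
Proof. by apply: cR_inj; rewrite cRM -!norm_modulus normrM. Qed.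

Lemma ler_cR x y : (cR x <= cR y) = (x <= y).
Proof. exact: lecR. Qed.
Lemma ltr_cR x y : (cR x < cR y) = (x < y).
Proof. exact: ltcR. Qed.

Lemma modulusD z w : modulus (z + w) <= modulus z + modulus w.
Proof. by rewrite -ler_cR cRD -!norm_modulus ler_normD. Qed.

Lemma modulusN z : modulus (- z) = modulus z.
Proof. by apply: cR_inj; rewrite -!norm_modulus normrN. Qed.

Lemma modulus_distC z w : modulus (z - w) = modulus (w - z).
Proof. by rewrite -modulusN opprB. Qed.

Lemma modulusB z w : modulus (z - w) <= modulus z + modulus w.
Proof. by rewrite -(modulusN w) modulusD. Qed.

Lemma modulus_distD a z w : modulus (z - w) <= modulus (z - a) + modulus (a - w).
Proof. by rewrite -(subrKA a) modulusD. Qed.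

Lemma lerB_modulus z w : modulus z - modulus w <= modulus (z - w).
Proof. by rewrite lerBlDr -{1}(subrK w z) modulusD. Qed.

Lemma modulus0 : modulus (0 : C) = 0.
Proof. by apply: cR_inj; rewrite -norm_modulus normr0. Qed.

Lemma modulus1 : modulus (1 : C) = 1.
Proof. by apply: cR_inj; rewrite -norm_modulus normr1. Qed.

Lemma modulus_eq0 z : (modulus z == 0) = (z == 0).
Proof. by rewrite -(inj_eq cR_inj) -norm_modulus normr_eq0. Qed.

Lemma modulus_gt0 z : (0 < modulus z) = (z != 0).
Proof. by rewrite lt_def modulus_ge0 andbT modulus_eq0. Qed.

Lemma modulusV z : modulus z^-1 = (modulus z)^-1.
Proof.
have [->|z0] := eqVneq z 0; first by rewrite !(invr0, modulus0).
apply: (mulfI (x := modulus z)); first by rewrite modulus_eq0.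
by rewrite -modulusM !mulfV ?modulus1 ?modulus_eq0.
Qed.

Lemma modulus_div z w : modulus (z / w) = modulus z / modulus w.
Proof. by rewrite modulusM modulusV. Qed.

Lemma modulusX z n : modulus (z ^+ n) = modulus z ^+ n.
Proof.
elim: n => [|n IH]; first by rewrite !expr0 modulus1.
by rewrite !exprS modulusM IH.
Qed.

Lemma modulus_exprz z (n : int) : modulus (z ^ n) = modulus z ^ n.
Proof. by case: n => n; rewrite /exprz ?modulusV modulusX. Qed.

Lemma modulus_cR x : modulus (cR x) = `|x|.
Proof. by rewrite modulusE expr0n addr0 sqrtr_sqr. Qed.

Lemma cRe_le_modulus z : `|cRe z| <= modulus z.
Proof.
by case: z => x y; rewrite modulusE -sqrtr_sqr ler_sqrt ?lerDl ?addr_ge0 ?sqr_ge0.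
Qed.

Lemma cIm_le_modulus z : `|cIm z| <= modulus z.
Proof.
by case: z => x y; rewrite modulusE -sqrtr_sqr ler_sqrt ?lerDr ?addr_ge0 ?sqr_ge0.
Qed.

Lemma modulus_le_ReIm z : modulus z <= `|cRe z| + `|cIm z|.
Proof.
case: z => x y; rewrite modulusE -[leRHS]ger0_norm ?addr_ge0// -sqrtr_sqr.
rewrite ler_sqrt ?sqr_ge0 //= -[x ^+ 2](real_normK (num_real x)).
rewrite -[y ^+ 2](real_normK (num_real y)) sqrrD.
have := mulr_ge0 (normr_ge0 x) (normr_ge0 y); set p := _ * _.
by move=> p0; rewrite mulr2n; lra.
Qed.

Lemma cReD z w : cRe (z + w) = cRe z + cRe w. Proof. by case: z; case: w. Qed.
Lemma cImD z w : cIm (z + w) = cIm z + cIm w. Proof. by case: z; case: w. Qed.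
Lemma cReN z : cRe (- z) = - cRe z. Proof. by case: z. Qed.
Lemma cImN z : cIm (- z) = - cIm z. Proof. by case: z. Qed.
Lemma cReB z w : cRe (z - w) = cRe z - cRe w. Proof. by rewrite cReD cReN. Qed.
Lemma cImB z w : cIm (z - w) = cIm z - cIm w. Proof. by rewrite cImD cImN. Qed.
Lemma cReM z w : cRe (z * w) = cRe z * cRe w - cIm z * cIm w.
Proof. by case: z; case: w. Qed.
Lemma cImM z w : cIm (z * w) = cRe z * cIm w + cIm z * cRe w.
Proof. by case: z; case: w. Qed.

Lemma ceqP z w : cRe z = cRe w -> cIm z = cIm w -> z = w.
Proof. by case: z => x y; case: w => x' y' /= -> ->. Qed.

Lemma cconjM z w : cconj (z * w) = cconj z * cconj w.
Proof. exact: rmorphM. Qed.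
Lemma cconjB z w : cconj (z - w) = cconj z - cconj w.
Proof. exact: rmorphB. Qed.
Lemma cconjV z : cconj z^-1 = (cconj z)^-1.
Proof. exact: fmorphV. Qed.
Lemma modulus_conj z : modulus (cconj z) = modulus z.
Proof. by case: z => x y; rewrite !modulusE /= sqrrN. Qed.
Lemma mul_conj z : z * cconj z = cR (modulus z ^+ 2).
Proof.
case: z => x y; apply: ceqP; rewrite ?cReM ?cImM /= ?modulusE.
  by rewrite sqr_sqrtr ?addr_ge0 ?sqr_ge0 //; ring.
ring.
Qed.
End ComplexBasics.

Arguments cRe {R} z.
Arguments cIm {R} z.
Arguments cR {R} x.
Arguments cconj {R} z.

(** * Complex differentiability *)

Section ComplexTopology.
Variable R : realType.
Local Notation C := (Cplx R).
Implicit Types (z w a b l : C) (f g : C -> C) (P : C -> Prop).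

Lemma near_modulusP a P :
  (\forall z \near a, P z) <->
  exists2 e : R, 0 < e & forall z, modulus (z - a) < e -> P z.
Proof.
split=> [/nbhs_normP[e /= e0 eP]|[e e0 eP]].
  have eE : e = cR (cRe e).
    by move: e0; case: (e) => x y; rewrite ltcE /= => /andP[/eqP -> _].
  exists (cRe e) => [|z zae]; first by rewrite -ltr_cR -eE.
  by apply: eP; rewrite /ball_ /= distrC norm_modulus eE ltr_cR.
apply/nbhs_normP; exists (cR e) => /=; first by rewrite ltr_cR.
by move=> z /=; rewrite distrC norm_modulus ltr_cR; exact: eP.
Qed.

Lemma near_puncturedP a P :
  (\forall z \near a^', P z) <->
  exists2 e : R, 0 < e & forall z, 0 < modulus (z - a) < e -> P z.
Proof.
apply: (iff_trans (B := \forall z \near a, z != a -> P z)); first by rewrite near_withinE.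
apply: iff_trans (near_modulusP _ _) _; split=> -[e e0 eP]; exists e => // z.
  by case/andP; rewrite modulus_gt0 subr_eq0; move=> za ze; exact: eP.
by move=> ze za; apply: eP; rewrite ze modulus_gt0 subr_eq0 za.
Qed.

Lemma cvg_modulusP (T : Type) (F : set_system T) {FF : Filter F} (f : T -> C) l :
  (f @ F --> l) <-> forall e : R, 0 < e -> \forall t \near F, modulus (f t - l) < e.
Proof.
split=> [fl e e0|H].
  have /fl : \forall z \near l, modulus (z - l) < e by apply/near_modulusP; exists e.
  by [].
by move=> P /near_modulusP[e e0 eP]; near=> t; apply: eP; near: t; exact: H.
Unshelve. all: by end_near. Qed.

(** The complex derivative with real tolerances, stated without the division
    so that it composes by plain estimates. *)
Definition cderiv f a l := forall e : R, 0 < e ->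
  exists2 d : R, 0 < d & forall z, modulus (z - a) < d ->
    modulus (f z - f a - l * (z - a)) <= e * modulus (z - a).

Lemma cderiv_is_derive f a l : cderiv f a l <-> is_derive a (1 : C) f l.
Proof.
have E (h : C) : h *: (1 : C) = h by rewrite /GRing.scale /= mulr1.
split=> [fl|[dfa dl]].
  have cl : (fun h : C => h^-1 *: (f (h *: 1 + a) - f a)) @ 0^' --> l.
    apply/cvg_modulusP => e e0.
    have [d d0 dP] := fl (e / 2) (divr_gt0 e0 (ltr0Sn _ _)).
    apply/near_puncturedP; exists d => // h; rewrite subr0 => /andP[h0 hd].
    have := dP (h + a); rewrite addrK => /(_ hd) H.
    rewrite E /GRing.scale /=.
    have hn0 : h != 0 by rewrite -modulus_gt0.
    have -> : h^-1 * (f (h + a) - f a) - l = h^-1 * (f (h + a) - f a - l * h).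
      by field.
    rewrite modulusM modulusV mulrC ltr_pdivrMr// (le_lt_trans H)//.
    by rewrite ltr_pM2r// ltr_pdivrMr ?ltr_pMr ?ltr1n.
  apply: DeriveDef; first by apply/cvg_ex; exists l.
  exact/cvg_lim.
have cl : (fun h : C => h^-1 *: (f (h *: 1 + a) - f a)) @ 0^' --> l.
  by rewrite -dl; exact: dfa.
move=> e e0; move/cvg_modulusP : cl => /(_ e e0) /near_puncturedP[d d0 dP].
exists d => // z zd; have [->|za] := eqVneq z a.
  by rewrite !subrr mulr0 subr0 modulus0 mulr0.
have zan : z - a != 0 by rewrite subr_eq0.
have := dP (z - a); rewrite subr0 modulus_gt0 zan zd => /(_ isT).
rewrite E subrK /GRing.scale /= => H.
have -> : f z - f a - l * (z - a) = (z - a) * ((z - a)^-1 * (f z - f a) - l).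
  by field.
by rewrite modulusM mulrC ler_pM2r ?modulus_gt0// ltW.
Qed.

Lemma cderivP f a l : cderiv f a l <-> derivable f a (1 : C) /\ derive1 f a = l.
Proof.
rewrite cderiv_is_derive derive1E; split=> [[]//|[? ?]]; exact: DeriveDef.
Qed.

Lemma cderiv_derivable f a : derivable f a (1 : C) -> cderiv f a (derive1 f a).
Proof. by move=> fa; apply/cderivP. Qed.

Lemma cderiv_unique f a l m : cderiv f a l -> cderiv f a m -> l = m.
Proof. by move=> /cderivP[_ <-] /cderivP[_ <-]. Qed.

Lemma cderiv_cst (c : C) a : cderiv (fun=> c) a 0.
Proof. by apply/cderiv_is_derive; exact: is_derive_cst. Qed.

Lemma cderiv_id a : cderiv id a 1.
Proof. by apply/cderiv_is_derive; exact: is_derive_id. Qed.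

Lemma cderivD f g a l m : cderiv f a l -> cderiv g a m ->
  cderiv (fun z => f z + g z) a (l + m).
Proof.
by move=> /cderiv_is_derive fl /cderiv_is_derive gm; apply/cderiv_is_derive; exact: is_deriveD.
Qed.

Lemma cderivN f a l : cderiv f a l -> cderiv (fun z => - f z) a (- l).
Proof. by move=> /cderiv_is_derive fl; apply/cderiv_is_derive; exact: is_deriveN. Qed.

Lemma cderivB f g a l m : cderiv f a l -> cderiv g a m ->
  cderiv (fun z => f z - g z) a (l - m).
Proof. by move=> fl gm; apply: cderivD => //; exact: cderivN. Qed.

Lemma cderivM f g a l m : cderiv f a l -> cderiv g a m ->
  cderiv (fun z => f z * g z) a (f a * m + g a * l).
Proof.
by move=> /cderiv_is_derive fl /cderiv_is_derive gm; apply/cderiv_is_derive; exact: is_deriveM.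
Qed.

Lemma cderivV f a l : f a != 0 -> cderiv f a l ->
  cderiv (fun z => (f z)^-1) a (- (f a) ^- 2 * l).
Proof.
move=> fa0 /cderiv_is_derive[fl <-]; apply/cderiv_is_derive; apply: DeriveDef.
  exact: derivableV.
by rewrite deriveV.
Qed.

Lemma cderiv_cont f a l : cderiv f a l -> forall e : R, 0 < e ->
  exists2 d : R, 0 < d & forall z, modulus (z - a) < d -> modulus (f z - f a) < e.
Proof.
move=> fl e e0; have [d d0 dP] := fl 1 ltr01.
have L0 : 0 < 1 + modulus l by rewrite ltr_pwDl// modulus_ge0.
exists (Num.min d (e / (1 + modulus l))); first by rewrite lt_min d0 divr_gt0.
move=> z; rewrite lt_min => /andP[/dP zd ze].
rewrite -[f z - f a](subrK (l * (z - a))).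
apply: le_lt_trans (modulusD _ _) _.
apply: (@le_lt_trans _ _ ((1 + modulus l) * modulus (z - a))).
  by rewrite mulrDl modulusM lerD2r.
by rewrite mulrC -ltr_pdivlMr.
Qed.

Lemma cderiv_near f g a l : (\forall z \near a, f z = g z) -> cderiv f a l -> cderiv g a l.
Proof.
move=> /near_modulusP[e e0 eP] fl e' e'0; have [d d0 dP] := fl _ e'0.
exists (Num.min d e); first by rewrite lt_min d0.
move=> z; rewrite lt_min => /andP[zd ze]; rewrite -!eP//; first exact: dP.
by rewrite subrr modulus0.
Qed.

End ComplexTopology.

(** * Integrals along curves *)

Section ComplexIntegral.
Variable R : realType.
Local Notation C := (Cplx R).
Local Notation mu := (@lebesgue_measure R).
Implicit Types (k h : R -> C) (u v : R -> R) (a b c x : R).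

Lemma continuous_at_modulusP k x : continuous_at x k <->
  forall e : R, 0 < e -> \forall y \near x, modulus (k y - k x) < e.
Proof. exact: cvg_modulusP. Qed.

Lemma continuous_at_cRe k x : continuous_at x k -> continuous_at x (cRe \o k).
Proof.
move=> /continuous_at_modulusP kx; apply/cvgrPdist_lt => e /kx.
apply: filterS => y; apply: le_lt_trans.
by rewrite /= -cReB (le_trans (cRe_le_modulus _))// modulus_distC.
Qed.

Lemma continuous_at_cIm k x : continuous_at x k -> continuous_at x (cIm \o k).
Proof.
move=> /continuous_at_modulusP kx; apply/cvgrPdist_lt => e /kx.
apply: filterS => y; apply: le_lt_trans.
by rewrite /= -cImB (le_trans (cIm_le_modulus _))// modulus_distC.
Qed.

Lemma continuous_at_Complex u v x : continuous_at x u -> continuous_at x v ->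
  continuous_at x (fun y => Complex (u y) (v y) : C).
Proof.
move=> /cvgrPdist_lt ux /cvgrPdist_lt vx; apply/continuous_at_modulusP => e e0.
have e20 : 0 < e / 2 by rewrite divr_gt0.
near=> y; rewrite modulus_distC; apply: le_lt_trans (modulus_le_ReIm _) _.
rewrite cReB cImB /= [e]splitr ltrD//; near: y; [exact: ux|exact: vx].
Unshelve. all: by end_near. Qed.

Lemma continuous_at_cR u x : continuous_at x u -> continuous_at x (cR \o u).
Proof. by move=> ux; apply: continuous_at_Complex => //; exact: cvg_cst. Qed.

Lemma continuous_at_comp_cderiv (f : C -> C) k x l : cderiv f (k x) l ->
  continuous_at x k -> continuous_at x (f \o k).
Proof.
move=> fl /continuous_at_modulusP kx; apply/continuous_at_modulusP => e e0.
have [d d0 dP] := cderiv_cont fl e0.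
by have := kx _ d0; apply: filterS => y; exact: dP.
Qed.

Definition rintegrable u a b := mu.-integrable `[a, b] (EFin \o u).
Definition cintegrable k a b :=
  rintegrable (cRe \o k) a b /\ rintegrable (cIm \o k) a b.
Definition cint k a b : C :=
  Complex (\int[mu]_(x in `[a, b]) cRe (k x)) (\int[mu]_(x in `[a, b]) cIm (k x)).

Lemma continuous_rintegrable u a b :
  (forall x, a <= x <= b -> continuous_at x u) -> rintegrable u a b.
Proof.
move=> cu; apply: continuous_compact_integrable; first exact: segment_compact.
apply: continuous_in_subspaceT => x; rewrite inE /= in_itv /= => xab; exact: cu.
Qed.

Lemma continuous_cintegrable k a b :
  (forall x, a <= x <= b -> continuous_at x k) -> cintegrable k a b.
Proof.
by move=> ck; split; apply: continuous_rintegrable => x xab;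
  [apply: continuous_at_cRe|apply: continuous_at_cIm]; exact: ck.
Qed.

Lemma eq_rintegrable u v a b : (forall x, a <= x <= b -> u x = v x) ->
  rintegrable u a b -> rintegrable v a b.
Proof.
move=> uv; apply: eq_integrable => // x; rewrite inE /= in_itv /= => xab.
by rewrite /= uv.
Qed.

Lemma rintegrableD u v a b : rintegrable u a b -> rintegrable v a b ->
  rintegrable (fun x => u x + v x) a b.
Proof. by move=> iu iv; exact: (integrableD _ iu iv). Qed.

Lemma rintegrableB u v a b : rintegrable u a b -> rintegrable v a b ->
  rintegrable (fun x => u x - v x) a b.
Proof. by move=> iu iv; exact: (integrableB _ iu iv). Qed.

Lemma rintegrableZ u r a b : rintegrable u a b -> rintegrable (fun x => r * u x) a b.
Proof. by move=> iu; exact: (integrableZl _ r iu). Qed.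

Lemma eq_cintegrable k h a b : (forall x, a <= x <= b -> k x = h x) ->
  cintegrable k a b -> cintegrable h a b.
Proof.
move=> kh [kr ki]; split.
  by apply: eq_rintegrable kr => x xab; rewrite /= kh.
by apply: eq_rintegrable ki => x xab; rewrite /= kh.
Qed.

Lemma eq_cint k h a b : (forall x, a <= x <= b -> k x = h x) -> cint k a b = cint h a b.
Proof.
move=> kh; congr (Complex _ _); apply: eq_Rintegral => x; rewrite inE /= in_itv /=;
  by move=> xab; rewrite kh.
Qed.

Lemma cintegrableD k h a b : cintegrable k a b -> cintegrable h a b ->
  cintegrable (fun x => k x + h x) a b.
Proof.
move=> [kr ki] [hr hi]; split.
  by apply: eq_rintegrable (rintegrableD kr hr) => x _ /=; rewrite cReD.
by apply: eq_rintegrable (rintegrableD ki hi) => x _ /=; rewrite cImD.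
Qed.

Lemma cintD k h a b : cintegrable k a b -> cintegrable h a b ->
  cint (fun x => k x + h x) a b = cint k a b + cint h a b.
Proof.
move=> [kr ki] [hr hi]; apply: ceqP; rewrite ?cReD ?cImD /=.
  by under eq_Rintegral do rewrite cReD; rewrite RintegralD.
by under eq_Rintegral do rewrite cImD; rewrite RintegralD.
Qed.

Lemma cintegrableZ (l : C) k a b : cintegrable k a b -> cintegrable (fun x => l * k x) a b.
Proof.
move=> [kr ki]; split.
  apply: eq_rintegrable (rintegrableB (rintegrableZ (cRe l) kr) (rintegrableZ (cIm l) ki)).
  by move=> x _ /=; rewrite cReM.
apply: eq_rintegrable (rintegrableD (rintegrableZ (cRe l) ki) (rintegrableZ (cIm l) kr)).
by move=> x _ /=; rewrite cImM.
Qed.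

Lemma cintZ (l : C) k a b : cintegrable k a b -> cint (fun x => l * k x) a b = l * cint k a b.
Proof.
move=> [kr ki]; apply: ceqP; rewrite ?cReM ?cImM /=.
  under eq_Rintegral do rewrite cReM.
  by rewrite RintegralB//; try (exact: rintegrableZ); rewrite !RintegralZl.
under eq_Rintegral do rewrite cImM.
by rewrite RintegralD//; try (exact: rintegrableZ); rewrite !RintegralZl.
Qed.

Lemma cintB k h a b : cintegrable k a b -> cintegrable h a b ->
  cint (fun x => k x - h x) a b = cint k a b - cint h a b.
Proof.
move=> ki hi; rewrite -[- cint h a b]mulN1r -cintZ// -cintD//; last exact: cintegrableZ.
by apply: eq_cint => x _; rewrite mulN1r.
Qed.

Lemma cintegrableB k h a b : cintegrable k a b -> cintegrable h a b ->
  cintegrable (fun x => k x - h x) a b.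
Proof.
move=> ki hi; apply: eq_cintegrable (cintegrableD ki (cintegrableZ (-1) hi)).
by move=> x _; rewrite mulN1r.
Qed.

Lemma cint_cst (l : C) a b : a <= b -> cint (fun=> l) a b = cR (b - a) * l.
Proof.
move=> ab; have mab : fine (mu `[a, b]) = b - a.
  rewrite lebesgue_measure_itv /= lte_fin; move: ab; rewrite le_eqVlt => /predU1P[->|->]//.
  by rewrite ltxx subrr.
apply: ceqP; rewrite ?cReM ?cImM /= !Rintegral_cst ?mab//; ring.
Qed.

Lemma le_rint_bound u a b M : a <= b -> rintegrable u a b ->
  (forall x, a <= x <= b -> `|u x| <= M) ->
  `|\int[mu]_(x in `[a, b]) u x| <= M * (b - a).
Proof.
move=> ab iu uM; have mab : fine (mu `[a, b]) = b - a.
  rewrite lebesgue_measure_itv /= lte_fin; move: (ab); rewrite le_eqVlt => /predU1P[->|->]//.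
  by rewrite ltxx subrr.
apply: le_trans (le_normr_Rintegral _ iu) _ => //.
rewrite -mab -Rintegral_cst//; apply: le_Rintegral => //.
- exact: integrable_abse iu.
- exact: (@continuous_rintegrable (fun=> M) a b (fun x _ => cvg_cst _)).
Qed.

(** The factor 2 comes from estimating real and imaginary parts separately. *)
Lemma cint_bound k a b M : a <= b -> cintegrable k a b ->
  (forall x, a <= x <= b -> modulus (k x) <= M) ->
  modulus (cint k a b) <= 2 * (M * (b - a)).
Proof.
move=> ab [kr ki] kM; apply: le_trans (modulus_le_ReIm _) _.
rewrite mulr_natl mulr2n lerD// le_rint_bound// => x xab.
  exact: le_trans (cRe_le_modulus _) (kM x xab).
exact: le_trans (cIm_le_modulus _) (kM x xab).
Qed.

Lemma rint_split u a b c : a <= c <= b -> rintegrable u a b ->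
  \int[mu]_(x in `[a, b]) u x =
  \int[mu]_(x in `[a, c]) u x + \int[mu]_(x in `[c, b]) u x.
Proof.
move=> /andP[ac cb] iu.
rewrite -(Rintegral_itv_obnd_cbnd (r := c)); last first.
  apply: integrableS iu => //; apply: subset_itvr; exact: ac.
by rewrite -(Rintegral_itvB iu) ?bnd_simp// addrC subrK.
Qed.

Lemma cint_split k a b c : a <= c <= b -> cintegrable k a b ->
  cint k a b = cint k a c + cint k c b.
Proof. by move=> acb [kr ki]; apply: ceqP; rewrite ?cReD ?cImD /= -rint_split. Qed.

Lemma rint_FTC u v a b : a <= b ->
  (forall x, a <= x <= b -> is_derive x (1 : R) v (u x)) ->
  (forall x, a <= x <= b -> continuous_at x u) ->
  \int[mu]_(x in `[a, b]) u x = v b - v a.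
Proof.
move=> ab dv cu; move: ab; rewrite le_eqVlt => /predU1P[ab|ab].
  by rewrite -ab set_itv1 Rintegral_set1 subrr.
have cv x : a <= x <= b -> continuous_at x v.
  by move=> /dv[dx _]; apply: differentiable_continuous; exact/derivable1_diffP.
rewrite /Rintegral (continuous_FTC2 (F := v))//.
- apply: continuous_in_subspaceT => x; rewrite inE /= in_itv /= => xab; exact: cu.
- split.
  + by move=> x; rewrite in_itv /= => /andP[ax xb]; have [] := dv x; rewrite ?(ltW ax) ?(ltW xb).
  + by apply: cvg_at_right_filter; apply: cv; rewrite lexx ltW.
  + by apply: cvg_at_left_filter; apply: cv; rewrite lexx ltW.
- move=> x; rewrite in_itv /= => /andP[ax xb]; have [] := dv x; rewrite ?(ltW ax) ?(ltW xb)//.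
  by move=> _ <-; rewrite derive1E.
Qed.

(** The derivative of a curve, taken componentwise: the fundamental theorem
    of calculus is applied to the real and imaginary parts. *)
Definition rderiv k x (l : C) :=
  is_derive x (1 : R) (cRe \o k) (cRe l) /\ is_derive x (1 : R) (cIm \o k) (cIm l).

Lemma cint_FTC k h a b : a <= b ->
  (forall x, a <= x <= b -> rderiv h x (k x)) ->
  (forall x, a <= x <= b -> continuous_at x k) ->
  cint k a b = h b - h a.
Proof.
move=> ab dk ck; apply: ceqP; rewrite ?cReB ?cImB /=.
  apply: (rint_FTC (v := cRe \o h)) => // x xab; first by have [] := dk x xab.
  by apply: continuous_at_cRe; exact: ck.
apply: (rint_FTC (v := cIm \o h)) => // x xab; first by have [] := dk x xab.
by apply: continuous_at_cIm; exact: ck.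
Qed.

Lemma rderiv_Complex u v x du dv : is_derive x (1 : R) u du -> is_derive x (1 : R) v dv ->
  rderiv (fun y => Complex (u y) (v y) : C) x (Complex du dv).
Proof. by []. Qed.

Lemma rderiv_cst (l : C) x : rderiv (fun=> l) x 0.
Proof. by split; exact: is_derive_cst. Qed.

Lemma rderiv_eq k x l l' : l = l' -> rderiv k x l -> rderiv k x l'.
Proof. by move=> ->. Qed.

Lemma rderivD k h x l m : rderiv k x l -> rderiv h x m -> rderiv (fun y => k y + h y) x (l + m).
Proof.
move=> [kr ki] [hr hi]; split; rewrite ?cReD ?cImD.
  have -> : cRe \o (fun y => k y + h y) = (cRe \o k) + (cRe \o h).
    by apply/funext => y /=; rewrite cReD.
  exact: is_deriveD.
have -> : cIm \o (fun y => k y + h y) = (cIm \o k) + (cIm \o h).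
  by apply/funext => y /=; rewrite cImD.
exact: is_deriveD.
Qed.

Lemma rderivM k h x l m : rderiv k x l -> rderiv h x m ->
  rderiv (fun y => k y * h y) x (k x * m + h x * l).
Proof.
move=> [kr ki] [hr hi]; split; rewrite ?cReD ?cImD ?cReM ?cImM.
  have -> : cRe \o (fun y => k y * h y) = (cRe \o k) * (cRe \o h) - (cIm \o k) * (cIm \o h).
    by apply/funext => y /=; rewrite cReM.
  apply: is_derive_eq; rewrite /GRing.scale /=; ring.
have -> : cIm \o (fun y => k y * h y) = (cRe \o k) * (cIm \o h) + (cIm \o k) * (cRe \o h).
  by apply/funext => y /=; rewrite cImM.
apply: is_derive_eq; rewrite /GRing.scale /=; ring.
Qed.

End ComplexIntegral.

(** * Goursat's theorem *)

Section Bisection.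
Variable R : realType.
Implicit Types (s t d e : R) (B : R -> R -> R -> R).

Definition in_unit_square s t d := [/\ 0 < d, 0 <= s, s + d <= 1, 0 <= t & t + d <= 1].

Lemma quarter_choice B s t d :
  B s t d <= B s t (d / 2) + B (s + d / 2) t (d / 2) +
             (B s (t + d / 2) (d / 2) + B (s + d / 2) (t + d / 2) (d / 2)) ->
  exists p : R * R, [/\ p.1 = s \/ p.1 = s + d / 2, p.2 = t \/ p.2 = t + d / 2
    & B s t d <= 4 * B p.1 p.2 (d / 2)].
Proof.
set b1 := B s t (d / 2); set b2 := B (s + d / 2) t (d / 2).
set b3 := B s (t + d / 2) (d / 2); set b4 := B (s + d / 2) (t + d / 2) (d / 2) => H.
have [h1|h1] := leP (B s t d) (4 * b1); first by exists (s, t); split; [left|left|].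
have [h2|h2] := leP (B s t d) (4 * b2); first by exists (s + d / 2, t); split; [right|left|].
have [h3|h3] := leP (B s t d) (4 * b3); first by exists (s, t + d / 2); split; [left|right|].
have [h4|h4] := leP (B s t d) (4 * b4).
  by exists (s + d / 2, t + d / 2); split; [right|right|].
exfalso; lra.
Qed.

(** One of the four quarters carries at least a quarter of the value.
    Repeating, the nested squares shrink to a point, where a majorant that is
    o(d^2) forces the value on the whole square below every positive e. *)
Lemma unit_square_bisection B :
  (forall s t d, in_unit_square s t d ->
    B s t d <= B s t (d / 2) + B (s + d / 2) t (d / 2) +
             (B s (t + d / 2) (d / 2) + B (s + d / 2) (t + d / 2) (d / 2))) ->
  (forall p q e, 0 <= p <= 1 -> 0 <= q <= 1 -> 0 < e ->
    exists2 r : R, 0 < r & forall s t d, in_unit_square s t d -> d < r ->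
      s <= p <= s + d -> t <= q <= t + d -> B s t d <= e * d ^+ 2) ->
  B 0 0 1 <= 0.
Proof.
move=> Bq Bloc.
have ch : forall x : R * R * nat, exists p : R * R,
    in_unit_square x.1.1 x.1.2 (2 ^- x.2) ->
    [/\ p.1 = x.1.1 \/ p.1 = x.1.1 + 2 ^- x.2 / 2,
        p.2 = x.1.2 \/ p.2 = x.1.2 + 2 ^- x.2 / 2
      & B x.1.1 x.1.2 (2 ^- x.2) <= 4 * B p.1 p.2 (2 ^- x.2 / 2)].
  move=> [[s t] n] /=; have [u|nu] := pselect (in_unit_square s t (2 ^- n)).
    by have [p pP] := quarter_choice (Bq _ _ _ u); exists p.
  by exists (0, 0).
have /choice[step stepP] := ch.
pose P := fix P n := if n is m.+1 then step (P m, m) else (0, 0) : R * R.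
pose S n := (P n).1; pose T n := (P n).2.
have dS n : 2 ^- n.+1 = 2 ^- n / 2 :> R by rewrite exprSr invfM.
have d0 n : 0 < 2 ^- n :> R by rewrite invr_gt0 exprn_gt0.
have stepS n : in_unit_square (S n) (T n) (2 ^- n) ->
    [/\ S n.+1 = S n \/ S n.+1 = S n + 2 ^- n / 2,
        T n.+1 = T n \/ T n.+1 = T n + 2 ^- n / 2
      & B (S n) (T n) (2 ^- n) <= 4 * B (S n.+1) (T n.+1) (2 ^- n.+1)].
  by move=> u; rewrite dS; exact: stepP (P n, n) u.
have PU n : in_unit_square (S n) (T n) (2 ^- n).
  elim: n => [|n IH]; first by split; rewrite /S /T /= ?expr0 ?invr1 ?add0r.
  have [h1 h2 _] := stepS n IH; rewrite dS.
  case: IH => i1 i2 i3 i4 i5; have := d0 n; set D := 2 ^- n in i1 i3 i5 h1 h2 * => dp.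
  by split; first lra; case: h1 => h1; case: h2 => h2; rewrite ?h1 ?h2; lra.
have stepn n : [/\ S n <= S n.+1, S n.+1 + 2 ^- n.+1 <= S n + 2 ^- n,
    T n <= T n.+1, T n.+1 + 2 ^- n.+1 <= T n + 2 ^- n
    & B (S n) (T n) (2 ^- n) <= 4 * B (S n.+1) (T n.+1) (2 ^- n.+1)].
  have [h1 h2 h3] := stepS n (PU n); have dp := d0 n; split=> //; rewrite ?dS;
    set D := 2 ^- n in h1 h2 dp *; case: h1 => h1; case: h2 => h2; rewrite ?h1 ?h2; lra.
have B4 n : B 0 0 1 <= 4 ^+ n * B (S n) (T n) (2 ^- n).
  elim: n => [|n IH]; first by rewrite !expr0 invr1 mul1r.
  have [_ _ _ _ h] := stepn n; apply: le_trans IH _.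
  by rewrite exprSr -mulrA ler_pM2l// exprn_gt0.
have nest (U : nat -> R) : (forall n, U n <= U n.+1) ->
    (forall n, U n.+1 + 2 ^- n.+1 <= U n + 2 ^- n) ->
    exists p, forall n, U n <= p <= U n + 2 ^- n.
  move=> U1 U2.
  have M1 m n : (m <= n)%N -> U m <= U n.
    by move=> mn; apply: (homo_leq (r := fun x y : R => x <= y)) mn => // y x z; exact: le_trans.
  have M2 m n : (m <= n)%N -> U n + 2 ^- n <= U m + 2 ^- m.
    move=> mn; apply: (homo_leq (r := fun x y : R => y <= x) (f := fun n => U n + 2 ^- n)) mn => //.
    by move=> y x z xy yz; exact: le_trans yz xy.
  have ub n : ubound (range U) (U n + 2 ^- n).
    move=> _ [m _ <-]; case: (leqP m n) => mn.
      by apply: le_trans (M1 _ _ mn) _; rewrite lerDl ltW.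
    by apply: le_trans (M2 _ _ (ltnW mn)); rewrite lerDl ltW.
  exists (sup (range U)) => n; apply/andP; split.
    by apply: ub_le_sup; [exists (U 0 + 2 ^- 0); exact: ub|exists n].
  by apply: ge_sup; [exists (U 0); exists 0|exact: ub].
have [p pP] := nest S (fun n => let: And5 a _ _ _ _ := stepn n in a)
  (fun n => let: And5 _ a _ _ _ := stepn n in a).
have [q qP] := nest T (fun n => let: And5 _ _ a _ _ := stepn n in a)
  (fun n => let: And5 _ _ _ a _ := stepn n in a).
have p01 : 0 <= p <= 1.
  by have := pP 0%N; rewrite /S /= expr0 invr1 add0r.
have q01 : 0 <= q <= 1.
  by have := qP 0%N; rewrite /T /= expr0 invr1 add0r.
apply/ler_addgt0Pl => e e0; rewrite addr0.
have [r r0 rP] := Bloc p q e p01 q01 e0.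
have [n nr] : exists n, 2 ^- n < r.
  exists (Num.trunc r^-1).+1; rewrite invf_plt ?posrE//.
  apply: lt_le_trans (truncnS_gt _) _.
  by rewrite -natrX ler_nat ltnW// ltn_expl.
apply: le_trans (B4 n) _; have := rP _ _ _ (PU n) nr (pP n) (qP n).
rewrite -(ler_pM2l (_ : 0 < 4 ^+ n))// => /le_trans; apply.
rewrite mulrCA -exprVn exprAC -exprMn.
by rewrite (_ : 4 * 2^-1 ^+ 2 = 1) ?expr1n ?mulr1//; field.
Qed.
End Bisection.
Section Goursat.
Variable R : realType.
Local Notation C := (Cplx R).
Variables (H Hs Ht : R -> R -> C) (L : R).
Implicit Types (f g : C -> C) (s t d : R).

Definition unit_itv (x : R) := 0 <= x <= 1.

(** The integral of f over the image under H of the boundary of a rectangle,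
    counterclockwise. *)
Definition edge_integral f s0 s1 t0 t1 : C :=
  cint (fun x => f (H x t0) * Hs x t0) s0 s1 + cint (fun y => f (H s1 y) * Ht s1 y) t0 t1
  - cint (fun x => f (H x t1) * Hs x t1) s0 s1 - cint (fun y => f (H s0 y) * Ht s0 y) t0 t1.

Hypothesis Hds : forall s t, unit_itv s -> unit_itv t -> rderiv (H ^~ t) s (Hs s t).
Hypothesis Hdt : forall s t, unit_itv s -> unit_itv t -> rderiv (H s) t (Ht s t).
Hypothesis Hcs : forall s t, unit_itv s -> unit_itv t -> continuous_at s (Hs ^~ t).
Hypothesis Hct : forall s t, unit_itv s -> unit_itv t -> continuous_at t (Ht s).
Hypothesis L0 : 0 < L.
Hypothesis Hlip : forall s t s' t', unit_itv s -> unit_itv t -> unit_itv s' -> unit_itv t' ->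
  modulus (H s t - H s' t') <= L * (`|s - s'| + `|t - t'|).
Hypothesis HsL : forall s t, unit_itv s -> unit_itv t -> modulus (Hs s t) <= L.
Hypothesis HtL : forall s t, unit_itv s -> unit_itv t -> modulus (Ht s t) <= L.

Lemma rderiv_continuous (k : R -> C) x l : rderiv k x l -> continuous_at x k.
Proof.
move=> [[kr _] [ki _]].
have -> : k = fun y => Complex ((cRe \o k) y) ((cIm \o k) y) by apply/funext => y /=; case: (k y).
apply: continuous_at_Complex; apply: differentiable_continuous; exact/derivable1_diffP.
Qed.

Definition continuous_along f := (forall s t, unit_itv s -> unit_itv t ->
  continuous_at s (fun x => f (H x t)) /\ continuous_at t (fun y => f (H s y))).

Lemma cderiv_continuous_along f :
  (forall s t, unit_itv s -> unit_itv t -> exists l, cderiv f (H s t) l) ->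
  continuous_along f.
Proof.
move=> fd s t s01 t01; have [l fl] := fd s t s01 t01; split.
  exact: (continuous_at_comp_cderiv (k := H ^~ t) fl (rderiv_continuous (Hds s01 t01))).
exact: (continuous_at_comp_cderiv (k := H s) fl (rderiv_continuous (Hdt s01 t01))).
Qed.

Lemma unit_itvW s0 s1 x : 0 <= s0 -> s1 <= 1 -> s0 <= x <= s1 -> unit_itv x.
Proof. by move=> a b /andP[c d]; apply/andP; split; lra. Qed.

Lemma edge_cintegrable f s0 s1 t : continuous_along f -> 0 <= s0 -> s1 <= 1 -> unit_itv t ->
  cintegrable (fun x => f (H x t) * Hs x t) s0 s1 /\
  cintegrable (fun y => f (H t y) * Ht t y) s0 s1.
Proof.
move=> cf a b t01; split; apply: continuous_cintegrable => x /(unit_itvW a b) x01.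
  by apply: cvgM; [have [] := cf x t x01 t01|exact: Hcs].
by apply: cvgM; [have [] := cf t x t01 x01|exact: Hct].
Qed.

Lemma edge_integralB f g s0 s1 t0 t1 : continuous_along f -> continuous_along g ->
  0 <= s0 -> s0 <= s1 -> s1 <= 1 -> 0 <= t0 -> t0 <= t1 -> t1 <= 1 ->
  edge_integral (fun z => f z - g z) s0 s1 t0 t1 = edge_integral f s0 s1 t0 t1 - edge_integral g s0 s1 t0 t1.
Proof.
move=> cf cg a b c a' b' c'.
have [p1 p2 p3 p4] : [/\ unit_itv s0, unit_itv s1, unit_itv t0 & unit_itv t1].
  by split; apply/andP; split; lra.
have E (k h : C -> C) (K : R -> C) (W : R -> C) x0 x1 :
    cintegrable (fun x => k (K x) * W x) x0 x1 -> cintegrable (fun x => h (K x) * W x) x0 x1 ->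
    cint (fun x => (k (K x) - h (K x)) * W x) x0 x1 =
    cint (fun x => k (K x) * W x) x0 x1 - cint (fun x => h (K x) * W x) x0 x1.
  by move=> ik ih; rewrite -cintB//; apply: eq_cint => x _; rewrite mulrBl.
rewrite /edge_integral (E f g (H ^~ t0) (Hs ^~ t0)) ?(E f g (H ^~ t1) (Hs ^~ t1))
  ?(E f g (H s0) (Ht s0)) ?(E f g (H s1) (Ht s1)); try by
  [exact: (edge_cintegrable _ _ _ _).1 | exact: (edge_cintegrable _ _ _ _).2].
ring.
Qed.

Lemma edge_integral_affine (l m : C) s0 s1 t0 t1 :
  0 <= s0 -> s0 <= s1 -> s1 <= 1 -> 0 <= t0 -> t0 <= t1 -> t1 <= 1 ->
  edge_integral (fun z => l + m * z) s0 s1 t0 t1 = 0.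
Proof.
move=> a b c a' b' c'.
have [p1 p2 p3 p4] : [/\ unit_itv s0, unit_itv s1, unit_itv t0 & unit_itv t1].
  by split; apply/andP; split; lra.
pose G z : C := l * z + m / 2 * (z * z).
have dG (K : R -> C) x k : rderiv K x k -> rderiv (fun y => G (K y)) x ((l + m * K x) * k).
  move=> dK; apply: rderiv_eq; last first.
    apply: rderivD; first by apply: (rderivM (rderiv_cst l x) dK).
    exact: (rderivM (rderiv_cst (m / 2) x) (rderivM dK dK)).
  by rewrite /=; field.
have E1 t : unit_itv t -> cint (fun x => (l + m * H x t) * Hs x t) s0 s1 = G (H s1 t) - G (H s0 t).
  move=> t01; apply: (cint_FTC (h := fun x => G (H x t))) => // x /(unit_itvW a c) x01.
    by apply: (dG (H ^~ t)); exact: Hds.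
  apply: cvgM; last exact: Hcs.
  apply: cvgD; first exact: cvg_cst.
  apply: cvgM; first exact: cvg_cst.
  exact: rderiv_continuous (Hds x01 t01).
have E2 s : unit_itv s -> cint (fun y => (l + m * H s y) * Ht s y) t0 t1 = G (H s t1) - G (H s t0).
  move=> s01; apply: (cint_FTC (h := fun x => G (H s x))) => // x /(unit_itvW a' c') x01.
    by apply: dG; exact: Hdt.
  apply: cvgM; last exact: Hct.
  apply: cvgD; first exact: cvg_cst.
  apply: cvgM; first exact: cvg_cst.
  exact: rderiv_continuous (Hdt s01 x01).
rewrite /edge_integral !E1// !E2//; ring.
Qed.

Lemma edge_integral_bound f s0 s1 t0 t1 M d : continuous_along f ->
  0 <= s0 -> s0 <= s1 -> s1 <= 1 -> 0 <= t0 -> t0 <= t1 -> t1 <= 1 ->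
  s1 - s0 <= d -> t1 - t0 <= d -> 0 <= M ->
  (forall s t, s0 <= s <= s1 -> t0 <= t <= t1 -> modulus (f (H s t)) <= M) ->
  modulus (edge_integral f s0 s1 t0 t1) <= 8 * (M * L * d).
Proof.
move=> cf a b c a' b' c' sd td M0 fM.
have [p1 p2 p3 p4] : [/\ unit_itv s0, unit_itv s1, unit_itv t0 & unit_itv t1].
  by split; apply/andP; split; lra.
have E1 t : t0 <= t <= t1 -> modulus (cint (fun x => f (H x t) * Hs x t) s0 s1) <= 2 * (M * L * d).
  move=> tt; have t01 := unit_itvW a' c' tt.
  apply: (@le_trans _ _ (2 * (M * L * (s1 - s0)))).
    apply: cint_bound => //; first by have [] := edge_cintegrable cf a c t01.
    move=> x xs; rewrite modulusM ler_pM ?modulus_ge0 ?fM ?HsL//; exact: unit_itvW a c xs.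
  by rewrite ler_pM2l// ler_wpM2l// mulr_ge0// ltW.
have E2 s : s0 <= s <= s1 -> modulus (cint (fun y => f (H s y) * Ht s y) t0 t1) <= 2 * (M * L * d).
  move=> ss; have s01 := unit_itvW a c ss.
  apply: (@le_trans _ _ (2 * (M * L * (t1 - t0)))).
    apply: cint_bound => //; first by have [] := edge_cintegrable cf a' c' s01.
    move=> x xs; rewrite modulusM ler_pM ?modulus_ge0 ?fM ?HtL//; exact: unit_itvW a' c' xs.
  by rewrite ler_pM2l// ler_wpM2l// mulr_ge0// ltW.
have -> : 8 * (M * L * d) = 2 * (M * L * d) + 2 * (M * L * d) + 2 * (M * L * d) + 2 * (M * L * d).
  by ring.
rewrite /edge_integral; apply: le_trans (modulusB _ _) _; apply: lerD; last by apply: E2; rewrite lexx.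
apply: le_trans (modulusB _ _) _; apply: lerD; last by apply: E1; rewrite lexx b'.
apply: le_trans (modulusD _ _) _; apply: lerD; first by apply: E1; rewrite lexx b'.
by apply: E2; rewrite lexx b.
Qed.

(** Goursat's theorem for a parametrized square: near each point f is affine
    up to a small error, and affine integrands have a primitive. *)
Theorem goursat f :
  (forall s t, unit_itv s -> unit_itv t -> exists l, cderiv f (H s t) l) ->
  edge_integral f 0 1 0 1 = 0.
Proof.
move=> fd; have cf := cderiv_continuous_along fd.
pose B s t d := modulus (edge_integral f s (s + d) t (t + d)).
suff : B 0 0 1 <= 0.
  by rewrite /B !add0r => B0; apply/eqP; rewrite -modulus_eq0 eq_le B0 modulus_ge0.
apply: unit_square_bisection.
  move=> s t d [d0 s0 s1 t0 t1]; rewrite /B.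
  have dd : d / 2 + d / 2 = d by rewrite -splitr.
  have <- : s + d / 2 + d / 2 = s + d by rewrite -addrA dd.
  have <- : t + d / 2 + d / 2 = t + d by rewrite -addrA dd.
  set h := d / 2 in dd *; rewrite -dd in s1 t1 d0.
  have [q1 q2 q3] : [/\ unit_itv s, unit_itv (s + h) & unit_itv (s + h + h)].
    by split; apply/andP; split; lra.
  have [r1 r2 r3] : [/\ unit_itv t, unit_itv (t + h) & unit_itv (t + h + h)].
    by split; apply/andP; split; lra.
  have S1 t' : unit_itv t' -> cint (fun x => f (H x t') * Hs x t') s (s + h + h) =
    cint (fun x => f (H x t') * Hs x t') s (s + h) + cint (fun x => f (H x t') * Hs x t') (s + h) (s + h + h).
    move=> t'01; apply: cint_split; first by apply/andP; split; lra.
    by apply: (edge_cintegrable cf _ _ t'01).1; lra.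
  have S2 s' : unit_itv s' -> cint (fun y => f (H s' y) * Ht s' y) t (t + h + h) =
    cint (fun y => f (H s' y) * Ht s' y) t (t + h) + cint (fun y => f (H s' y) * Ht s' y) (t + h) (t + h + h).
    move=> s'01; apply: cint_split; first by apply/andP; split; lra.
    by apply: (edge_cintegrable cf _ _ s'01).2; lra.
  have -> : edge_integral f s (s + h + h) t (t + h + h) =
      edge_integral f s (s + h) t (t + h) + edge_integral f (s + h) (s + h + h) t (t + h) +
      (edge_integral f s (s + h) (t + h) (t + h + h) +
       edge_integral f (s + h) (s + h + h) (t + h) (t + h + h)).
    rewrite /edge_integral S1// S1// S2// S2//; ring.
  apply: le_trans (modulusD _ _) _; apply: lerD; exact: modulusD.
move=> p q e p01 q01 e0; have [l fl] := fd p q p01 q01.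
pose e' := e / (16 * L ^+ 2).
have L2 : 0 < 16 * L ^+ 2 by rewrite mulr_gt0// exprn_gt0.
have e'0 : 0 < e' by rewrite divr_gt0.
have [d d0 dP] := fl e' e'0.
exists (d / (2 * L)); first by rewrite divr_gt0// mulr_gt0.
move=> s t h [h0 s0 s1 t0 t1] hd sp tq.
have hd' : L * (2 * h) < d.
  by move: hd; rewrite ltr_pdivlMr ?mulr_gt0// [h * _]mulrCA mulrA mulrC mulrA.
pose z0 := H p q.
pose A z : C := (f z0 - l * z0) + l * z.
have dA z : exists m, cderiv A z m.
  eexists; apply: cderivD; first exact: cderiv_cst.
  exact: (cderivM (cderiv_cst l _) (cderiv_id _)).
have cA : continuous_along A by apply: cderiv_continuous_along => s' t' _ _; exact: dA.
have cfA : continuous_along (fun z => f z - A z).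
  apply: cderiv_continuous_along => s' t' a b.
  have [k kP] := fd s' t' a b; have [m mP] := dA (H s' t').
  by exists (k - m); exact: cderivB.
rewrite /B.
have -> : edge_integral f s (s + h) t (t + h) = edge_integral (fun z => f z - A z) s (s + h) t (t + h).
  have [sh th] : s <= s + h /\ t <= t + h by split; lra.
  have E1 := edge_integralB cf cA s0 sh s1 t0 th t1.
  have E2 := edge_integral_affine (f z0 - l * z0) l s0 sh s1 t0 th t1.
  by rewrite E1 [X in _ = _ - X]E2 subr0.
have -> : e * h ^+ 2 = 8 * ((e' * (L * (2 * h))) * L * h).
  transitivity (e' * (16 * L ^+ 2) * h ^+ 2); first by rewrite /e' divfK ?lt0r_neq0.
  ring.
have sh : s <= s + h by lra.
have th : t <= t + h by lra.
apply: edge_integral_bound => //.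
- by rewrite addrAC subrr add0r.
- by rewrite addrAC subrr add0r.
- apply: mulr_ge0; first exact: ltW.
  by apply: mulr_ge0; [exact: ltW|apply: mulr_ge0; [|exact: ltW]].
move=> s' t' s's t't.
have HH : modulus (H s' t' - z0) <= L * (2 * h).
  apply: le_trans (Hlip _ _ _ _) _ => //; first exact: unit_itvW s0 s1 s's.
    exact: unit_itvW t0 t1 t't.
  rewrite ler_pM2l// (_ : 2 * h = h + h); last by ring.
  apply: lerD; rewrite ler_norml; apply/andP; split; lra.
have -> : f (H s' t') - A (H s' t') = f (H s' t') - f z0 - l * (H s' t' - z0).
  by rewrite /A; ring.
apply: le_trans (dP _ _) _; first exact: le_lt_trans HH hd'.
by rewrite ler_pM2l.
Qed.

End Goursat.

(** * Cauchy's formula *)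

Section CauchyFormula.
Variable R : realType.
Local Notation C := (Cplx R).
Implicit Types (f : C -> C) (w z a : C) (r e t s x : R) (k : R -> C).

Lemma cint_lipschitz (k dk : R -> C) (a b M : R) : 0 <= a -> b <= 1 ->
  (forall x, unit_itv x -> rderiv k x (dk x)) ->
  (forall x, unit_itv x -> continuous_at x dk) ->
  (forall x, unit_itv x -> modulus (dk x) <= M) ->
  a <= b -> modulus (k b - k a) <= 2 * M * `|b - a|.
Proof.
move=> a0 b1 kd kc kM ab.
have W x : a <= x <= b -> unit_itv x by exact: unit_itvW.
rewrite -(@cint_FTC R dk k a b)//; last 2 first.
- by move=> x /W; exact: kd.
- by move=> x /W; exact: kc.
rewrite (ger0_norm (x := b - a)) ?subr_ge0// -mulrA; apply: cint_bound => //.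
- by apply: continuous_cintegrable => x /W; exact: kc.
- by move=> x /W; exact: kM.
Qed.

(** Bounds on the partial derivatives supply the Lipschitz bound that
    Goursat's theorem asks for. *)
Lemma goursat_square (H Hs Ht : R -> R -> C) (M : R) f :
  (forall s t, unit_itv s -> unit_itv t -> rderiv (H ^~ t) s (Hs s t)) ->
  (forall s t, unit_itv s -> unit_itv t -> rderiv (H s) t (Ht s t)) ->
  (forall s t, unit_itv s -> unit_itv t -> continuous_at s (Hs ^~ t)) ->
  (forall s t, unit_itv s -> unit_itv t -> continuous_at t (Ht s)) ->
  0 < M ->
  (forall s t, unit_itv s -> unit_itv t -> modulus (Hs s t) <= M) ->
  (forall s t, unit_itv s -> unit_itv t -> modulus (Ht s t) <= M) ->
  (forall s t, unit_itv s -> unit_itv t -> exists l, cderiv f (H s t) l) ->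
  edge_integral H Hs Ht f 0 1 0 1 = 0.
Proof.
move=> ds dt cs ct M0 sM tM fd; have M2 : M <= 2 * M by lra.
apply: (@goursat R H Hs Ht (2 * M)) => //.
- by rewrite mulr_gt0.
- have L1 s s' t : unit_itv s -> unit_itv t -> unit_itv s' ->
      modulus (H s t - H s' t) <= 2 * M * `|s - s'|.
    move=> s01 t01 s'01; case/andP: (s01) => s0 s1; case/andP: (s'01) => s'0 s'1.
    have [ss'|/ltW ss'] := leP s' s.
      apply: (@cint_lipschitz (H ^~ t) (Hs ^~ t)) => // x x01;
      [exact: ds|exact: cs|exact: sM].
    rewrite modulus_distC distrC; apply: (@cint_lipschitz (H ^~ t) (Hs ^~ t)) => // x x01;
      [exact: ds|exact: cs|exact: sM].
  have L2 s t t' : unit_itv s -> unit_itv t -> unit_itv t' ->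
      modulus (H s t - H s t') <= 2 * M * `|t - t'|.
    move=> s01 t01 t'01; case/andP: (t01) => t0 t1; case/andP: (t'01) => t'0 t'1.
    have [tt'|/ltW tt'] := leP t' t.
      apply: (@cint_lipschitz (H s) (Ht s)) => // x x01;
      [exact: dt|exact: ct|exact: tM].
    rewrite modulus_distC distrC; apply: (@cint_lipschitz (H s) (Ht s)) => // x x01;
      [exact: dt|exact: ct|exact: tM].
  move=> s t s' t' s01 t01 s'01 t'01.
  apply: le_trans (modulus_distD (H s' t) _ _) _; rewrite mulrDr; apply: lerD.
    exact: L1.
  exact: L2.
- by move=> s t s01 t01; apply: le_trans (sM s t s01 t01) M2.
- by move=> s t s01 t01; apply: le_trans (tM s t s01 t01) M2.
Qed.

Lemma circle_ptE r t : circle_pt r t = cR r * circle_pt 1 t.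
Proof. by apply: ceqP; rewrite ?cReM ?cImM /= !mul1r mul0r ?subr0 ?addr0. Qed.

Lemma modulus_circle_pt r t : 0 <= r -> modulus (circle_pt r t) = r.
Proof.
move=> r0; rewrite modulusE !exprMn -mulrDr cos2Dsin2 mulr1 sqrtr_sqr ger0_norm//.
Qed.

Lemma circle_pt_neq0 r t : 0 < r -> circle_pt r t != 0.
Proof. by move=> r0; rewrite -modulus_gt0 modulus_circle_pt// ltW. Qed.

Lemma rderiv_circle_pt r t : rderiv (circle_pt r) t (Complex 0 1 * circle_pt r t).
Proof.
have -> : Complex 0 1 * circle_pt r t = Complex (r * - sin t) (r * cos t) :> C.
  by apply: ceqP; rewrite ?cReM ?cImM /=; ring.
have dc : is_derive t (1 : R) (fun x => r * cos x) (r * - sin t).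
  exact: (is_deriveZ r (is_derive_cos t)).
have ds : is_derive t (1 : R) (fun x => r * sin x) (r * cos t).
  exact: (is_deriveZ r (is_derive_sin t)).
exact: rderiv_Complex.
Qed.

Lemma rderiv_scaled_circle_pt r (T : R) t :
  rderiv (fun x => circle_pt r (T * x)) t (cR T * (Complex 0 1 * circle_pt r (T * t))).
Proof.
have -> : cR T * (Complex 0 1 * circle_pt r (T * t)) =
    Complex (r * (T * - sin (T * t))) (r * (T * cos (T * t))) :> C.
  by apply: ceqP; rewrite ?cReM ?cImM /= ?cReM ?cImM /=; ring.
have dT : is_derive t (1 : R) (fun x => T * x) T.
  have := is_deriveZ T (is_derive_id t 1).
  by rewrite /GRing.scale /= mulr1.
have dc : is_derive t (1 : R) (fun x => cos (T * x)) (T * - sin (T * t)).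
  have := is_derive1_comp (is_derive_cos (T * t)) dT.
  by rewrite mulrC.
have ds : is_derive t (1 : R) (fun x => sin (T * x)) (T * cos (T * t)).
  have := is_derive1_comp (is_derive_sin (T * t)) dT.
  by rewrite mulrC.
exact: (rderiv_Complex (is_deriveZ r dc) (is_deriveZ r ds)).
Qed.

Lemma continuous_circle_pt r t : continuous_at t (circle_pt r).
Proof. exact: rderiv_continuous (rderiv_circle_pt r t). Qed.

Lemma circle_pt_period r : circle_pt r (2 * pi) = circle_pt r 0.
Proof.
by rewrite /circle_pt mulr_natl cos2pi sin2pi cos0 sin0.
Qed.

Lemma rint_scale (u : R -> R) (T : R) : 0 < T ->
  (forall x, 0 <= x <= T -> continuous_at x u) ->
  \int[@lebesgue_measure R]_(x in `[0, T]) u x =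
  T * \int[@lebesgue_measure R]_(x in `[0, 1]) u (T * x).
Proof.
move=> T0 cu.
have dT (x : R) : is_derive x (1 : R) (fun x => T * x) T.
  have := is_deriveZ T (is_derive_id x 1).
  by rewrite /GRing.scale /= mulr1.
have dE : derive1 (fun x : R => T * x) = fun=> T.
  by apply/funext => x; rewrite derive1E; have [] := dT x.
have cT (x : R) : continuous_at x (fun x => T * x).
  by apply: differentiable_continuous; apply/derivable1_diffP; have [] := dT x.
have := @integration_by_substitution_increasing R (fun x => T * x) u 0 1 ler01.
rewrite dE mulr0 mulr1 => E.
rewrite /Rintegral E.
- have ci x : 0 <= x <= 1 -> continuous_at x (fun x => u (T * x)).
    move=> /andP[x0 x1]; apply: (continuous_comp (f := fun x => T * x)); first exact: cT.
    by apply: cu; rewrite mulr_ge0 ?(ltW T0)//= ler_piMr ?(ltW T0).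
  rewrite -[T in RHS]/(fine T%:E) -fineM//; last first.
    by apply: integrable_fin_num => //; exact: (continuous_rintegrable ci).
  rewrite -integralZl//; last exact: (continuous_rintegrable ci).
  by congr fine; apply: eq_integral => x _; rewrite /= -EFinM mulrC.
- by move=> x y _ _ xy; rewrite ltr_pM2l.
- by move=> x _; exact: cvg_cst.
- exact: is_cvg_cst.
- exact: is_cvg_cst.
- split; first by move=> x _; have [] := dT x.
  + by apply: cvg_at_right_filter; exact: cT.
  + by apply: cvg_at_left_filter; exact: cT.
- by apply: continuous_in_subspaceT => x; rewrite inE /= in_itv /= => xab; exact: cu.
Qed.

Lemma cint_scale k (T : R) : 0 < T -> (forall x, 0 <= x <= T -> continuous_at x k) ->
  cint k 0 T = cR T * cint (fun x => k (T * x)) 0 1.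
Proof.
move=> T0 ck; apply: ceqP; rewrite ?cReM ?cImM /= mul0r ?subr0 ?addr0.
  by rewrite (@rint_scale (cRe \o k))// => x xT; apply: continuous_at_cRe; exact: ck.
by rewrite (@rint_scale (cIm \o k))// => x xT; apply: continuous_at_cIm; exact: ck.
Qed.

Lemma twopi_gt0 : 0 < 2 * pi :> R.
Proof. by rewrite mulr_gt0// pi_gt0. Qed.

(** The circles interpolating linearly between the two circles sweep a region
    that avoids w. Goursat's theorem applies to this sweep, and its two radial
    edges cancel because the circles close up. *)
Lemma circle_deformation f w r e : 0 < e -> modulus w + e < r ->
  (forall z, modulus z <= r -> z != w -> exists l, cderiv f z l) ->
  cint (fun t => f (circle_pt r t) * circle_pt r t) 0 (2 * pi) =
  cint (fun t => f (w + circle_pt e t) * circle_pt e t) 0 (2 * pi).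
Proof.
move=> e0 wer fd.
have w0 := modulus_ge0 w.
pose T : R := 2 * pi; have T0 : 0 < T := twopi_gt0.
pose rad s := s * r + (1 - s) * e.
pose E t : C := circle_pt 1 (T * t).
pose H s t : C := cR (1 - s) * w + cR (rad s) * E t.
pose Hs (s t : R) : C := - w + cR (r - e) * E t.
pose Ht s t : C := cR (rad s) * (cR T * (Complex 0 1 * E t)).
have rad0 s : unit_itv s -> 0 < rad s.
  move=> /andP[s0 s1]; have -> : rad s = s * (r - e) + e by rewrite /rad; ring.
  by apply: ltr_wpDl => //; apply: mulr_ge0 => //; lra.
have radr s : unit_itv s -> rad s <= r.
  move=> /andP[s0 s1]; have -> : rad s = r - (1 - s) * (r - e) by rewrite /rad; ring.
  by rewrite lerBlDr lerDl; apply: mulr_ge0; lra.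
have Em t : modulus (E t) = 1 by rewrite modulus_circle_pt.
have dcR (c d s : R) : is_derive s (1 : R) (fun x => c + x * d) d.
  have -> : (fun x : R => c + x * d) = (fun x => c + d * x).
    by apply/funext => x; rewrite mulrC.
  have := is_deriveD (is_derive_cst c s 1) (is_deriveZ d (is_derive_id s 1)).
  by rewrite add0r [in X in is_derive _ _ _ X]/GRing.scale /= mulr1.
have dlin (c d s : R) : rderiv (fun x => cR (c + x * d) : C) s (cR d).
  exact: (rderiv_Complex (dcR c d s) (is_derive_cst _ _ _)).
have ds s t : rderiv (H ^~ t) s (Hs s t).
  rewrite /H /Hs.
  have -> : (fun x => cR (1 - x) * w + cR (rad x) * E t) =
      (fun x => cR (1 + x * (- 1)) * w + cR (e + x * (r - e)) * E t).
    by apply/funext => x; rewrite mulrN1 /rad; congr (_ + cR _ * _); ring.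
  apply: rderiv_eq; last first.
    apply: rderivD; apply: rderivM; try exact: rderiv_cst; exact: dlin.
  by rewrite /= !mulr0 !add0r cRN cR1 mulrN1 [E t * _]mulrC.
have dE t : rderiv E t (cR T * (Complex 0 1 * E t)) by exact: rderiv_scaled_circle_pt.
have dt s t : rderiv (H s) t (Ht s t).
  apply: rderiv_eq; last first.
    apply: rderivD; first exact: rderiv_cst.
    by apply: rderivM; [exact: rderiv_cst|exact: dE].
  by rewrite /= mulr0 addr0 add0r.
have cE t : continuous_at t E by exact: rderiv_continuous (dE t).
pose M : R := modulus w + (r - e) + r * T + 1.
have rT : 0 <= r * T by rewrite mulr_ge0// ltW//; lra.
have Hw s t : unit_itv s -> H s t != w.
  move=> s01; have /andP[s0 s1] := s01; apply/eqP => Hw.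
  have : cR (rad s) * E t = cR s * w.
    have -> : cR (rad s) * E t = H s t - cR (1 - s) * w by rewrite /H; ring.
    by rewrite Hw cRB cR1; ring.
  move/(congr1 (@modulus R)); rewrite !modulusM !modulus_cR Em mulr1.
  rewrite ger0_norm ?(ltW (rad0 _ s01))// ger0_norm// => h.
  have : 0 <= s * (r - e - modulus w) by apply: mulr_ge0; lra.
  have -> : s * (r - e - modulus w) = rad s - e - s * modulus w by rewrite /rad; ring.
  by rewrite h; lra.
have Hr s t : unit_itv s -> modulus (H s t) <= r.
  move=> s01; have /andP[s0 s1] := s01; apply: le_trans (modulusD _ _) _.
  rewrite !modulusM !modulus_cR Em mulr1 ger0_norm ?subr_ge0// ger0_norm ?(ltW (rad0 _ s01))//.
  have : 0 <= (1 - s) * (r - e - modulus w) by apply: mulr_ge0; lra.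
  have -> : (1 - s) * (r - e - modulus w) = r - ((1 - s) * modulus w + rad s) by rewrite /rad; ring.
  by rewrite subr_ge0.
have := @goursat_square H Hs Ht M f (fun s t _ _ => ds s t) (fun s t _ _ => dt s t).
have M0 : 0 < M by rewrite /M; lra.
have cs s t : continuous_at s (Hs ^~ t) by exact: cvg_cst.
have ct s t : continuous_at t (Ht s).
  apply: cvgM; first exact: cvg_cst.
  apply: cvgM; first exact: cvg_cst.
  by apply: cvgM; [exact: cvg_cst|exact: cE].
move=> /(_ (fun s t _ _ => cs s t) (fun s t _ _ => ct s t) M0).
have sM s t : modulus (Hs s t) <= M.
  apply: le_trans (modulusD _ _) _; rewrite modulusN modulusM modulus_cR Em mulr1 ger0_norm; last lra.
  by rewrite /M; lra.
have mi : modulus (Complex 0 1 : C) = 1 by rewrite modulusE expr0n expr1n add0r sqrtr1.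
have tM s t : unit_itv s -> modulus (Ht s t) <= M.
  move=> s01; rewrite !modulusM !modulus_cR Em mi !mulr1 !ger0_norm ?(ltW T0) ?(ltW (rad0 _ s01))//.
  have : rad s * T <= r * T by rewrite ler_pM2r// radr.
  by rewrite /M; lra.
move=> /(_ (fun s t _ _ => sM s t) (fun s t h _ => tM s t h)).
move=> /(_ (fun s t h _ => fd _ (Hr s t h) (Hw s t h))).
rewrite /edge_integral.
have HE0 : E 1 = E 0 by rewrite /E mulr1 mulr0 circle_pt_period.
have -> : (fun x => f (H x 1) * Hs x 1) = (fun x => f (H x 0) * Hs x 0).
  by apply/funext => x; rewrite /H /Hs HE0.
rewrite [X in X - _]addrAC subrr add0r => /eqP; rewrite subr_eq0 => /eqP main.
have c1 x : continuous_at x (fun t => f (circle_pt r t) * circle_pt r t).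
  apply: cvgM; last exact: continuous_circle_pt.
  have [l fl] : exists l, cderiv f (circle_pt r x) l.
    apply: fd; first by rewrite modulus_circle_pt//; lra.
    apply/eqP => h; have r0 : 0 <= r by lra.
    by move: wer; rewrite -h modulus_circle_pt// => er; lra.
  exact: (continuous_at_comp_cderiv fl (@continuous_circle_pt r x)).
have c2 x : continuous_at x (fun t => f (w + circle_pt e t) * circle_pt e t).
  apply: cvgM; last exact: continuous_circle_pt.
  have [l fl] : exists l, cderiv f (w + circle_pt e x) l.
    apply: fd; last by rewrite -subr_eq0 addrAC subrr add0r circle_pt_neq0.
    by apply: le_trans (modulusD _ _) _; rewrite modulus_circle_pt; [lra|exact: ltW].
  apply: (continuous_at_comp_cderiv (k := fun t => w + circle_pt e t) fl).
  by apply: cvgD; [exact: cvg_cst|exact: continuous_circle_pt].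
rewrite (cint_scale (k := fun t => f (circle_pt r t) * circle_pt r t))//.
rewrite (cint_scale (k := fun t => f (w + circle_pt e t) * circle_pt e t))//.
have ni : Complex 0 1 != 0 :> C by rewrite -modulus_gt0 mi.
have c3 : forall h : R -> C, (forall x, continuous_at x h) -> cintegrable (fun x => h (T * x)) 0 1.
  move=> h ch; apply: continuous_cintegrable => x _.
  apply: (continuous_comp (f := fun x => T * x)); last exact: ch.
  by apply: cvgM; [exact: cvg_cst|exact: cvg_id].
apply: (mulfI ni); rewrite mulrCA [RHS]mulrCA; congr (_ * _).
rewrite -(cintZ _ (c3 _ c1)) -(cintZ _ (c3 _ c2)).
have nT : cR T != 0 :> C by rewrite -modulus_gt0 modulus_cR normr_gt0 lt0r_neq0.
apply: (mulfI nT); rewrite -(cintZ _ (cintegrableZ _ (c3 _ c1))) -(cintZ _ (cintegrableZ _ (c3 _ c2))).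
transitivity (cint (fun y => f (H 1 y) * Ht 1 y) 0 1).
  apply: eq_cint => x _; rewrite /H /Ht /rad /E subrr cR0 mul0r add0r mul1r mul0r addr0.
  rewrite !(circle_ptE r); ring.
rewrite main; apply: eq_cint => x _; rewrite /H /Ht /rad /E subr0 mul0r add0r mul1r cR1 mul1r.
rewrite !(circle_ptE e); ring.
Qed.

End CauchyFormula.
Section CauchyTransform.
Variable R : realType.
Local Notation C := (Cplx R).
Implicit Types (f : C -> C) (w z a l : C) (r e t s x M : R) (k h : R -> C).

Definition cmeanable k := cintegrable k 0 (2 * pi).
Definition cmean k : C := cR (2 * pi)^-1 * cint k 0 (2 * pi).

Lemma continuous_cmeanable k : (forall t, continuous_at t k) -> cmeanable k.
Proof. by move=> ck; apply: continuous_cintegrable => t _; exact: ck. Qed.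

Lemma eq_cmean k h : (forall t, 0 <= t <= 2 * pi -> k t = h t) -> cmean k = cmean h.
Proof. by move=> kh; rewrite /cmean; congr (_ * _); exact: eq_cint. Qed.

Lemma cmeanD k h : cmeanable k -> cmeanable h ->
  cmean (fun t => k t + h t) = cmean k + cmean h.
Proof. by move=> ik ih; rewrite /cmean cintD// mulrDr. Qed.

Lemma cmeanB k h : cmeanable k -> cmeanable h ->
  cmean (fun t => k t - h t) = cmean k - cmean h.
Proof. by move=> ik ih; rewrite /cmean cintB// mulrBr. Qed.

Lemma cmeanZ l k : cmeanable k -> cmean (fun t => l * k t) = l * cmean k.
Proof. by move=> ik; rewrite /cmean cintZ// mulrCA. Qed.

Lemma cR_nat n : cR n%:R = n%:R :> C.
Proof. by elim: n => [//|n IH]; rewrite -[in LHS]natr1 -[in RHS]natr1 cRD IH cR1. Qed.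

Lemma cR_int (n : int) : cR n%:~R = n%:~R :> C.
Proof. by case: n => n; rewrite ?NegzE ?mulrNz ?cRN -!pmulrn cR_nat. Qed.

Lemma cmean_cst l : cmean (fun=> l) = l.
Proof.
rewrite /cmean cint_cst ?subr0 ?(ltW (twopi_gt0 R))// mulrA -cRM mulVf ?mul1r//.
exact: lt0r_neq0 (twopi_gt0 R).
Qed.

Lemma cmean_bound k M : cmeanable k ->
  (forall t, 0 <= t <= 2 * pi -> modulus (k t) <= M) -> modulus (cmean k) <= 2 * M.
Proof.
move=> ik kM; have T0 := twopi_gt0 R.
rewrite modulusM modulus_cR ger0_norm ?invr_ge0 ?(ltW T0)//.
have := cint_bound (ltW T0) ik kM; rewrite subr0 => H.
by rewrite mulrC ler_pdivrMr// -mulrA.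
Qed.

Lemma continuous_circle_fun f r : (forall z, modulus z = r -> exists l, cderiv f z l) ->
  0 <= r -> forall t, continuous_at t (fun t => f (circle_pt r t)).
Proof.
move=> fd r0 t; have [l fl] := fd (circle_pt r t) (modulus_circle_pt t r0).
exact: (continuous_at_comp_cderiv fl (@continuous_circle_pt R r t)).
Qed.

Lemma circle_ptB_neq0 r w t : modulus w < r -> circle_pt r t - w != 0.
Proof.
move=> wr; rewrite subr_eq0; apply/eqP => h; move: (wr); rewrite -h modulus_circle_pt ?ltxx//.
exact: le_trans (modulus_ge0 w) (ltW wr).
Qed.

Lemma circle_ptB_ge r w t : 0 <= r -> r - modulus w <= modulus (circle_pt r t - w).
Proof. by move=> r0; apply: le_trans (lerB_modulus _ _); rewrite modulus_circle_pt. Qed.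

Lemma continuous_atM k h t : continuous_at t k -> continuous_at t h ->
  continuous_at t (fun t => k t * h t).
Proof. move=> ck ch; apply: (cvgM ck ch). Qed.

(** Deform the circle to a small circle about w, on which f is close to f w. *)
Theorem cauchy_formula f w r : modulus w < r ->
  (forall z, modulus z <= r -> exists l, cderiv f z l) ->
  cmean (fun t => f (circle_pt r t) * (circle_pt r t * (circle_pt r t - w)^-1)) = f w.
Proof.
move=> wr fd.
have r0 : 0 < r by exact: le_lt_trans (modulus_ge0 w) wr.
apply/eqP; rewrite -subr_eq0 -modulus_eq0 eq_le modulus_ge0 andbT.
apply/ler_addgt0Pl => e e0; rewrite addr0.
have [l fl] := fd w (ltW wr).
have [d d0 dP] := cderiv_cont fl (divr_gt0 e0 (ltr0Sn R 1)).
pose p := Num.min d (r - modulus w) / 2.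
have m0 : 0 < Num.min d (r - modulus w) by rewrite lt_min d0 subr_gt0.
have p0 : 0 < p by rewrite divr_gt0.
have [pd pr] : p < d /\ modulus w + p < r.
  have : p < Num.min d (r - modulus w) by rewrite /p ltr_pdivrMr// ltr_pMr ?ltr1n.
  by rewrite lt_min => /andP[? ?]; split=> //; lra.
have := @circle_deformation R (fun z => f z * (z - w)^-1) w r p p0 pr.
have dq z : modulus z <= r -> z != w -> exists l, cderiv (fun z => f z * (z - w)^-1) z l.
  move=> zr zw; have [m fm] := fd z zr; eexists.
  apply: cderivM; first exact: fm.
  apply: (cderivV (f := fun z => z - w)); first by rewrite subr_eq0.
  apply: cderivB; [exact: cderiv_id|exact: cderiv_cst].
move=> /(_ dq) E.
have cfp t : continuous_at t (fun t => f (w + circle_pt p t)).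
  have [m fm] : exists l, cderiv f (w + circle_pt p t) l.
    by apply: fd; apply: le_trans (modulusD _ _) _; rewrite modulus_circle_pt ?(ltW p0)// ltW.
  apply: (continuous_at_comp_cderiv (k := fun t => w + circle_pt p t) fm).
  by apply: cvgD; [exact: cvg_cst|exact: continuous_circle_pt].
have -> : cmean (fun t => f (circle_pt r t) * (circle_pt r t * (circle_pt r t - w)^-1)) =
    cmean (fun t => f (w + circle_pt p t)).
  rewrite /cmean; congr (_ * _).
  transitivity (cint (fun t => f (circle_pt r t) * (circle_pt r t - w)^-1 * circle_pt r t) 0 (2 * pi)).
    by apply: eq_cint => t _; rewrite mulrAC mulrA.
  rewrite E; apply: eq_cint => t _.
  have -> : w + circle_pt p t - w = circle_pt p t by ring.
  by rewrite divfK// circle_pt_neq0.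
rewrite -[f w]cmean_cst -cmeanB//; last 2 first.
- exact: continuous_cmeanable.
- by apply: continuous_cmeanable => t; exact: cvg_cst.
have -> : e = 2 * (e / 2) by rewrite mulrC divfK.
apply: cmean_bound.
  by apply: continuous_cmeanable => t; apply: (cvgB (@cfp t)); exact: cvg_cst.
move=> t _; apply/ltW/dP.
have -> : w + circle_pt p t - w = circle_pt p t by ring.
by rewrite modulus_circle_pt// ltW.
Qed.

Lemma mean_value f r : 0 < r -> (forall z, modulus z <= r -> exists l, cderiv f z l) ->
  cmean (fun t => f (circle_pt r t)) = f 0.
Proof.
move=> r0 fd; rewrite -(cauchy_formula _ fd) ?modulus0//.
by apply: eq_cmean => t _; rewrite subr0 mulfV ?mulr1// circle_pt_neq0.
Qed.

Lemma cderiv_quadratic f a l d (K : R) : 0 < d -> 0 <= K ->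
  (forall z, modulus (z - a) < d ->
    modulus (f z - f a - l * (z - a)) <= K * modulus (z - a) ^+ 2) -> cderiv f a l.
Proof.
move=> d0 K0 H e e0; have K1 : 0 < K + 1 by lra.
exists (Num.min d (e / (K + 1))); first by rewrite lt_min d0 divr_gt0.
move=> z; rewrite lt_min => /andP[/H zd ze]; apply: le_trans zd _.
rewrite expr2 mulrA; apply: ler_wpM2r; first exact: modulus_ge0.
move: ze; rewrite ltr_pdivlMr// => /ltW; apply: le_trans.
by rewrite mulrC; apply: ler_wpM2l; [exact: modulus_ge0|lra].
Qed.

Lemma continuous_bounded k (a b : R) : a <= b ->
  (forall t, a <= t <= b -> continuous_at t k) ->
  exists2 M, 0 < M & forall t, a <= t <= b -> modulus (k t) <= M.
Proof.
move=> ab ck.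
have bd (u : R -> R) : (forall t, a <= t <= b -> continuous_at t u) ->
    exists M, forall t, a <= t <= b -> `|u t| <= M.
  move=> cu.
  have cn : {within `[a, b], continuous (fun t => `|u t|)}.
    apply: continuous_in_subspaceT => x; rewrite inE /= in_itv /= => xab.
    by apply: (continuous_comp (f := u) (g := Num.norm)); [exact: cu|exact: norm_continuous].
  have [c _ cP] := EVT_max ab cn.
  by exists `|u c| => t tab; apply: cP; rewrite in_itv.
have /bd[M1 M1P] : forall t, a <= t <= b -> continuous_at t (cRe \o k).
  by move=> t tab; apply: continuous_at_cRe; exact: ck.
have /bd[M2 M2P] : forall t, a <= t <= b -> continuous_at t (cIm \o k).
  by move=> t tab; apply: continuous_at_cIm; exact: ck.
exists (`|M1| + `|M2| + 1) => [|t tab].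
  by have := normr_ge0 M1; have := normr_ge0 M2; lra.
apply: le_trans (modulus_le_ReIm _) _.
have := M1P t tab; have := M2P t tab; rewrite /=.
have := ler_norm M1; have := ler_norm M2; lra.
Qed.

Definition cauchy_transform j k r w := cmean (fun t => k t * (circle_pt r t - w) ^- j).

Lemma continuous_cauchy_kernel j k r w : modulus w < r ->
  (forall t, continuous_at t k) ->
  forall t, continuous_at t (fun t => k t * (circle_pt r t - w) ^- j).
Proof.
move=> wr ck t; apply: continuous_atM; first exact: ck.
apply: cvgV; first by rewrite expf_neq0// circle_ptB_neq0.
elim: j => [|j IH]; first exact: cvg_cst.
under eq_fun do rewrite exprS; rewrite exprS.
apply: (continuous_atM (k := fun t => circle_pt r t - w)); last exact: IH.
by apply: cvgB; [exact: continuous_circle_pt|exact: cvg_cst].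
Qed.

(** Differentiation under the integral sign: the second-order remainder of the
    kernel is bounded on the circle, uniformly for nearby points. *)
Lemma cderiv_cauchy_transform j k r w (c K d : R) :
  0 < d -> 0 <= K -> modulus w + d <= r ->
  (forall t, continuous_at t k) ->
  (forall z t, modulus (z - w) < d -> 0 <= t <= 2 * pi ->
    modulus (k t * (circle_pt r t - z) ^- j - k t * (circle_pt r t - w) ^- j -
      (cR c * (k t * (circle_pt r t - w) ^- j.+1)) * (z - w)) <= K * modulus (z - w) ^+ 2) ->
  cderiv (cauchy_transform j k r) w (cR c * cauchy_transform j.+1 k r w).
Proof.
move=> d0 K0 wdr ck H; apply: (@cderiv_quadratic _ _ _ d (2 * K)) => //.
  by rewrite mulr_ge0.
move=> z zd.
have wr : modulus w < r by lra.
have zr : modulus z < r.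
  by have := modulusD (z - w) w; rewrite subrK => h; lra.
have I1 := continuous_cmeanable (@continuous_cauchy_kernel j k r z zr ck).
have I2 := continuous_cmeanable (@continuous_cauchy_kernel j k r w wr ck).
have I3 := continuous_cmeanable (@continuous_cauchy_kernel j.+1 k r w wr ck).
have -> : cauchy_transform j k r z - cauchy_transform j k r w -
    cR c * cauchy_transform j.+1 k r w * (z - w) =
    cmean (fun t => (k t * (circle_pt r t - z) ^- j - k t * (circle_pt r t - w) ^- j) -
      (cR c * (z - w)) * (k t * (circle_pt r t - w) ^- j.+1)).
  rewrite cmeanB; last 2 first.
  - exact: cintegrableB.
  - exact: cintegrableZ.
  by rewrite cmeanB// cmeanZ// mulrAC.
rewrite -mulrA; apply: cmean_bound.
  apply: cintegrableB; [exact: cintegrableB|exact: cintegrableZ].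
by move=> t tT; have := H z t zd tT; rewrite [_ * (z - w)]mulrAC.
Qed.

Lemma cderiv_cauchy_transform1 k r w : modulus w < r -> (forall t, continuous_at t k) ->
  cderiv (cauchy_transform 1 k r) w (cauchy_transform 2 k r w).
Proof.
move=> wr ck.
have r0 : 0 < r := le_lt_trans (modulus_ge0 w) wr.
have [M M0 kM] := continuous_bounded (ltW (twopi_gt0 R)) (fun t _ => ck t).
pose d := (r - modulus w) / 2; have d0 : 0 < d by rewrite divr_gt0// subr_gt0.
rewrite -[cauchy_transform 2 k r w]mul1r -cR1.
apply: (@cderiv_cauchy_transform 1 k r w 1 (M * (d ^- 2 * d^-1)) d) => //.
- by rewrite !mulr_ge0 ?invr_ge0 ?exprn_ge0 ?(ltW d0) ?(ltW M0).
- by rewrite /d; lra.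
move=> z t zd tT; set A := circle_pt r t - w.
have hA : circle_pt r t - z = A - (z - w) by rewrite /A; ring.
have Ad : d <= modulus A by have := circle_ptB_ge w t (ltW r0); rewrite /d -/A; lra.
have Bd : d <= modulus (A - (z - w)).
  have := lerB_modulus A (z - w); have := circle_ptB_ge w t (ltW r0).
  by rewrite -/A /d; move: zd; rewrite /d; lra.
have A0 : A != 0 by rewrite -modulus_gt0; lra.
have B0 : A - (z - w) != 0 by rewrite -modulus_gt0; lra.
rewrite hA cR1; set h := z - w in B0 Bd *.
have -> : k t * (A - h) ^- 1 - k t * A ^- 1 - 1 * (k t * A ^- 2) * h =
   k t * (A ^- 2 * (A - h)^-1) * h ^+ 2.
  by field; rewrite B0 A0.
rewrite modulusM modulusX; apply: ler_wpM2r; first by rewrite exprn_ge0// modulus_ge0.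
rewrite modulusM; apply: ler_pM; rewrite ?modulus_ge0 ?kM//.
rewrite modulusM; apply: ler_pM; rewrite ?modulus_ge0//.
  rewrite modulusV modulusX lef_pV2 ?posrE ?exprn_gt0//; last lra.
  by rewrite lerXn2r ?nnegrE ?modulus_ge0// ltW.
by rewrite modulusV lef_pV2 ?posrE//; lra.
Qed.

Lemma cderiv_cauchy_transform2 k r w : modulus w < r -> (forall t, continuous_at t k) ->
  cderiv (cauchy_transform 2 k r) w (cR 2 * cauchy_transform 3 k r w).
Proof.
move=> wr ck.
have r0 : 0 < r := le_lt_trans (modulus_ge0 w) wr.
have [M M0 kM] := continuous_bounded (ltW (twopi_gt0 R)) (fun t _ => ck t).
pose d := (r - modulus w) / 2; have d0 : 0 < d by rewrite divr_gt0// subr_gt0.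
apply: (@cderiv_cauchy_transform 2 k r w 2 (M * ((d ^- 3 * d ^- 2) * (8 * r))) d) => //.
- by rewrite !mulr_ge0 ?invr_ge0 ?exprn_ge0 ?(ltW d0) ?(ltW M0) ?(ltW r0).
- by rewrite /d; lra.
move=> z t zd tT; set A := circle_pt r t - w.
have w0 := modulus_ge0 w.
have hA : circle_pt r t - z = A - (z - w) by rewrite /A; ring.
have Ar : modulus A <= 2 * r.
  by apply: le_trans (modulusB _ _) _; rewrite modulus_circle_pt ?(ltW r0)//; lra.
have Ad : d <= modulus A by have := circle_ptB_ge w t (ltW r0); rewrite /d -/A; lra.
have Bd : d <= modulus (A - (z - w)).
  have := lerB_modulus A (z - w); have := circle_ptB_ge w t (ltW r0).
  by rewrite -/A /d; move: zd; rewrite /d; lra.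
have A0 : A != 0 by rewrite -modulus_gt0; lra.
have B0 : A - (z - w) != 0 by rewrite -modulus_gt0; lra.
rewrite hA; set h := z - w in B0 Bd zd *.
have -> : k t * (A - h) ^- 2 - k t * A ^- 2 - cR 2 * (k t * A ^- 3) * h =
   k t * ((A ^- 3 * (A - h) ^- 2) * (cR 3 * A - cR 2 * h)) * h ^+ 2.
  rewrite (cR_nat 2) (cR_nat 3).
  by field; rewrite B0 A0.
have h2 : modulus (cR 3 * A - cR 2 * h) <= 8 * r.
  apply: le_trans (modulusB _ _) _; rewrite !modulusM !modulus_cR !ger0_norm//.
  by move: zd; rewrite /d; lra.
rewrite modulusM modulusX; apply: ler_wpM2r; first by rewrite exprn_ge0// modulus_ge0.
rewrite modulusM; apply: ler_pM; rewrite ?modulus_ge0 ?kM//.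
rewrite modulusM; apply: ler_pM; rewrite ?modulus_ge0//.
rewrite modulusM; apply: ler_pM; rewrite ?modulus_ge0//.
  rewrite modulusV modulusX lef_pV2 ?posrE ?exprn_gt0//; last lra.
  by rewrite lerXn2r ?nnegrE ?modulus_ge0// ltW.
rewrite modulusV modulusX lef_pV2 ?posrE ?exprn_gt0//; last lra.
by rewrite lerXn2r ?nnegrE ?modulus_ge0// ltW.
Qed.

End CauchyTransform.

(** * Taylor expansion *)

Section TaylorRemainder.
Variable R : realType.
Local Notation C := (Cplx R).
Implicit Types (f g u : C -> C) (w z a l : C) (r e t M : R).

Lemma cderiv_shift f a z l : cderiv f (a + z) l -> cderiv (fun y => f (a + y)) z l.
Proof.
move=> fl e e0; have [d d0 dP] := fl e e0; exists d => // y yd.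
have E : y - z = a + y - (a + z) by ring.
by rewrite E; apply: dP; rewrite -E.
Qed.

Variables (f : C -> C) (r : R).
Hypothesis fd : forall z, modulus z <= r -> exists l, cderiv f z l.

(** Dividing the Cauchy density by zeta^n gives the n-th Taylor remainder
    divided by w^n. *)
Definition taylor_rem n := cauchy_transform 1
  (fun t => f (circle_pt r t) * (circle_pt r t * circle_pt r t ^- n)) r.

Lemma continuous_taylor_density n : 0 < r -> forall t,
  continuous_at t (fun t => f (circle_pt r t) * (circle_pt r t * circle_pt r t ^- n)).
Proof.
move=> r0 t; apply: continuous_atM.
  by apply: continuous_circle_fun; [move=> z zr; apply: fd; rewrite zr|exact: ltW].
apply: continuous_atM; first exact: continuous_circle_pt.
apply: cvgV; first by rewrite expf_neq0// circle_pt_neq0.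
elim: n => [|n IH]; first exact: cvg_cst.
under eq_fun do rewrite exprS; rewrite exprS.
apply: (@continuous_atM R (circle_pt r)); [exact: continuous_circle_pt|exact: IH].
Qed.

Lemma radius_gt0 w : modulus w < r -> 0 < r.
Proof. exact: le_lt_trans (modulus_ge0 w). Qed.

Lemma taylor_rem0 w : modulus w < r -> taylor_rem 0 w = f w.
Proof.
move=> wr; rewrite -(cauchy_formula wr fd); apply: eq_cmean => t _.
by rewrite expr0 invr1 mulr1 expr1 mulrA.
Qed.

(** Partial fractions: 1 / (zeta - w) = 1 / zeta + (w / zeta) / (zeta - w). *)
Lemma taylor_remS n w : modulus w < r ->
  taylor_rem n w = taylor_rem n 0 + w * taylor_rem n.+1 w.
Proof.
move=> wr; have r0 := radius_gt0 wr.
have zr : modulus (0 : C) < r by rewrite modulus0.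
have I0 := continuous_cmeanable (@continuous_cauchy_kernel R 1 _ r 0 zr (@continuous_taylor_density n r0)).
have I1 := continuous_cmeanable (@continuous_cauchy_kernel R 1 _ r w wr (@continuous_taylor_density n.+1 r0)).
rewrite /taylor_rem /cauchy_transform -cmeanZ// -cmeanD//; last exact: cintegrableZ.
apply: eq_cmean => t _; rewrite subr0.
have c0 := circle_pt_neq0 t r0; have cw := circle_ptB_neq0 t wr.
rewrite !expr1 exprS invfM; set c := circle_pt r t in c0 cw *; set q := c ^- n.
by field; rewrite cw c0.
Qed.

Lemma cderiv_taylor_rem n w : modulus w < r -> exists l, cderiv (taylor_rem n) w l.
Proof.
move=> wr; eexists; apply: cderiv_cauchy_transform1 => //.
exact: continuous_taylor_density (radius_gt0 wr).
Qed.

Lemma taylor_expansion n w : modulus w < r ->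
  f w = \sum_(i < n) taylor_rem i 0 * w ^+ i + w ^+ n * taylor_rem n w.
Proof.
move=> wr; elim: n => [|n IH]; first by rewrite big_ord0 add0r expr0 mul1r taylor_rem0.
rewrite big_ord_recr /= IH {1}(taylor_remS n wr) exprSr; ring.
Qed.

Lemma taylor_rem_bound : 0 < r -> exists2 M, 0 < M & forall n w, modulus w < r ->
  modulus (w ^+ n * taylor_rem n w) <= M / (r - modulus w) * (modulus w / r) ^+ n.
Proof.
move=> r0.
have [M M0 MP] := continuous_bounded (ltW (twopi_gt0 R)) (fun t _ => @continuous_taylor_density 0 r0 t).
exists (2 * M) => [|n w wr]; first by rewrite mulr_gt0.
have I1 := continuous_cmeanable (@continuous_cauchy_kernel R 1 _ r w wr (@continuous_taylor_density n r0)).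
rewrite modulusM modulusX mulrC expr_div_n mulrA [leRHS]mulrAC.
apply: ler_wpM2r; first by rewrite exprn_ge0// modulus_ge0.
rewrite -!mulrA; apply: cmean_bound => // t tT.
have cr := modulus_circle_pt t (ltW r0).
have := MP t tT; rewrite expr0 invr1 mulr1 => h.
have -> : f (circle_pt r t) * (circle_pt r t * circle_pt r t ^- n) * (circle_pt r t - w) ^- 1 =
  (f (circle_pt r t) * circle_pt r t) * ((circle_pt r t - w)^-1 * circle_pt r t ^- n).
  rewrite expr1; ring.
rewrite modulusM; apply: ler_pM; rewrite ?modulus_ge0//.
rewrite modulusM; apply: ler_pM; rewrite ?modulus_ge0//.
  rewrite modulusV lef_pV2 ?posrE ?subr_gt0//; first exact: circle_ptB_ge (ltW r0).
  by rewrite modulus_gt0 circle_ptB_neq0.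
by rewrite modulusV modulusX cr.
Qed.

Lemma ratio_exp_small (q e : R) : 0 <= q < 1 -> 0 < e -> exists n, q ^+ n < e.
Proof.
move=> /andP[q0 q1] e0.
have q1' : `|q| < 1 by rewrite ger0_norm.
have := cvg_expr q1'; move/cvgrPdist_lt => /(_ e e0)[N _ NP].
exists N; have := NP N (leqnn N); rewrite sub0r normrN normrX ger0_norm//.
Qed.

Lemma taylor_tail w e : modulus w < r -> 0 < e ->
  exists N, forall n, (N <= n)%N -> modulus (w ^+ n * taylor_rem n w) < e.
Proof.
move=> wr e0; have r0 := radius_gt0 wr; have [M M0 MP] := taylor_rem_bound r0.
have K0 : 0 < M / (r - modulus w) by rewrite divr_gt0// subr_gt0.
have q01 : 0 <= modulus w / r < 1.
  by rewrite divr_ge0 ?modulus_ge0 ?(ltW r0)//= ltr_pdivrMr// mul1r.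
have [N NP] := ratio_exp_small q01 (divr_gt0 e0 K0).
exists N => n Nn; apply: le_lt_trans (MP n w wr) _.
rewrite mulrC -ltr_pdivlMr//; apply: le_lt_trans NP.
by case/andP: q01 => q0 q1; apply: ler_wiXn2l => //; exact: ltW.
Qed.

(** If all Taylor coefficients vanish, f equals its own remainders, which tend
    to 0; otherwise the first nonvanishing coefficient gives k. *)
Lemma zero_or_order : 0 < r ->
  (forall w, modulus w < r -> f w = 0) \/
  exists k u, [/\ forall w, modulus w < r -> exists l, cderiv u w l, u 0 != 0
    & forall w, modulus w < r -> f w = w ^+ k * u w].
Proof.
move=> r0; have [all0|] := pselect (forall n, taylor_rem n 0 = 0).
  left => w wr; apply/eqP; rewrite -modulus_eq0 eq_le modulus_ge0 andbT.
  apply/ler_addgt0Pl => e e0; rewrite addr0.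
  have [N /(_ N (leqnn N)) H] := taylor_tail wr e0.
  rewrite (taylor_expansion N wr) big1 ?add0r; first exact: ltW.
  by move=> i _; rewrite all0 mul0r.
move=> /existsNP ex; right.
have {}ex : exists n, taylor_rem n 0 != 0 by have [n /eqP] := ex; exists n.
pose k := ex_minn ex; exists k, (taylor_rem k); split.
- by move=> w; exact: cderiv_taylor_rem.
- by rewrite /k; case: ex_minnP.
- move=> w wr; rewrite (taylor_expansion k wr) big1 ?add0r// => i _.
  have -> : taylor_rem i 0 = 0; last by rewrite mul0r.
  move: (ltn_ord i); move: (nat_of_ord i) => j; apply: contraTeq => h; rewrite /k.
  by case: ex_minnP => m _ /(_ j h) mj; rewrite -leqNgt.
Qed.

Lemma cderiv_cauchy w : modulus w < r ->
  cderiv f w (cauchy_transform 2 (fun t => f (circle_pt r t) * circle_pt r t) r w).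
Proof.
move=> wr; have r0 := radius_gt0 wr.
have ck t : continuous_at t (fun t => f (circle_pt r t) * circle_pt r t).
  have := @continuous_taylor_density 0 r0 t.
  by under eq_fun do rewrite expr0 invr1 mulr1.
apply: cderiv_near (cderiv_cauchy_transform1 wr ck).
apply/near_modulusP; exists (r - modulus w); first by rewrite subr_gt0.
move=> z zw; have zr : modulus z < r.
  by have := modulusD (z - w) w; rewrite subrK => h; lra.
by rewrite -(cauchy_formula zr fd); apply: eq_cmean => t _; rewrite expr1 mulrA.
Qed.

Lemma derive1_cauchy w : modulus w < r ->
  derive1 f w = cauchy_transform 2 (fun t => f (circle_pt r t) * circle_pt r t) r w.
Proof. by move=> wr; have /cderivP[] := cderiv_cauchy wr. Qed.

(** The derivative is again a Cauchy transform. *)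
Lemma cderiv_derive1 w : modulus w < r -> exists l, cderiv (derive1 f) w l.
Proof.
move=> wr; have r0 := radius_gt0 wr; eexists.
have ck t : continuous_at t (fun t => f (circle_pt r t) * circle_pt r t).
  have := @continuous_taylor_density 0 r0 t.
  by under eq_fun do rewrite expr0 invr1 mulr1.
apply: cderiv_near (cderiv_cauchy_transform2 wr ck).
apply/near_modulusP; exists (r - modulus w); first by rewrite subr_gt0.
move=> z zw; rewrite derive1_cauchy//.
by have := modulusD (z - w) w; rewrite subrK => h; lra.
Qed.

End TaylorRemainder.

(** * The logarithm of a zero-free function *)

Section LogModulus.
Variable R : realType.
Local Notation C := (Cplx R).
Implicit Types (f g h : C -> C) (w z a l : C) (r e t x M rho : R) (k : R -> C).

Lemma is_derive_small (u : R -> R) x (l : R) :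
  (forall e, 0 < e -> exists2 d : R, 0 < d & forall y, `|y - x| < d ->
     `|u y - u x - l * (y - x)| <= e * `|y - x|) -> is_derive x (1 : R) u l.
Proof.
move=> ul; have cl : (fun h : R => h^-1 *: (u (h *: (1 : R) + x) - u x)) @ 0^' --> l.
  apply/cvgrPdist_lt => e e0.
  have [d d0 dP] := ul (e / 2) (divr_gt0 e0 (ltr0Sn _ _)).
  rewrite near_withinE; apply/nbhs_normP; exists d => // h /=; rewrite sub0r normrN => hd h0.
  have := dP (h + x); rewrite addrK => /(_ hd) H.
  rewrite /GRing.scale /= mulr1 distrC.
  have -> : h^-1 * (u (h + x) - u x) - l = h^-1 * (u (h + x) - u x - l * h) by field.
  rewrite normrM normfV mulrC ltr_pdivrMr ?normr_gt0// (le_lt_trans H)//.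
  by rewrite ltr_pM2r ?normr_gt0// ltr_pdivrMr ?ltr_pMr ?ltr1n.
apply: DeriveDef; first by apply/cvg_ex; exists l.
exact/cvg_lim.
Qed.

Lemma rderiv_small k x l :
  (forall e, 0 < e -> exists2 d : R, 0 < d & forall y, `|y - x| < d ->
     modulus (k y - k x - l * cR (y - x)) <= e * `|y - x|) -> rderiv k x l.
Proof.
move=> H; split; apply: is_derive_small => e /H[d d0 dP]; exists d => // y yd;
  apply: le_trans (dP y yd).
- apply: le_trans (cRe_le_modulus _); rewrite !cReB cReM /= mulr0 subr0.
  exact: lexx.
- apply: le_trans (cIm_le_modulus _); rewrite !cImB cImM /= mulr0 add0r.
  exact: lexx.
Qed.

Lemma rderiv_line f z x l : cderiv f (cR x * z) l -> rderiv (fun y => f (cR y * z)) x (l * z).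
Proof.
move=> fl; apply: rderiv_small => e e0; have z0 := modulus_ge0 z.
have z1 : 0 < modulus z + 1 by lra.
have [d d0 dP] := fl (e / (modulus z + 1)) (divr_gt0 e0 z1).
exists (d / (modulus z + 1)); first by rewrite divr_gt0.
move=> y; rewrite ltr_pdivlMr// => yd.
have E : cR y * z - cR x * z = cR (y - x) * z by rewrite cRB mulrBl.
have M1 : modulus (cR (y - x) * z) <= `|y - x| * (modulus z + 1).
  by rewrite modulusM modulus_cR ler_wpM2l// lerDl.
have := dP (cR y * z); rewrite E => /(_ (le_lt_trans M1 yd)) H.
rewrite mulrAC -mulrA; apply: le_trans H _.
rewrite mulrAC ler_pdivrMr// -mulrA; apply: ler_wpM2l M1; exact: ltW.
Qed.

Lemma continuous_line z x : continuous_at x (fun y => cR y * z : C).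
Proof.
apply: continuous_atM; last exact: cvg_cst.
by apply: continuous_at_cR; exact: cvg_id.
Qed.

Lemma continuous_along_line f z x l : cderiv f (cR x * z) l ->
  continuous_at x (fun y => f (cR y * z)).
Proof. by move=> fl; apply: (continuous_at_comp_cderiv fl); exact: continuous_line. Qed.

Definition ray_primitive f z := cint (fun t => f (cR t * z) * z) 0 1.

Section RayPrimitive.
Variables (f : C -> C) (r : R).
Hypothesis fd : forall z, modulus z < r -> exists l, cderiv f z l.

Lemma modulus_ray x z : unit_itv x -> modulus (cR x * z) <= modulus z.
Proof.
by move=> /andP[x0 x1]; rewrite modulusM modulus_cR ger0_norm// ler_piMl// modulus_ge0.
Qed.

(** Goursat's theorem on the triangle with vertices 0, z and z + w. *)
Lemma ray_primitive_increment z w : modulus z + modulus w < r ->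
  ray_primitive f (z + w) - ray_primitive f z = cint (fun s => f (z + cR s * w) * w) 0 1.
Proof.
move=> zwr; have z0 := modulus_ge0 z; have w0 := modulus_ge0 w.
pose H s t : C := cR t * (z + cR s * w).
pose Hs (s t : R) : C := cR t * w.
pose Ht (s t : R) : C := z + cR s * w.
have dcR x : rderiv (fun y => cR y : C) x 1.
  have -> : (1 : C) = Complex 1 0 by [].
  exact: (rderiv_Complex (is_derive_id x (1 : R)) (is_derive_cst _ _ _)).
have ds s t : rderiv (H ^~ t) s (Hs s t).
  apply: rderiv_eq; last first.
    apply: rderivM; first exact: rderiv_cst.
    apply: rderivD; first exact: rderiv_cst.
    by apply: rderivM; [exact: dcR|exact: rderiv_cst].
  rewrite /Hs /=; ring.
have dt s t : rderiv (H s) t (Ht s t).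
  apply: rderiv_eq; last first.
    by apply: rderivM; [exact: dcR|exact: rderiv_cst].
  rewrite /Ht /=; ring.
have Hb s : unit_itv s -> modulus (z + cR s * w) <= modulus z + modulus w.
  by move=> s01; apply: le_trans (modulusD _ _) _; rewrite lerD2l modulus_ray.
have := @goursat_square R H Hs Ht (modulus z + modulus w + 1) f
  (fun s t _ _ => ds s t) (fun s t _ _ => dt s t).
have cs s t : continuous_at s (Hs ^~ t) by exact: cvg_cst.
have ct s t : continuous_at t (Ht s) by exact: cvg_cst.
have M0 : 0 < modulus z + modulus w + 1 by lra.
move=> /(_ (fun s t _ _ => cs s t) (fun s t _ _ => ct s t) M0).
have sM s t : unit_itv t -> modulus (Hs s t) <= modulus z + modulus w + 1.
  by move=> t01; apply: le_trans (modulus_ray _ t01) _; lra.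
have tM s t : unit_itv s -> modulus (Ht s t) <= modulus z + modulus w + 1.
  by move=> s01; apply: le_trans (Hb s s01) _; lra.
move=> /(_ (fun s t _ t01 => sM s t t01) (fun s t s01 _ => tM s t s01)).
have fH s t : unit_itv s -> unit_itv t -> exists l, cderiv f (H s t) l.
  move=> s01 t01; apply: fd; apply: le_lt_trans zwr.
  exact: le_trans (modulus_ray _ t01) (Hb s s01).
move=> /(_ fH).
have E0 : cint (fun x => f (H x 0) * Hs x 0) 0 1 = 0.
  rewrite (@eq_cint _ _ (fun=> 0)) ?cint_cst ?mulr0// => x _.
  by rewrite /Hs cR0 mul0r mulr0.
have E1 : cint (fun x => f (H x 1) * Hs x 1) 0 1 = cint (fun s => f (z + cR s * w) * w) 0 1.
  by apply: eq_cint => x _; rewrite /H /Hs cR1 !mul1r.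
have E2 : cint (fun y => f (H 1 y) * Ht 1 y) 0 1 = ray_primitive f (z + w).
  by apply: eq_cint => x _; rewrite /H /Ht cR1 !mul1r.
have E3 : cint (fun y => f (H 0 y) * Ht 0 y) 0 1 = ray_primitive f z.
  by apply: eq_cint => x _; rewrite /H /Ht cR0 !mul0r !addr0.
rewrite /edge_integral E0 E1 E2 E3 add0r => /eqP; rewrite addrAC subr_eq0 => /eqP.
by [].
Qed.

Lemma cderiv_ray_primitive z : modulus z < r -> cderiv (ray_primitive f) z (f z).
Proof.
move=> zr; have [l fl] := fd zr => e e0.
have [d d0 dP] := cderiv_cont fl (divr_gt0 e0 (ltr0Sn R 1)).
exists (Num.min d (r - modulus z)); first by rewrite lt_min d0 subr_gt0.
move=> y; rewrite lt_min => /andP[yd yr]; set w := y - z in yd yr *.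
have zwr : modulus z + modulus w < r by lra.
have zwE : y = z + w by rewrite /w; ring.
have w0 := modulus_ge0 w.
have W s : unit_itv s -> modulus (z + cR s * w) < r.
  by move=> s01; apply: le_lt_trans (modulusD _ _) _; apply: le_lt_trans zwr; rewrite lerD2l modulus_ray.
have cw x : unit_itv x -> continuous_at x (fun s => f (z + cR s * w) * w).
  move=> x01; have [m fm] := fd (W x x01).
  apply: continuous_atM; last exact: cvg_cst.
  apply: (continuous_at_comp_cderiv (k := fun s => z + cR s * w) fm).
  by apply: cvgD; [exact: cvg_cst|exact: continuous_line].
rewrite zwE ray_primitive_increment//.
have -> : f z * w = cint (fun=> f z * w) 0 1 by rewrite cint_cst// subr0 cR1 mul1r.
have I1 : cintegrable (fun s => f (z + cR s * w) * w) 0 1 by exact: continuous_cintegrable.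
have I2 : cintegrable (fun=> f z * w) 0 1.
  by apply: continuous_cintegrable => x _; exact: cvg_cst.
rewrite -cintB//.
have -> : e * modulus w = 2 * ((e / 2 * modulus w) * (1 - 0)) by rewrite subr0; field.
apply: cint_bound => //; first exact: cintegrableB.
move=> x x01; rewrite -mulrBl modulusM; apply: ler_wpM2r => //.
apply/ltW/dP; rewrite (_ : z + cR x * w - z = cR x * w); last by ring.
exact: le_lt_trans (modulus_ray _ x01) yd.
Qed.

End RayPrimitive.

Lemma is_derive_ln_modulus k x l : k x != 0 -> rderiv k x l ->
  is_derive x (1 : R) (fun y => ln (modulus (k y))) (cRe (l / k x)).
Proof.
move=> kx0 [kr ki].
pose u := cRe \o k; pose v := cIm \o k.
have mE y : modulus (k y) = Num.sqrt (u y * u y + v y * v y).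
  by rewrite /u /v /=; case: (k y) => p q; rewrite modulusE -!expr2.
have s0 : 0 < u x * u x + v x * v x.
  by rewrite -sqrtr_gt0 -mE modulus_gt0.
have ds : is_derive x (1 : R) (fun y => u y * u y + v y * v y)
    ((u x * cRe l + u x * cRe l) + (v x * cIm l + v x * cIm l)).
  exact: (is_deriveD (is_deriveM kr kr) (is_deriveM ki ki)).
have dl := is_derive1_ln s0.
have dln : is_derive x (1 : R) (fun y => ln (u y * u y + v y * v y))
   (((u x * cRe l + u x * cRe l) + (v x * cIm l + v x * cIm l)) * (u x * u x + v x * v x)^-1).
  by have := is_derive1_comp (g := fun y => u y * u y + v y * v y) dl ds; rewrite mulrC.
have -> : (fun y => ln (modulus (k y))) = (fun y => 2^-1 * ln (u y * u y + v y * v y)).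
  apply/funext => y; rewrite mE.
  have := addr_ge0 (sqr_ge0 (u y)) (sqr_ge0 (v y)); rewrite !expr2; set q := _ + _ => q0.
  have [->|qn0] := eqVneq q 0; first by rewrite sqrtr0 ln0// mulr0.
  have qp : 0 < q by rewrite lt_def qn0.
  have sp : 0 < Num.sqrt q by rewrite sqrtr_gt0.
  by rewrite -[q in RHS]sqr_sqrtr// expr2 lnM ?posrE//; field.
have := is_deriveZ 2^-1 dln; rewrite [in X in is_derive _ _ _ X]/GRing.scale /=.
suff -> : cRe (l / k x) = 2^-1 * (((u x * cRe l + u x * cRe l) + (v x * cIm l + v x * cIm l)) * (u x * u x + v x * v x)^-1) by [].
rewrite cReM.
have -> : cRe (k x)^-1 = u x / (u x * u x + v x * v x).
  by rewrite /u /v /=; case: (k x) => p q /=; rewrite !expr2.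
have -> : cIm (k x)^-1 = - (v x / (u x * u x + v x * v x)).
  by rewrite /u /v /=; case: (k x) => p q /=; rewrite !expr2.
by rewrite /u /v /= in s0 *; field; exact: lt0r_neq0.
Qed.

Section LogOfZeroFree.
Variables (h : C -> C) (r : R).
Hypothesis hd : forall z, modulus z < r -> exists l, cderiv h z l.
Hypothesis h0 : forall z, modulus z < r -> h z != 0.

Definition log_deriv f z := derive1 f z / f z.

Lemma cderiv_log_deriv z : modulus z < r -> exists l, cderiv (log_deriv h) z l.
Proof.
move=> zr; pose r' := (modulus z + r) / 2.
have zr' : modulus z < r' by rewrite /r'; lra.
have r'r : r' < r by rewrite /r'; lra.
have [m hm] := cderiv_derive1 (fun z (zr : modulus z <= r') => hd (le_lt_trans zr r'r)) zr'.
have [l hl] := hd zr.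
by eexists; apply: cderivM; [exact: hm|apply: cderivV; [exact: h0|exact: hl]].
Qed.

(** The ray primitive of h'/h is a branch of log h. *)
Lemma ln_modulus_ray z : modulus z < r ->
  ln (modulus (h z)) = ln (modulus (h 0)) + cRe (ray_primitive (log_deriv h) z).
Proof.
move=> zr.
have W x : unit_itv x -> modulus (cR x * z) < r.
  by move=> x01; exact: le_lt_trans (modulus_ray _ x01) zr.
have := @rint_FTC R (fun t => cRe (log_deriv h (cR t * z) * z)) (fun t => ln (modulus (h (cR t * z)))) 0 1 ler01.
rewrite cR1 cR0 mul1r mul0r => E.
have P1 x : 0 <= x <= 1 -> is_derive x (1 : R) (fun t => ln (modulus (h (cR t * z))))
    (cRe (log_deriv h (cR x * z) * z)).
  move=> x01; have [l hl] := hd (W x x01).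
  have := is_derive_ln_modulus (h0 (W x x01)) (rderiv_line hl).
  have /cderivP[_ <-] := hl.
  by rewrite /log_deriv mulrAC.
have P2 x : 0 <= x <= 1 -> continuous_at x (fun t => cRe (log_deriv h (cR t * z) * z)).
  move=> x01; apply: (@continuous_at_cRe R (fun t => log_deriv h (cR t * z) * z)).
  apply: continuous_atM; last exact: cvg_cst.
  by have [l hl] := cderiv_log_deriv (W x x01); exact: continuous_along_line hl.
by rewrite /ray_primitive /= (E P1 P2) addrC subrK.
Qed.

End LogOfZeroFree.
End LogModulus.

(** * The Schwarz formula on a circle *)

Section CircleMeans.
Variable R : realType.
Local Notation C := (Cplx R).
Local Notation mu := (@lebesgue_measure R).
Implicit Types (f g h : C -> C) (w z a l : C) (r e t x M rho : R) (k : R -> C) (u v : R -> R).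

Definition rmean u : R := (2 * pi)^-1 * \int[mu]_(t in `[0, 2 * pi]) u t.
Definition rmeanable u := rintegrable u 0 (2 * pi).

Lemma cRe_cmean k : cRe (cmean k) = rmean (cRe \o k).
Proof. by rewrite /cmean cReM /= mul0r subr0. Qed.

Lemma eq_rmean u v : (forall t, 0 <= t <= 2 * pi -> u t = v t) -> rmean u = rmean v.
Proof.
by move=> uv; congr (_ * _); apply: eq_Rintegral => t; rewrite inE /= in_itv /=; exact: uv.
Qed.

Lemma rmeanD u v : rmeanable u -> rmeanable v -> rmean (fun t => u t + v t) = rmean u + rmean v.
Proof. by move=> iu iv; rewrite /rmean RintegralD// mulrDr. Qed.

Lemma rmeanB u v : rmeanable u -> rmeanable v -> rmean (fun t => u t - v t) = rmean u - rmean v.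
Proof. by move=> iu iv; rewrite /rmean RintegralB// mulrBr. Qed.

Lemma rmeanZ c u : rmeanable u -> rmean (fun t => c * u t) = c * rmean u.
Proof. by move=> iu; rewrite /rmean RintegralZl// mulrCA. Qed.

Lemma rmeanable_cst (c : R) : rmeanable (fun=> c).
Proof. by apply: continuous_rintegrable => x _; exact: cvg_cst. Qed.

Lemma rmean_cst (c : R) : rmean (fun=> c) = c.
Proof. by have := cRe_cmean (fun=> cR c); rewrite cmean_cst. Qed.

Lemma ler_rmean u v : rmeanable u -> rmeanable v ->
  (forall t, 0 <= t <= 2 * pi -> u t <= v t) -> rmean u <= rmean v.
Proof.
move=> iu iv uv; rewrite /rmean ler_pM2l ?invr_gt0 ?twopi_gt0//.
by apply: le_Rintegral => // t; rewrite /= in_itv /=; exact: uv.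
Qed.

Lemma rmean_ge0 u : (forall t, 0 <= u t) -> 0 <= rmean u.
Proof.
move=> u0; rewrite /rmean mulr_ge0 ?invr_ge0 ?(ltW (twopi_gt0 R))//.
exact: Rintegral_ge0.
Qed.

Lemma cconj_cmean k : cmeanable k -> cconj (cmean k) = cmean (fun t => cconj (k t)).
Proof.
move=> [kr ki].
have reE t : cRe (cconj (k t)) = cRe (k t) by case: (k t).
have imE t : cIm (cconj (k t)) = -1 * cIm (k t) by case: (k t) => p q; rewrite mulN1r.
apply: ceqP.
  rewrite cRe_cmean; have -> : cRe \o (fun t => cconj (k t)) = cRe \o k by apply/funext.
  by rewrite -cRe_cmean; case: (cmean k).
have -> : forall z, cIm (cconj z) = - cIm z by case.
rewrite /cmean !cImM /= !mul0r !addr0 -mulrN; congr (_ * _).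
by under [RHS]eq_Rintegral do rewrite imE; rewrite RintegralZl// mulN1r.
Qed.

Lemma mul_conj_circle_pt r t : circle_pt r t * cconj (circle_pt r t) = cR (r ^+ 2).
Proof.
apply: ceqP; rewrite ?cReM ?cImM /=; last by ring.
by rewrite mulrN opprK -!expr2 !exprMn -mulrDr cos2Dsin2 mulr1.
Qed.

Definition schwarz_kernel rho z t := 2 * (circle_pt rho t * (circle_pt rho t - z) ^- 2).

Lemma continuous_schwarz_kernel rho z t : modulus z < rho ->
  continuous_at t (schwarz_kernel rho z).
Proof.
move=> zr; apply: continuous_atM; first exact: cvg_cst.
by apply: (@continuous_cauchy_kernel R 2 (circle_pt rho)) => // s; exact: continuous_circle_pt.
Qed.

Lemma cmean_kernel0 rho z : modulus z < rho ->
  cmean (fun t => circle_pt rho t * (circle_pt rho t - z) ^- 2) = 0.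
Proof.
move=> zr; have d1 y : modulus y <= rho -> exists l, cderiv (fun=> 1 : C) y l.
  by move=> _; exists 0; exact: cderiv_cst.
have := cderiv_unique (cderiv_cauchy d1 zr) (cderiv_cst 1 z).
by rewrite /cauchy_transform; under eq_fun do rewrite mul1r.
Qed.

Section ZeroFree.
Variables (h : C -> C) (r rho : R).
Hypothesis rho0 : 0 < rho.
Hypothesis rhor : rho < r.
Hypothesis hd : forall z, modulus z < r -> exists l, cderiv h z l.
Hypothesis h0 : forall z, modulus z < r -> h z != 0.

Let L := ray_primitive (log_deriv h).

Let dL z : modulus z < r -> cderiv L z (log_deriv h z).
Proof. exact: cderiv_ray_primitive (cderiv_log_deriv hd h0) z. Qed.

Let circ_lt t : modulus (circle_pt rho t) < r.
Proof. by rewrite modulus_circle_pt ?(ltW rho0). Qed.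

Lemma continuous_ln_modulus t : continuous_at t (fun t => ln (modulus (h (circle_pt rho t)))).
Proof.
under eq_fun do rewrite (ln_modulus_ray hd h0 (circ_lt _)).
apply: cvgD; first exact: cvg_cst.
apply: (@continuous_at_cRe R (fun t => L (circle_pt rho t))).
by apply: continuous_circle_fun => // [z zr|]; [eexists; apply: dL; rewrite zr|exact: ltW].
Qed.

(** The mean value property of the real part of log h. *)
Lemma rmean_ln_zero_free : rmean (fun t => ln (modulus (h (circle_pt rho t)))) = ln (modulus (h 0)).
Proof.
under eq_rmean do rewrite (ln_modulus_ray hd h0 (circ_lt _)).
have cL t : continuous_at t (fun t => L (circle_pt rho t)).
  by apply: continuous_circle_fun => // [z zr|]; [eexists; apply: dL; rewrite zr|exact: ltW].
have iL : rmeanable (cRe \o (fun t => L (circle_pt rho t))).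
  by have [] := continuous_cmeanable cL.
rewrite rmeanD//; last exact: rmeanable_cst.
rewrite rmean_cst -[X in _ + X = _]/(rmean (cRe \o (fun t => L (circle_pt rho t)))).
rewrite -cRe_cmean (mean_value rho0); last first.
  by move=> z zr; eexists; apply: dL; exact: le_lt_trans zr rhor.
rewrite /L /ray_primitive (@eq_cint _ _ (fun=> 0)) ?cint_cst ?mulr0 ?addr0//.
by move=> x _; rewrite mulr0.
Qed.

(** The derivative of the Schwarz formula. The conjugate of log h contributes
    nothing: on the circle the conjugate of the kernel is a holomorphic
    function of zeta that vanishes at the origin. *)
Lemma cmean_ln_zero_free z : modulus z < rho ->
  cmean (fun t => cR (ln (modulus (h (circle_pt rho t)))) * schwarz_kernel rho z t) =
  log_deriv h z.
Proof.
move=> zr; have zr' := lt_trans zr rhor.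
have dLb y : modulus y <= rho -> exists l, cderiv L y l.
  by move=> yr; eexists; apply: dL; exact: le_lt_trans yr rhor.
have cL t : continuous_at t (fun t => L (circle_pt rho t)).
  by apply: continuous_circle_fun; [move=> y yr; apply: dLb; rewrite yr|exact: ltW].
pose K t := circle_pt rho t * (circle_pt rho t - z) ^- 2.
have cK t : continuous_at t K.
  apply: (@continuous_cauchy_kernel R 2 (circle_pt rho)); first exact: zr.
  by move=> s; exact: continuous_circle_pt.
have cLK t : continuous_at t (fun t => L (circle_pt rho t) * K t) by exact: (continuous_atM (@cL t) (@cK t)).
pose G y := L y * (cR (rho ^+ 2) * y * (cR (rho ^+ 2) - cconj z * y) ^- 2).
have den y : modulus y <= rho -> cR (rho ^+ 2) - cconj z * y != 0.
  move=> yr; rewrite subr_eq0; apply/eqP => /(congr1 (@modulus R)).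
  rewrite modulus_cR modulusM modulus_conj ger0_norm ?sqr_ge0// => E.
  have : modulus z * modulus y < rho ^+ 2; last by rewrite E ltxx.
  apply: (@le_lt_trans _ _ (modulus z * rho)); first by rewrite ler_wpM2l// modulus_ge0.
  by rewrite expr2 ltr_pM2r.
have dG y : modulus y <= rho -> exists l, cderiv G y l.
  move=> yr; have [l Ll] := dLb y yr; eexists; apply: cderivM; first exact: Ll.
  apply: cderivM; first by apply: cderivM; [exact: cderiv_cst|exact: cderiv_id].
  apply: (cderivV (f := fun y => (cR (rho ^+ 2) - cconj z * y) ^+ 2)); first by rewrite expf_neq0// den.
  have dlin := cderivB (cderiv_cst (cR (rho ^+ 2)) y) (cderivM (cderiv_cst (cconj z) y) (cderiv_id y)).
  exact: (cderivM dlin dlin).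
have conjE t : cconj (L (circle_pt rho t)) * K t = cconj (G (circle_pt rho t)).
  have c0 := circle_pt_neq0 t rho0; have cz := circle_ptB_neq0 t zr.
  have d0 : cR (rho ^+ 2) - cconj z * circle_pt rho t != 0.
    by apply: den; rewrite modulus_circle_pt ?(ltW rho0).
  rewrite /G cconjM; congr (_ * _).
  rewrite /K -(mul_conj_circle_pt rho t) !cconjM.
  have cK2 : forall y : C, cconj (cconj y) = y by move=> y; apply: ceqP; case: y => p q //=; rewrite opprK.
  rewrite cconjV cconjM cconjB !cconjM !cK2.
  rewrite -(mul_conj_circle_pt rho t) mulrC in d0.
  have cc0 : cconj (circle_pt rho t) != 0 by rewrite -modulus_gt0 modulus_conj modulus_gt0.
  have -> : cconj (circle_pt rho t) * circle_pt rho t - z * cconj (circle_pt rho t) =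
            cconj (circle_pt rho t) * (circle_pt rho t - z) by ring.
  by field; rewrite cz cc0.
have -> : cmean (fun t => cR (ln (modulus (h (circle_pt rho t)))) * schwarz_kernel rho z t) =
   cmean (fun t => (cR (2 * ln (modulus (h 0))) * K t + L (circle_pt rho t) * K t)
     + cconj (G (circle_pt rho t))).
  apply: eq_cmean => t _; rewrite (ln_modulus_ray hd h0 (circ_lt t)) -/(L _) -conjE.
  rewrite /schwarz_kernel -/(K t) cRD cRM (cR_nat R 2).
  have E2 : forall y : C, 2 * cR (cRe y) = y + cconj y.
    by move=> y; rewrite -(cR_nat R 2); apply: ceqP; rewrite ?cReD ?cImD ?cReM ?cImM; case: y => p q /=; ring.
  transitivity ((2 * cR (ln (modulus (h 0))) + 2 * cR (cRe (L (circle_pt rho t)))) * K t).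
    by ring.
  by rewrite E2; ring.
have cG t : continuous_at t (fun t => cconj (G (circle_pt rho t))).
  under eq_fun do rewrite -conjE.
  apply: continuous_atM; last exact: cK.
  have -> : (fun t => cconj (L (circle_pt rho t))) =
     (fun t => Complex (cRe (L (circle_pt rho t))) (- cIm (L (circle_pt rho t)))).
    by apply/funext => s; case: (L _).
  apply: continuous_at_Complex.
    exact: (@continuous_at_cRe R (fun t => L (circle_pt rho t)) t (@cL t)).
  exact: (cvgN (@continuous_at_cIm R (fun t => L (circle_pt rho t)) t (@cL t))).
rewrite cmeanD; last 2 first.
- apply: cintegrableD; last exact: continuous_cmeanable.
  by apply: cintegrableZ; exact: continuous_cmeanable.
- exact: continuous_cmeanable.
rewrite cmeanD; last 2 first.
- by apply: cintegrableZ; exact: continuous_cmeanable.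
- exact: continuous_cmeanable.
rewrite cmeanZ; last exact: continuous_cmeanable.
rewrite [cmean K]cmean_kernel0// mulr0 add0r.
have cG' t : continuous_at t (fun t => G (circle_pt rho t)).
  by apply: continuous_circle_fun; [move=> y yr; apply: dG; rewrite yr|exact: ltW].
rewrite -cconj_cmean; last exact: continuous_cmeanable.
rewrite (mean_value rho0 dG) /G mulr0 mul0r mulr0.
have -> : cconj (0 : C) = 0 by apply: ceqP; rewrite //= oppr0.
rewrite addr0 -(cderiv_unique (cderiv_cauchy dLb zr) (dL zr')).
by apply: eq_cmean => t _; rewrite /K mulrA.
Qed.

End ZeroFree.
End CircleMeans.

(** * Circle means and countable sets *)

Section OffCountable.
Variable R : realType.
Local Notation C := (Cplx R).
Local Notation mu := (@lebesgue_measure R).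
Implicit Types (u v : R -> R) (N : set R).

Lemma countable_setR_measurable N : countable N -> measurable N.
Proof. by move=> cN; apply: countable_measurable. Qed.

Lemma measurable_off_countable N u v (D : set R) : countable N -> measurable D ->
  (forall t, D t -> ~ N t -> u t = v t) -> measurable_fun D v -> measurable_fun D u.
Proof.
move=> cN mD uv mv; have mN := countable_setR_measurable cN.
rewrite -(setUIDK D N); apply/measurable_funU; [exact: measurableI|exact: measurableD|].
split.
  move=> _ Y mY; apply: countable_setR_measurable.
  by apply: sub_countable cN; apply: subset_card_le => t [[]].
apply: (@eq_measurable_fun _ _ _ _ (D `\` N) v).
  by move=> t; rewrite inE => -[Dt Nt]; rewrite uv.
by apply: measurable_funS mv => //; exact: subDsetl.
Qed.

Lemma rint_off_countable N u v (a b : R) : countable N ->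
  (forall t, a <= t <= b -> ~ N t -> u t = v t) -> rintegrable v a b ->
  rintegrable u a b /\ \int[mu]_(t in `[a, b]) u t = \int[mu]_(t in `[a, b]) v t.
Proof.
move=> cN uv iv.
have mD : measurable (`[a, b]%classic : set R) by [].
have uv' t : `[a, b]%classic t -> ~ N t -> u t = v t.
  by rewrite /= in_itv /=; exact: uv.
have mv : measurable_fun `[a, b] v by apply/measurable_EFinP; exact: measurable_int iv.
have mu' : measurable_fun `[a, b] u by exact: measurable_off_countable cN mD uv' mv.
have ae : ae_eq mu `[a, b]%classic (EFin \o u) (EFin \o v).
  exists N; split; [exact: countable_setR_measurable|exact: countable_lebesgue_measure0|].
  move=> t /= h; apply: contrapT => Nt; apply: h => tab; congr EFin; exact: uv'.
have E : (\int[mu]_(t in `[a, b]) (EFin \o u) t = \int[mu]_(t in `[a, b]) (EFin \o v) t)%E.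
  by apply: ae_eq_integral => //; apply/measurable_EFinP.
split; last by rewrite /Rintegral; congr fine.
apply/integrableP; split; first exact/measurable_EFinP.
have mabs (w : R -> R) : measurable_fun `[a, b] w -> measurable_fun `[a, b] (fun t => `|(EFin \o w) t|%E).
  by move=> mw; apply: measurableT_comp => //; apply/measurable_EFinP.
have aeabs : ae_eq mu `[a, b]%classic (fun t => `|(EFin \o u) t|%E) (fun t => `|(EFin \o v) t|%E).
  exists N; split; [exact: countable_setR_measurable|exact: countable_lebesgue_measure0|].
  by move=> t /= h; apply: contrapT => Nt; apply: h => tab /=; rewrite uv'.
have -> : (\int[mu]_(t in `[a, b]) `|(EFin \o u) t| = \int[mu]_(t in `[a, b]) `|(EFin \o v) t|)%E.
  by apply: ae_eq_integral; [exact: mD|exact: mabs|exact: mabs|exact: aeabs].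
by case/integrableP: iv.
Qed.

Lemma rmean_off_countable N u v : countable N ->
  (forall t, 0 <= t <= 2 * pi -> ~ N t -> u t = v t) -> rmeanable v ->
  rmeanable u /\ rmean u = rmean v.
Proof.
by move=> cN uv iv; have [iu E] := rint_off_countable cN uv iv; split=> //; rewrite /rmean E.
Qed.

Lemma countable_circle_preimage (r : R) (a : C) : 0 < r ->
  countable [set t | 0 <= t <= 2 * pi /\ circle_pt r t = a].
Proof.
move=> r0; apply: finite_set_countable.
apply: (@sub_finite_set _ _ [set acos (cRe a / r); 2 * pi - acos (cRe a / r)]); last first.
  exact: finite_set2.
have cosE t : circle_pt r t = a -> cos t = cRe a / r.
  by move=> <- /=; rewrite mulrAC mulfV ?mul1r// lt0r_neq0.
move=> t /= [/andP[t0 t1] /cosE <-]; have [tp|tp] := leP t pi.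
  by left; rewrite cosK// in_itv /= t0.
right; have -> : cos t = cos (2 * pi - t).
  by rewrite mulr_natl cosB cos2pi sin2pi mul1r mul0r addr0.
by rewrite cosK ?subKr// in_itv /=; lra.
Qed.

End OffCountable.

(** * Circle means of linear factors *)

Section LinearFactors.
Variable R : realType.
Local Notation C := (Cplx R).
Local Notation mu := (@lebesgue_measure R).
Implicit Types (z w a : C) (t : R) (u v : R -> R).

Definition ln_dist (rho : R) a t := ln (modulus (circle_pt rho t - a)).

Section Interior.
Variables (rho : R) (a : C).
Hypothesis rho0 : 0 < rho.
Hypothesis arho : modulus a < rho.

(* The reflection of z - a in the circle: it has the same modulus on the
   circle, and its zero lies outside. *)
Let h (w : C) : C := (cR (rho ^+ 2) - cconj a * w) / cR rho.
(* A radius between rho and rho^2 / |a| that also makes sense for a = 0. *)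
Let r := 2 * rho ^+ 2 / (rho + modulus a).

Let ra0 : 0 < rho + modulus a. Proof. by rewrite ltr_pwDl// modulus_ge0. Qed.

Let rhor : rho < r.
Proof.
rewrite ltr_pdivlMr// mulrDr expr2.
have : rho * modulus a < rho * rho by rewrite ltr_pM2l.
by move=> H; lra.
Qed.

Let ar : modulus a * r <= rho ^+ 2.
Proof.
rewrite mulrA ler_pdivrMr//.
have -> : modulus a * (2 * rho ^+ 2) = rho ^+ 2 * (2 * modulus a) by ring.
by apply: ler_wpM2l; [exact: sqr_ge0|move: arho => ?; lra].
Qed.

Let crho0 : cR rho != 0 :> C.
Proof. by rewrite -modulus_gt0 modulus_cR normr_gt0 lt0r_neq0. Qed.

Lemma reflected_neq0 w : modulus w < r -> cR (rho ^+ 2) - cconj a * w != 0.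
Proof.
move=> wr; rewrite subr_eq0; apply/eqP => /(congr1 (@modulus R)).
rewrite modulus_cR modulusM modulus_conj ger0_norm ?sqr_ge0// => E.
have [a0|a0] := eqVneq (modulus a) 0.
  by move: E; rewrite a0 mul0r; apply/eqP; rewrite expf_neq0// lt0r_neq0.
have ap : 0 < modulus a by rewrite lt_def a0 modulus_ge0.
have : modulus a * modulus w < rho ^+ 2; last by rewrite E ltxx.
by apply: lt_le_trans ar; rewrite ltr_pM2l.
Qed.

Let h0 w : modulus w < r -> h w != 0.
Proof. by move=> wr; rewrite mulf_neq0 ?invr_eq0// reflected_neq0. Qed.

Let dh w : cderiv h w (- cconj a / cR rho).
Proof.
have H := cderivM (cderivB (cderiv_cst (cR (rho ^+ 2)) w) (cderivM (cderiv_cst (cconj a) w) (cderiv_id w)))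
  (cderiv_cst (cR rho)^-1 w).
suff -> : - cconj a / cR rho =
  ((cR (rho ^+ 2) - cconj a * id w) * 0 + (cR rho)^-1 * (0 - (cconj a * 1 + id w * 0))) by [].
by ring.
Qed.

Let hd w : modulus w < r -> exists l, cderiv h w l.
Proof. by move=> _; eexists; exact: dh. Qed.

Let hE t : modulus (circle_pt rho t - a) = modulus (h (circle_pt rho t)).
Proof.
rewrite /h modulus_div -(mul_conj_circle_pt rho t).
have -> : circle_pt rho t * cconj (circle_pt rho t) - cconj a * circle_pt rho t =
  circle_pt rho t * cconj (circle_pt rho t - a) by rewrite cconjB; ring.
rewrite modulusM modulus_conj modulus_circle_pt ?(ltW rho0)// modulus_cR ger0_norm ?(ltW rho0)//.
by rewrite mulrAC mulfV ?mul1r// lt0r_neq0.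
Qed.

Let lnE : ln_dist rho a = fun t => ln (modulus (h (circle_pt rho t))).
Proof. by apply/funext => t; rewrite /ln_dist hE. Qed.

Lemma continuous_ln_dist t : continuous_at t (ln_dist rho a).
Proof. rewrite lnE; exact: (continuous_ln_modulus rho0 rhor hd h0). Qed.

(** On the circle |zeta - a| is the modulus of the zero-free reflected factor. *)
Lemma rmean_ln_dist_int : rmean (ln_dist rho a) = ln rho.
Proof.
rewrite lnE (rmean_ln_zero_free rho0 rhor hd h0) /h mulr0 subr0 modulus_div !modulus_cR.
rewrite !ger0_norm ?sqr_ge0 ?(ltW rho0)// expr2 mulfK//; exact: lt0r_neq0.
Qed.

Lemma cmean_ln_dist_int z : modulus z < rho ->
  cmean (fun t => cR (ln_dist rho a t) * schwarz_kernel rho z t) =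
  - cconj a / (cR (rho ^+ 2) - cconj a * z).
Proof.
move=> zr; rewrite lnE (cmean_ln_zero_free rho0 rhor hd h0 zr) /log_deriv.
have /cderivP[_ ->] := dh z.
have d0 := reflected_neq0 (lt_trans zr rhor).
by rewrite /h; field; rewrite d0 crho0.
Qed.

End Interior.

Lemma rmean_dominated_cvg (un : nat -> R -> R) u g N : countable N ->
  (forall n, measurable_fun `[0, 2 * pi] (un n)) -> measurable_fun `[0, 2 * pi] u ->
  rmeanable g ->
  (forall t, 0 <= t <= 2 * pi -> ~ N t -> un n t @[n --> \oo] --> u t) ->
  (forall t n, 0 <= t <= 2 * pi -> ~ N t -> `|un n t| <= g t) ->
  rmeanable u /\ rmean (un n) @[n --> \oo] --> rmean u.
Proof.
move=> cN mun mu' ig ucvg ub.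
have mD : measurable (`[0, 2 * pi]%classic : set R) by [].
have N0 := countable_lebesgue_measure0 cN.
have mN := countable_setR_measurable cN.
have [|||||iu _ cvgI] := @dominated_convergence _ _ _ mu _ mD (fun n => EFin \o un n) (EFin \o u) (EFin \o g).
- by move=> n; apply/measurable_EFinP; exact: mun.
- exact/measurable_EFinP.
- exists N; split=> // t /= H; apply: contrapT => Nt; apply: H; rewrite in_itv /= => tT.
  by apply/fine_cvgP; split; [exact: nearW|exact: ucvg].
- exact: ig.
- exists N; split=> // t /= H; apply: contrapT => Nt; apply: H => n; rewrite in_itv /= => tT.
  by rewrite lee_fin; exact: ub.
split; first exact: iu.
apply: cvgM; first exact: cvg_cst.
have F : (\int[mu]_(t in `[0%R, (2 * pi)%R]) (EFin \o u) t)%E \is a fin_num.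
  by apply: integrable_fin_num; [exact: mD|exact: iu].
have E := fineK F.
by rewrite -E in cvgI; case/fine_cvgP : cvgI.
Qed.

End LinearFactors.
Section BoundaryFactors.
Variable R : realType.
Local Notation C := (Cplx R).
Local Notation mu := (@lebesgue_measure R).
Implicit Types (z w a : C) (t : R) (u v : R -> R).

Lemma continuous_at_modulus (k : R -> C) t : continuous_at t k ->
  continuous_at t (fun t => modulus (k t)).
Proof.
move=> /continuous_at_modulusP ck; apply/cvgrPdist_lt => e /ck.
apply: filterS => y; apply: le_lt_trans; rewrite ler_norml.
have := lerB_modulus (k t) (k y); have := lerB_modulus (k y) (k t).
by rewrite [modulus (k t - k y)]modulus_distC => H1 H2; apply/andP; split; lra.
Qed.

Lemma measurable_ln_modulus (k : R -> C) : (forall t, continuous_at t k) ->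
  measurable_fun [set: R] (fun t => ln (modulus (k t))).
Proof.
move=> ck; apply: (measurableT_comp (f := @ln R)); first exact: measurable_ln.
by apply: continuous_measurable_fun => t; apply: continuous_at_modulus; exact: ck.
Qed.

Lemma continuous_circle_ptB rho a t : continuous_at t (fun t => circle_pt rho t - a).
Proof. by apply: cvgB; [exact: continuous_circle_pt|exact: cvg_cst]. Qed.

Lemma measurable_ln_dist rho a : measurable_fun [set: R] (ln_dist rho a).
Proof. by apply: measurable_ln_modulus => t; exact: continuous_circle_ptB. Qed.

Section Boundary.
Variables (rho : R) (a : C).
Hypothesis rho0 : 0 < rho.
Hypothesis arho : modulus a = rho.

Definition shrink n : R := 1 - (n.+2)%:R^-1.

Lemma shrink01 n : 0 < shrink n < 1.
Proof.
have : 0 < (n.+2)%:R^-1 :> R by rewrite invr_gt0.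
have : (n.+2)%:R^-1 < 1 :> R by rewrite invf_lt1// ltr1n.
by rewrite /shrink; move: (n.+2%:R^-1) => q h1 h2; apply/andP; split; lra.
Qed.

Lemma cvg_shrink : shrink n @[n --> \oo] --> (1 : R).
Proof.
rewrite -[X in _ --> X](subr0 1); apply: cvgB; first exact: cvg_cst.
have := @cvg_harmonic R; rewrite -(cvg_shiftS (@harmonic R)); exact.
Qed.

Let an n : C := cR (shrink n) * a.

Let anE n : modulus (an n) = shrink n * rho.
Proof. by rewrite modulusM modulus_cR arho ger0_norm//; case/andP: (shrink01 n) => /ltW. Qed.

Let an_lt n : modulus (an n) < rho.
Proof. by case/andP: (shrink01 n) => _ h; rewrite anE -[ltRHS]mul1r ltr_pM2r. Qed.

Let an_sub n : modulus (an n - a) = (1 - shrink n) * rho.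
Proof.
have -> : an n - a = - (cR (1 - shrink n) * a) by rewrite /an (cRB 1 (shrink n)) cR1; ring.
case/andP: (shrink01 n) => _ /ltW h.
by rewrite modulusN modulusM modulus_cR arho ger0_norm// subr_ge0.
Qed.

Let dist_gt0 n t : 0 < modulus (circle_pt rho t - an n).
Proof. by rewrite modulus_gt0 circle_ptB_neq0. Qed.

Let dist_le n t : modulus (circle_pt rho t - an n) <= 2 * rho.
Proof.
apply: le_trans (modulusB _ _) _; rewrite modulus_circle_pt ?(ltW rho0)//.
have := an_lt n; lra.
Qed.

(* Moving a point of the circle inwards along its radius at most halves its
   distance to other points of the circle; hence a domination uniform in n. *)
Let dist_half n t : modulus (circle_pt rho t - a) <= 2 * modulus (circle_pt rho t - an n).
Proof.
have := modulus_distD (an n) (circle_pt rho t) a; rewrite an_sub.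
have := circle_ptB_ge (an n) t (ltW rho0); rewrite anE => h1 h2; lra.
Qed.

Let N := [set t | 0 <= t <= 2 * pi /\ circle_pt rho t = a].
Let cN : countable N. Proof. exact: countable_circle_preimage. Qed.

Let continuous_an t : continuous_at (1 : R) (fun q => circle_pt rho t - cR q * a : C).
Proof. by apply: cvgB; [exact: cvg_cst|exact: continuous_line]. Qed.

Let ln_dist_cvg t : circle_pt rho t != a -> ln_dist rho (an n) t @[n --> \oo] --> ln_dist rho a t.
Proof.
move=> ta; have tp : 0 < modulus (circle_pt rho t - a) by rewrite modulus_gt0 subr_eq0.
have c1 := continuous_at_modulus (@continuous_an t).
have H : (fun q : R => modulus (circle_pt rho t - cR q * a)) (shrink n) @[n --> \oo] -->
    modulus (circle_pt rho t - cR 1 * a) by apply: cvg_comp cvg_shrink c1.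
rewrite cR1 mul1r in H.
apply: cvg_comp H _; apply: continuous_ln; exact: tp.
Qed.

Let dom t := `|ln_dist rho a t| + (ln 2 + `|ln (2 * rho)|).

Let ln_dist_dom t n : circle_pt rho t != a -> `|ln_dist rho (an n) t| <= dom t.
Proof.
move=> ta; have tp : 0 < modulus (circle_pt rho t - a) by rewrite modulus_gt0 subr_eq0.
have h1 : ln_dist rho (an n) t <= ln (2 * rho).
  by rewrite ler_ln ?posrE ?mulr_gt0 ?dist_gt0.
have h2 : ln_dist rho a t <= ln 2 + ln_dist rho (an n) t.
  by rewrite -lnM ?posrE ?dist_gt0// ler_ln ?posrE ?mulr_gt0 ?dist_gt0.
have l2 : 0 < ln 2 :> R by rewrite ln_gt0// ltr1n.
have := normr_ge0 (ln_dist rho a t); have := normr_ge0 (ln (2 * rho)).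
have := ler_norm (ln (2 * rho)); have := ler_norm (- ln_dist rho a t); rewrite normrN.
by rewrite /dom ler_norml => *; apply/andP; split; lra.
Qed.

(** Fatou's lemma gives integrability of the logarithmic singularity without
    computing its integral: the means for the interior points are constant. *)
Lemma rmeanable_ln_dist_bnd : rmeanable (ln_dist rho a).
Proof.
pose v n t := ln (2 * rho) - ln_dist rho (an n) t.
pose v' n t := if circle_pt rho t == a then 0 else v n t.
pose w t := if circle_pt rho t == a then 0 else ln (2 * rho) - ln_dist rho a t.
have mD : measurable (`[0, 2 * pi]%classic : set R) by [].
have offN t : `[0, 2 * pi]%classic t -> ~ N t -> (circle_pt rho t == a) = false.
  by rewrite /= in_itv /= => tT Nt; apply/eqP => h; apply: Nt.
have mw : measurable_fun `[0, 2 * pi] w.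
  apply: (@measurable_off_countable _ N _ (fun t => ln (2 * rho) - ln_dist rho a t)) => //.
    by move=> t tT Nt; rewrite /w offN.
  apply: measurable_funB; first exact: measurable_cst.
  exact: measurable_funS (measurable_ln_dist rho a).
have mv' n : measurable_fun `[0, 2 * pi] (v' n).
  apply: (@measurable_off_countable _ N _ (v n)) => //.
    by move=> t tT Nt; rewrite /v' offN.
  apply: measurable_funB; first exact: measurable_cst.
  exact: measurable_funS (measurable_ln_dist rho (an n)).
have v0 n t : 0 <= v' n t.
  rewrite /v'; case: ifP => // _.
  by rewrite subr_ge0 ler_ln ?posrE ?mulr_gt0 ?dist_gt0.
have cv n t : continuous_at t (v n).
  rewrite /v; apply: cvgB; first exact: cvg_cst.
  exact: (continuous_ln_dist rho0 (an_lt n)).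
have iv n : rmeanable (v n) by apply: continuous_rintegrable => t _; exact: cv.
have ivE n : (\int[mu]_(t in `[0%R, (2 * pi)%R]) (v' n t)%:E)%E = (2 * pi * ln 2)%:E.
  have vE t : 0 <= t <= 2 * pi -> ~ N t -> v' n t = v n t.
    by move=> tT Nt; rewrite /v' offN//= in_itv.
  have [iv' E] := rint_off_countable cN vE (iv n).
  have : rmean (v n) = ln 2.
    rewrite rmeanB; first last.
    - by apply: continuous_rintegrable => t _; exact: continuous_ln_dist.
    - exact: rmeanable_cst.
    rewrite rmean_cst rmean_ln_dist_int// lnM ?posrE//; ring.
  rewrite /rmean -E => <-; rewrite mulVKf ?lt0r_neq0 ?twopi_gt0// /Rintegral fineK//.
  by apply: integrable_fin_num; [exact: mD|exact: iv'].
have wcvg t : (v' n t)%:E @[n --> \oo] --> (w t)%:E.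
  apply/fine_cvgP; split; first exact: nearW.
  rewrite /v' /w /=; case: ifPn => [_|ta]; first exact: cvg_cst.
  apply: cvgB; first exact: cvg_cst.
  exact: ln_dist_cvg.
have fat : (\int[mu]_(t in `[0%R, (2 * pi)%R]) (w t)%:E <= (2 * pi * ln 2)%:E)%E.
  have := @fatou _ _ _ mu _ mD (fun n => EFin \o v' n).
  have -> : (fun t => limn_einf (fun n => (EFin \o v' n) t)) = (fun t => (w t)%:E).
    by apply/funext => t; rewrite (cvg_limn_einf_sup (wcvg t)).
  have -> : (fun n => \int[mu]_(t in `[0%R, (2 * pi)%R]) (EFin \o v' n) t)%E = (fun=> (2 * pi * ln 2)%:E).
    by apply/funext => n; exact: ivE.
  rewrite (cvg_limn_einf_sup (cvg_cst _)); apply.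
    by move=> n; apply/measurable_EFinP; exact: mv'.
  by move=> n t _; rewrite lee_fin.
have w0 t : 0 <= w t.
  have : (0%:E <= (w t)%:E)%E.
    by apply: (cvge_ge _ (wcvg t)); apply: nearW => n; rewrite lee_fin.
  by rewrite lee_fin.
have iw : rmeanable w.
  apply/integrableP; split; first exact/measurable_EFinP.
  apply: le_lt_trans (ltry (2 * pi * ln 2)).
  rewrite (_ : (fun x => `|(EFin \o w) x|%E) = (fun x => (w x)%:E))//.
  by apply/funext => t; rewrite /= ger0_norm.
have wE t : 0 <= t <= 2 * pi -> ~ N t -> ln (2 * rho) - ln_dist rho a t = w t.
  by move=> tT Nt; rewrite /w offN//= in_itv.
have [i1 _] := rint_off_countable cN wE iw.
apply: eq_rintegrable (rintegrableB (rmeanable_cst (ln (2 * rho))) i1) => t _.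
by rewrite subKr.
Qed.

Lemma rmean_bnd_cvg v : (forall t, continuous_at t v) ->
  rmeanable (fun t => ln_dist rho a t * v t) /\
  rmean (fun t => ln_dist rho (an n) t * v t) @[n --> \oo] --> rmean (fun t => ln_dist rho a t * v t).
Proof.
move=> cv.
have [B B0 BP] := continuous_bounded (k := cR \o v) (ltW (twopi_gt0 R))
  (fun t _ => @continuous_at_cR R v t (cv t)).
have mv : measurable_fun `[0, 2 * pi] v.
  by apply: measurable_funS (continuous_measurable_fun cv).
have mprod b : measurable_fun `[0, 2 * pi] (fun t => ln_dist rho b t * v t).
  by apply: measurable_funM => //; exact: measurable_funS (measurable_ln_dist rho b).
have idom : rmeanable (fun t => B * dom t).
  apply: rintegrableZ; apply: rintegrableD; last exact: rmeanable_cst.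
  exact: integrable_abse rmeanable_ln_dist_bnd.
apply: (rmean_dominated_cvg cN _ _ idom) => //.
- move=> t tT Nt; apply: cvgM; last exact: cvg_cst.
  by apply: ln_dist_cvg; apply/eqP => h; exact: Nt.
- move=> t n tT Nt; rewrite normrM mulrC; apply: ler_pM => //.
    by have := BP t tT; rewrite modulus_cR.
  by apply: ln_dist_dom; apply/eqP => h; exact: Nt.
Qed.

Lemma rmean_ln_dist_bnd : rmean (ln_dist rho a) = ln rho.
Proof.
have [_ H] := @rmean_bnd_cvg (fun=> 1) (fun t => cvg_cst _).
have : (fun n => rmean (fun t => ln_dist rho (an n) t * 1)) @ \oo --> ln rho.
  under eq_fun => n.
    under eq_rmean do rewrite mulr1.
    rewrite rmean_ln_dist_int//; over.
  exact: cvg_cst.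
move=> /(cvg_unique _ H) <- //.
by apply: eq_rmean => t _; rewrite mulr1.
Qed.

Lemma cIm_cmean (k : R -> C) : cIm (cmean k) = rmean (cIm \o k).
Proof. by rewrite /cmean cImM /= mul0r addr0. Qed.

Lemma cmean_ln_dist_bnd z : modulus z < rho ->
  cmeanable (fun t => cR (ln_dist rho a t) * schwarz_kernel rho z t) /\
  cmean (fun t => cR (ln_dist rho a t) * schwarz_kernel rho z t) =
  - cconj a / (cR (rho ^+ 2) - cconj a * z).
Proof.
move=> zr.
have cK t := @continuous_schwarz_kernel R rho z t zr.
have reE b : cRe \o (fun t => cR (ln_dist rho b t) * schwarz_kernel rho z t) =
    (fun t => ln_dist rho b t * cRe (schwarz_kernel rho z t)).
  by apply/funext => t; rewrite /= cReM /= mul0r subr0.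
have imE b : cIm \o (fun t => cR (ln_dist rho b t) * schwarz_kernel rho z t) =
    (fun t => ln_dist rho b t * cIm (schwarz_kernel rho z t)).
  by apply/funext => t; rewrite /= cImM /= mul0r addr0.
have [ir cr] := rmean_bnd_cvg (fun t => @continuous_at_cRe R _ t (cK t)).
have [ii ci] := rmean_bnd_cvg (fun t => @continuous_at_cIm R _ t (cK t)).
split; first by split; rewrite ?reE ?imE.
pose F (q : R) : C := - (cR q * cconj a) / (cR (rho ^+ 2) - (cR q * cconj a) * z).
have conj_cR q : cconj (cR q : C) = cR q by apply: ceqP; rewrite //= oppr0.
have FE n : cmean (fun t => cR (ln_dist rho (an n) t) * schwarz_kernel rho z t) = F (shrink n).
  by rewrite cmean_ln_dist_int// /an cconjM conj_cR.
have den0 : cR (rho ^+ 2) - (cR 1 * cconj a) * z != 0.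
  rewrite cR1 mul1r subr_eq0; apply/eqP => /(congr1 (@modulus R)).
  rewrite modulus_cR modulusM modulus_conj arho ger0_norm ?sqr_ge0// expr2 => /mulfI E.
  by move: zr; rewrite -E ?ltxx// lt0r_neq0.
have cF : continuous_at (1 : R) F.
  apply: continuous_atM; first by apply: cvgN; exact: continuous_line.
  apply: cvgV; first exact: den0.
  apply: cvgB; first exact: cvg_cst.
  by apply: continuous_atM; [exact: continuous_line|exact: cvg_cst].
have F1 : - cconj a / (cR (rho ^+ 2) - cconj a * z) = F 1 by rewrite /F cR1 mul1r.
have Fr := cvg_comp _ _ cvg_shrink (@continuous_at_cRe R F 1 cF).
have Fi := cvg_comp _ _ cvg_shrink (@continuous_at_cIm R F 1 cF).
have FEr : (fun n => rmean (fun t => ln_dist rho (an n) t * cRe (schwarz_kernel rho z t))) =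
    (cRe \o F) \o shrink by apply/funext => n; rewrite /= -FE cRe_cmean reE.
have FEi : (fun n => rmean (fun t => ln_dist rho (an n) t * cIm (schwarz_kernel rho z t))) =
    (cIm \o F) \o shrink by apply/funext => n; rewrite /= -FE cIm_cmean imE.
rewrite -FEr in Fr; rewrite -FEi in Fi.
rewrite F1; apply: ceqP.
  by rewrite cRe_cmean reE; exact: (cvg_unique _ cr Fr).
by rewrite cIm_cmean imE; exact: (cvg_unique _ ci Fi).
Qed.

End Boundary.

(** For a zero on the circle both means are limits of those for zeros
    approaching it radially from inside. *)
Lemma ln_dist_means rho a : 0 < rho -> modulus a <= rho ->
  [/\ rmeanable (ln_dist rho a), rmean (ln_dist rho a) = ln rho &
   forall z, modulus z < rho ->
     cmeanable (fun t => cR (ln_dist rho a t) * schwarz_kernel rho z t) /\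
     cmean (fun t => cR (ln_dist rho a t) * schwarz_kernel rho z t) =
       - cconj a / (cR (rho ^+ 2) - cconj a * z)].
Proof.
move=> rho0; rewrite le_eqVlt => /predU1P[arho|arho].
  split; [exact: rmeanable_ln_dist_bnd|exact: rmean_ln_dist_bnd|].
  by move=> z; exact: cmean_ln_dist_bnd.
split; first by apply: continuous_rintegrable => t _; exact: continuous_ln_dist.
  exact: rmean_ln_dist_int.
move=> z zr; split; last exact: cmean_ln_dist_int.
apply: continuous_cmeanable => t; apply: continuous_atM.
  by apply: continuous_at_cR; exact: continuous_ln_dist.
exact: continuous_schwarz_kernel.
Qed.

End BoundaryFactors.

(** * Local orders and the identity theorem *)

Section LocalOrder.
Variable R : realType.
Local Notation C := (Cplx R).
Implicit Types (f g u v : C -> C) (z w a b : C) (r e : R) (m n : int) (U : set C).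

Definition cdiff_on_ball f a r := forall z, modulus (z - a) < r -> exists l, cderiv f z l.

Definition local_order f a m := exists r u, [/\ 0 < r, cdiff_on_ball u a r,
  (forall z, modulus (z - a) < r -> u z != 0) &
  forall z, 0 < modulus (z - a) < r -> f z = (z - a) ^ m * u z].

Definition local_zero f a := exists2 r : R, 0 < r & forall z, 0 < modulus (z - a) < r -> f z = 0.

Definition local_mero f a := exists r k u, [/\ 0 < r, cdiff_on_ball u a r &
  forall z, 0 < modulus (z - a) < r -> f z = (z - a) ^- k * u z].

Lemma holomorphic_atP f a :
  holomorphic_at f a <-> exists2 r : R, 0 < r & cdiff_on_ball f a r.
Proof.
split=> [/near_modulusP[r r0 rP]|[r r0 rP]].
  by exists r => // z /rP /cderiv_derivable; eexists; eassumption.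
by apply/near_modulusP; exists r => // z /rP[l /cderivP[]].
Qed.

Lemma cdiff_on_ballW f a r e : e <= r -> cdiff_on_ball f a r -> cdiff_on_ball f a e.
Proof. by move=> er fd z ze; apply: fd; exact: lt_le_trans er. Qed.

Lemma cdiff_on_ball_shift f a r : cdiff_on_ball f a r ->
  forall z, modulus z < r -> exists l, cderiv (fun y => f (a + y)) z l.
Proof.
move=> fd z zr; have [l fl] := fd (a + z) ltac:(by rewrite addrAC subrr add0r).
by exists l; exact: cderiv_shift.
Qed.

Lemma cderivX f a l k : cderiv f a l -> exists l', cderiv (fun z => f z ^+ k) a l'.
Proof.
move=> fl; elim: k => [|k [l' IH]]; first by exists 0; exact: cderiv_cst.
by eexists; under eq_fun do rewrite exprS; exact: (cderivM fl IH).
Qed.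

Lemma cderiv_subc a z : cderiv (fun y => y - a) z 1.
Proof. by rewrite -(subr0 1); apply: cderivB; [exact: cderiv_id|exact: cderiv_cst]. Qed.

Lemma cderiv_exprz a z n : z != a -> exists l, cderiv (fun y => (y - a) ^ n) z l.
Proof.
move=> za; case: n => k; first exact: (cderivX k (cderiv_subc a z)).
have [l hl] := cderivX k.+1 (cderiv_subc a z).
by eexists; apply: cderivV hl; rewrite expf_neq0// subr_eq0.
Qed.

Lemma cderiv_punctured_eq f g a l l' r : 0 < r -> cderiv f a l -> cderiv g a l' ->
  (forall z, 0 < modulus (z - a) < r -> f z = g z) -> f a = g a.
Proof.
move=> r0 fl gl fg; have /(_ _) cont := cderiv_cont (cderivB fl gl).
apply/eqP; rewrite -subr_eq0 -modulus_eq0 eq_le modulus_ge0 andbT.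
apply/ler_addgt0Pl => e e0; rewrite addr0.
have [d d0 dP] := cont e e0.
pose x := Num.min d r / 2.
have m0 : 0 < Num.min d r by rewrite lt_min d0.
have x0 : 0 < x by rewrite divr_gt0.
have : x < Num.min d r by rewrite ltr_pdivrMr// ltr_pMr ?ltr1n.
rewrite lt_min => /andP[xd xr].
have xa : modulus (a + cR x - a) = x by rewrite addrAC subrr add0r modulus_cR gtr0_norm.
have := dP (a + cR x); rewrite xa => /(_ xd).
by rewrite fg ?xa ?x0// subrr sub0r modulusN => /ltW.
Qed.

(** The numerator has a zero of finite order or vanishes identically, by its
    Taylor expansion. *)
Lemma local_mero_dichotomy f a : local_mero f a -> local_zero f a \/ exists m, local_order f a m.
Proof.
move=> [r [k [u [r0 ud fE]]]].
have r20 : 0 < r / 2 by rewrite divr_gt0.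
have r2r : r / 2 < r by rewrite ltr_pdivrMr// ltr_pMr ?ltr1n.
pose v y := u (a + y).
have vd z : modulus z <= r / 2 -> exists l, cderiv v z l.
  by move=> zr; apply: (cdiff_on_ball_shift ud); exact: le_lt_trans zr r2r.
have [v0|[j [w [wd w0 vE]]]] := zero_or_order vd r20.
  left; exists (r / 2) => // z /andP[z0 zr]; rewrite fE ?z0 ?(lt_trans zr)//.
  by have := v0 _ zr; rewrite /v addrC subrK => ->; rewrite mulr0.
right; exists (j%:Z - k%:Z).
have w00 : modulus (0 : C) < r / 2 by rewrite modulus0.
have [l wl] := wd 0 w00.
have w0p : 0 < modulus (w 0) by rewrite modulus_gt0.
have [d d0 dP] := cderiv_cont wl w0p.
exists (Num.min d (r / 2)), (fun z => w (z - a)); split.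
- by rewrite lt_min d0.
- move=> z; rewrite lt_min => /andP[_ zr]; have [l' wl'] := wd _ zr.
  exists l'; have := @cderiv_shift R w (- a) z l'; rewrite addrC => /(_ wl').
  by under eq_fun do rewrite addrC.
- move=> z; rewrite lt_min => /andP[zd _]; apply/eqP => wz.
  by have := dP (z - a); rewrite subr0 wz sub0r modulusN ltxx => /(_ zd).
- move=> z; rewrite lt_min => /and3P[z0 _ zr].
  have za : z - a != 0 by rewrite -modulus_gt0.
  rewrite fE ?z0 ?(lt_trans zr)//.
  have := vE _ zr; rewrite /v addrC subrK => ->.
  by rewrite mulrA expfzDr// exprnP exprnN [_ * (z - a) ^ j]mulrC.
Qed.

Lemma local_order_not_zero f a m : local_order f a m -> ~ local_zero f a.
Proof.
move=> [r [u [r0 _ u0 fE]]] [d d0 dP].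
have m0 : 0 < Num.min d r by rewrite lt_min d0.
pose x := Num.min d r / 2; have x0 : 0 < x by rewrite divr_gt0.
have : x < Num.min d r by rewrite ltr_pdivrMr// ltr_pMr ?ltr1n.
rewrite lt_min => /andP[xd xr].
have xa : modulus (a + cR x - a) = x by rewrite addrAC subrr add0r modulus_cR gtr0_norm.
have := dP (a + cR x); rewrite xa x0 xd => /(_ isT); rewrite fE ?xa ?x0//.
move=> /eqP; rewrite mulf_eq0 (negbTE (u0 _ _)) ?xa// orbF; apply/negP.
by rewrite expfz_neq0// -modulus_gt0 xa.
Qed.

Lemma local_zero_near f a : local_zero f a ->
  exists2 r : R, 0 < r & forall z, modulus (z - a) < r -> local_zero f z.
Proof.
move=> [r r0 rP]; exists r => // z zr.
have [->|za] := eqVneq z a; first by exists r.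
have za0 : 0 < modulus (z - a) by rewrite modulus_gt0 subr_eq0.
exists (Num.min (modulus (z - a)) (r - modulus (z - a))).
  by rewrite lt_min za0 subr_gt0.
move=> y; rewrite lt_min => /and3P[y0 y1 y2]; apply: rP.
have h1 := modulus_distD z y a; have h2 := modulus_distD y z a.
by rewrite [modulus (z - y)]modulus_distC in h2; apply/andP; split; lra.
Qed.

Lemma local_order_near f a m : local_order f a m ->
  exists2 r : R, 0 < r & forall z, 0 < modulus (z - a) < r -> local_order f z 0.
Proof.
move=> [r [u [r0 ud u0 fE]]]; exists r => // z /andP[za0 zr].
exists (Num.min (modulus (z - a)) (r - modulus (z - a))), (fun y => (y - a) ^ m * u y).
have H y : modulus (y - z) < Num.min (modulus (z - a)) (r - modulus (z - a)) ->
    0 < modulus (y - a) < r.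
  rewrite lt_min => /andP[y1 y2].
  have h1 := modulus_distD z y a; have h2 := modulus_distD y z a.
  by rewrite [modulus (z - y)]modulus_distC in h2; apply/andP; split; lra.
split.
- by rewrite lt_min za0 subr_gt0.
- move=> y /H /andP[]; rewrite modulus_gt0 subr_eq0 => ya yr.
  have [l1 h1] := cderiv_exprz m ya; have [l2 h2] := ud y yr.
  by eexists; exact: (cderivM h1 h2).
- move=> y /H /andP[y0 yr]; rewrite mulf_neq0 ?u0// expfz_neq0//.
  by rewrite -modulus_gt0.
- by move=> y /andP[_ /H yr]; rewrite expr0z mul1r fE.
Qed.

Lemma meromorphic_local_mero f a :
  holomorphic_at f a \/ (exists k, has_pole_of_order f a k) -> local_mero f a.
Proof.
case=> [/holomorphic_atP[r r0 rP]|[k [k0 [g [/holomorphic_atP[r r0 rP] ga /near_puncturedP[d d0 dP]]]]]].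
  by exists r, 0%N, f; split=> // z _; rewrite expr0 invr1 mul1r.
exists (Num.min r d), k, g; split; first by rewrite lt_min r0.
  by apply: cdiff_on_ballW rP; rewrite ge_min lexx.
move=> z; rewrite lt_min => /and3P[z0 zr zd]; rewrite dP ?z0//.
by rewrite mulrC.
Qed.

(** The identity theorem: by the dichotomy, the points near which f vanishes
    form a set that is open and closed. *)
Lemma local_order_on_connected f U a0 : connected U -> (forall a, U a -> local_mero f a) ->
  U a0 -> ~ local_zero f a0 -> forall a, U a -> exists m, local_order f a m.
Proof.
move=> cU fU Ua0 nz a Ua; have [za|//] := local_mero_dichotomy (fU a Ua).
exfalso; apply: nz.
have open_near (P : C -> Prop) :
    (forall b, P b -> exists2 r : R, 0 < r & forall z, modulus (z - b) < r -> P z) -> open [set b | P b].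
  by move=> H; rewrite openE => b /H bP; exact/near_modulusP.
have oz : open [set b | local_zero f b] by apply: open_near => b /local_zero_near.
have oo : open [set b | exists m, local_order f b m].
  apply: open_near => b [m bm]; have [r r0 rP] := local_order_near bm.
  exists r => // z zr; have [->|zb] := eqVneq z b; first by exists m.
  by exists 0; apply: rP; rewrite zr modulus_gt0 subr_eq0 zb.
have E : U `&` [set b | local_zero f b] = U.
  apply: cU.
  - by exists a.
  - by exists [set b | local_zero f b].
  - exists (~` [set b | exists m, local_order f b m]); first exact: open_closedC.
    apply/seteqP; split=> b [Ub bz]; split=> //.
      by move=> [m /local_order_not_zero].
    by have [//|[m bm]] := local_mero_dichotomy (fU b Ub); exfalso; apply: bz; exists m.
by have : (U `&` [set b | local_zero f b]) a0 by [rewrite E]; case.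
Qed.

End LocalOrder.

(** * Splitting off zeros and poles *)

Section FiniteFactorization.
Variable R : realType.
Local Notation C := (Cplx R).
Implicit Types (f g u v : C -> C) (z w a b : C) (r e rho : R) (m n : int) (U : set C).

Definition open_disc rho : set C := [set z | modulus z < rho].

Lemma compact_closed_disc rho : compact (closed_disc rho : set C).
Proof.
pose P (p : R * R) : C := Complex p.1 p.2.
have cP : continuous P.
  move=> p; apply/cvg_modulusP => e e0.
  have e2 : 0 < e / 2 by rewrite divr_gt0.
  near=> q; rewrite modulus_distC; apply: le_lt_trans (modulus_le_ReIm _) _.
  rewrite cReB cImB /= [e]splitr ltrD//; near: q.
    have : fst @ p --> p.1 by exact: cvg_fst.
    by move=> /cvgrPdist_lt; apply.
  have : snd @ p --> p.2 by exact: cvg_snd.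
  by move=> /cvgrPdist_lt; apply.
have cK : compact [set P x | x in `[- rho, rho]%classic `*` `[- rho, rho]%classic].
  apply: continuous_compact; first exact: continuous_subspaceT.
  by apply: compact_setX; exact: segment_compact.
apply: subclosed_compact cK _.
  rewrite -[closed_disc rho]setCK; apply: open_closedC; rewrite openE => z /= /negP; rewrite -ltNge => zr.
  apply/near_modulusP; exists (modulus z - rho); first by rewrite subr_gt0.
  move=> y yz /=; rewrite /closed_disc /= => yr.
  have := lerB_modulus z y; rewrite modulus_distC; lra.
move=> z /= zr; exists (cRe z, cIm z); last by case: z zr.
by rewrite /= !in_itv /= -!ler_norml; split;
  [exact: le_trans (cRe_le_modulus z) zr|exact: le_trans (cIm_le_modulus z) zr].
Unshelve. all: by end_near. Qed.

Lemma open_discP a r : open [set z | modulus (z - a) < r].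
Proof.
rewrite openE => z /= zr; apply/near_modulusP; exists (r - modulus (z - a)); first by rewrite subr_gt0.
by move=> y yz /=; have := modulus_distD z y a; lra.
Qed.

(** Compactness of the closed disc provides a uniform margin. *)
Lemma closed_disc_enlarge U rho : 0 < rho -> open U -> closed_disc rho `<=` U ->
  exists2 rho' : R, rho < rho' & open_disc rho' `<=` U.
Proof.
move=> rho0 oU dU.
have /compact_near_coveringP nc := @compact_closed_disc rho.
have : \forall q \near (1 : R), closed_disc rho `<=` (fun z => U (cR q * z)).
  apply: (nc R (nbhs (1 : R)) (fun q z => U (cR q * z))) => z zr.
  have /near_modulusP[d d0 dP] : \forall y \near z, U y by move: oU; rewrite openE; apply; exact: dU.
  have z0 := modulus_ge0 z; pose c := d / (2 * (modulus z + 1)).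
  have D0 : 0 < 2 * (modulus z + 1) by lra.
  have c0 : 0 < c by rewrite divr_gt0.
  near=> z' q => /=.
  apply: dP.
  have -> : cR q * z' - z = cR q * (z' - z) + cR (q - 1) * z by rewrite cRB cR1; ring.
  have q2 : `|q - 1| < Num.min 1 c.
    near: q; apply/nbhs_normP; exists (Num.min 1 c); first by rewrite /= lt_min ltr01.
    by move=> y; rewrite /ball_ /= distrC.
  have zz : modulus (z' - z) < d / 4.
    by near: z'; apply/near_modulusP; exists (d / 4) => //; rewrite divr_gt0.
  move: q2; rewrite lt_min => /andP[q1 qc].
  apply: le_lt_trans (modulusD _ _) _; rewrite !modulusM !modulus_cR.
  have qq : `|q| <= 2.
    have := ler_normD (q - 1) 1; rewrite subrK normr1; lra.
  have h1 : `|q| * modulus (z' - z) <= 2 * modulus (z' - z) by rewrite ler_wpM2r// modulus_ge0.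
  have h2 : `|q - 1| * modulus z <= c * (modulus z + 1).
    by apply: ler_pM; [exact: normr_ge0|exact: z0|exact: ltW|lra].
  have h3 : c * (modulus z + 1) = d / 2 by rewrite /c; field; lra.
  lra.
move=> /nbhs_normP[d /= d0 dP].
exists ((1 + d / 2) * rho); first by rewrite ltr_pMl//; lra.
move=> z zr; have q0 : 0 < 1 + d / 2 by have : 0 < d := d0; lra.
have := dP (1 + d / 2); rewrite /ball_ /= opprD addNKr normrN gtr0_norm ?divr_gt0//.
have -> : d / 2 < d by have : 0 < d := d0; lra.
move=> /(_ isT) /(_ (cR (1 + d / 2)^-1 * z)).
rewrite mulrA -cRM mulfV ?lt0r_neq0// cR1 mul1r; apply.
rewrite /closed_disc /= modulusM modulus_cR gtr0_norm ?invr_gt0// mulrC ler_pdivrMr// mulrC ltW.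
Unshelve. all: by end_near. Qed.

Lemma local_order_unique f a m n : local_order f a m -> local_order f a n -> m = n.
Proof.
wlog mn : m n / (n <= m)%R => [H|].
  have [h|/ltW h] := leP n m; first exact: H.
  by move=> fm fn; symmetry; exact: H.
move=> [r [u [r0 ud u0 fu]]] [e [v [e0 vd v0 fv]]].
apply/eqP; rewrite eq_le mn andbT leNgt; apply/negP => nm.
have [k kE] : exists k, m - n = k.+1%:Z.
  by move: nm; rewrite -subr_gt0; case: (m - n) => [[|k]|k] // _; exists k.
have aa d : 0 < d -> modulus (a - a) < d by rewrite subrr modulus0.
have [l ul] := ud a (aa _ r0); have [l' vl] := vd a (aa _ e0).
have [l2 h2] := cderivX k.+1 (cderiv_subc a a).
have m0 : 0 < Num.min r e by rewrite lt_min r0.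
have E : (a - a) ^+ k.+1 * u a = v a.
  apply: (cderiv_punctured_eq m0 (cderivM h2 ul) vl) => z.
  rewrite lt_min => /and3P[z0 zr ze].
  have za : z - a != 0 by rewrite -modulus_gt0.
  have := fu z; rewrite z0 zr => /(_ isT); rewrite fv ?z0//.
  move=> /esym H; apply: (mulfI (expfz_neq0 n za)); rewrite -H.
  by rewrite mulrA exprnP -kE -expfzDr// [n + _]addrC subrK.
by move: (v0 a (aa _ e0)); rewrite -E subrr expr0n mul0r eqxx.
Qed.

Lemma local_orderM f g a m n : local_order f a m -> local_order g a n ->
  local_order (fun z => f z * g z) a (m + n).
Proof.
move=> [r [u [r0 ud u0 fu]]] [e [v [e0 vd v0 fv]]].
exists (Num.min r e), (fun z => u z * v z); split.
- by rewrite lt_min r0 e0.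
- move=> z; rewrite lt_min => /andP[zr ze].
  have [l1 h1] := ud z zr; have [l2 h2] := vd z ze.
  by exists (u z * l2 + v z * l1); exact: (cderivM h1 h2).
- by move=> z; rewrite lt_min => /andP[zr ze]; rewrite mulf_neq0// ?u0 ?v0.
- move=> z; rewrite lt_min => /and3P[z0 zr ze]; rewrite fu ?z0// fv ?z0//.
  have za : z - a != 0 by rewrite -modulus_gt0.
  by rewrite (expfzDr _ _ za) mulrACA.
Qed.

Lemma local_order_factor a b m : local_order (fun z => (z - b) ^ m) a (if a == b then m else 0).
Proof.
case: eqVneq => [->|ab].
  exists 1, (fun=> 1); split=> //.
  - by move=> z _; exists 0; exact: cderiv_cst.
  - by move=> z _; rewrite mulr1.
have d0 : 0 < modulus (a - b) by rewrite modulus_gt0 subr_eq0.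
have zb z : modulus (z - a) < modulus (a - b) -> z != b.
  by move=> h; apply/eqP => zb; move: h; rewrite zb modulus_distC ltxx.
exists (modulus (a - b)), (fun z => (z - b) ^ m); split=> //.
- by move=> z /zb h; exact: cderiv_exprz.
- by move=> z /zb h; rewrite expfz_neq0// subr_eq0.
- by move=> z _; rewrite expr0z mul1r.
Qed.

Definition divisor_prod (s : seq C) (m : C -> int) z := \prod_(b <- s) (z - b) ^ m b.

Lemma local_order_prod (s : seq C) (m : C -> int) a : uniq s ->
  local_order (divisor_prod s m) a (if a \in s then m a else 0).
Proof.
rewrite /divisor_prod; elim: s => [_|b s IH /= /andP[bs us]].
  have := local_order_factor a a 0; rewrite eqxx.
  by under eq_fun do rewrite expr0z; under [X in _ -> local_order X _ _]eq_fun do rewrite big_nil.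
under eq_fun do rewrite big_cons.
have := local_orderM (local_order_factor a b (m b)) (IH us).
rewrite in_cons; case: eqVneq => [->|ab] /=; last by rewrite add0r.
by rewrite (negbTE bs) addr0.
Qed.

(** A point of nonzero order is isolated, so compactness leaves finitely many
    of them. *)
Lemma local_order_nbhd f rho : (forall a, closed_disc rho a -> exists m, local_order f a m) ->
  exists (V : set C) (s : seq C), [/\ open V, closed_disc rho `<=` V, {subset s <= closed_disc rho} &
    forall z, V z -> exists2 m, local_order f z m & m != 0 -> z \in s].
Proof.
move=> fo.
have /choice[r rP] : forall a, exists r, closed_disc rho a ->
    0 < r /\ forall z, modulus (z - a) < r -> exists2 m, local_order f z m & m != 0 -> z = a.
  move=> a; have [ad|ad] := pselect (closed_disc rho a); last by exists 0.
  have [m am] := fo a ad; have [r r0 rP] := local_order_near am.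
  exists r => _; split=> // z zr; have [->|za] := eqVneq z a; first by exists m.
  by exists 0 => //; apply: rP; rewrite zr modulus_gt0 subr_eq0 za.
have := @compact_closed_disc rho; rewrite compact_cover => /(_ C (closed_disc rho)).
move=> /(_ (fun a => [set z | modulus (z - a) < r a])) [].
- by move=> a _; exact: open_discP.
- by move=> a ad; exists a => //=; rewrite subrr modulus0; have [] := rP a ad.
move=> D DS cov.
exists (\bigcup_(a in closed_disc rho) [set z | modulus (z - a) < r a]), (finmap.enum_fset D).
split.
- by apply: bigcup_open => a _; exact: open_discP.
- by move=> a ad; exists a => //=; rewrite subrr modulus0; have [] := rP a ad.
- by move=> a /DS.
- move=> z [a ad za]; have [r0 /(_ z za)[m zm mz]] := rP a ad.
  exists m => // mn0; have zd : closed_disc rho z by rewrite (mz mn0).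
  have [b bD zb] := cov z zd.
  have [_ /(_ z zb)[n zn nz]] := rP b (set_mem (DS b bD)).
  by rewrite nz// -(local_order_unique zm zn).
Qed.

End FiniteFactorization.
Section Factorization.
Variable R : realType.
Local Notation C := (Cplx R).
Implicit Types (f g u v h : C -> C) (z w a b : C) (r e rho : R) (U : set C) (s : seq C) (m : C -> int).

Lemma pole_local_order f a k : has_pole_of_order f a k -> (0 < k)%N /\ local_order f a (- k%:Z).
Proof.
move=> [k0 [g [/holomorphic_atP[r r0 rP] ga /near_puncturedP[d d0 dP]]]]; split=> //.
have aa : modulus (a - a) < r by rewrite subrr modulus0.
have [l gl] := rP a aa.
have g0 : 0 < modulus (g a) by rewrite modulus_gt0.
have [c c0 cP] := cderiv_cont gl g0.
exists (Num.min r (Num.min d c)), g; split.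
- by rewrite !lt_min r0 d0 c0.
- by apply: cdiff_on_ballW rP; rewrite ge_min lexx.
- move=> z; rewrite !lt_min => /and3P[_ _ zc]; apply/eqP => gz.
  by have := cP z zc; rewrite gz sub0r modulusN ltxx.
- move=> z; rewrite !lt_min => /and4P[z0 zr zd zc]; rewrite dP ?z0 ?zd//.
  by rewrite mulrC exprnN.
Qed.

Lemma local_order_pole f a k : (0 < k)%N -> local_order f a (- k%:Z) -> has_pole_of_order f a k.
Proof.
move=> k0 [r [u [r0 ud u0 fu]]]; split=> //; exists u; split.
- by apply/holomorphic_atP; exists r.
- by apply: u0; rewrite subrr modulus0.
- apply/near_puncturedP; exists r => // z zr; rewrite fu// mulrC exprnN.
  by [].
Qed.

Lemma pole_orderE f a (n : int) : local_order f a n ->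
  pole_order f a = if n < 0 then `|n|%N else 0%N.
Proof.
move=> fn; rewrite /pole_order; case: xgetP => [k -> /pole_local_order[k0 fk]|nok].
  have -> := local_order_unique fn fk.
  by rewrite oppr_lt0 ltz_nat k0 abszN absz_nat.
case: ifP => // n0; exfalso; apply: (nok `|n|%N).
apply: local_order_pole; first by rewrite absz_gt0 lt_eqF.
by rewrite -abszN gez0_abs ?opprK// oppr_ge0 ltW.
Qed.

Lemma divisor_prod_neq0 s m z : z \notin s -> divisor_prod s m z != 0.
Proof.
move=> zs; rewrite /divisor_prod prodf_seq_neq0; apply/allP => b bs /=.
by rewrite expfz_neq0// subr_eq0; apply: contraNneq zs => ->.
Qed.

Lemma cderiv_divisor_prod s m z : z \notin s -> exists l, cderiv (divisor_prod s m) z l.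
Proof.
rewrite /divisor_prod; elim: s => [_|b s IH].
  by exists 0; under eq_fun do rewrite big_nil; exact: cderiv_cst.
rewrite in_cons negb_or => /andP[zb /IH[l hl]].
have [l' hl'] := cderiv_exprz (m b) zb.
by eexists; under eq_fun do rewrite big_cons; exact: (cderivM hl' hl).
Qed.

Lemma divisor_prodN s m z : z \notin s ->
  divisor_prod s m z * divisor_prod s (fun b => - m b) z = 1.
Proof.
move=> zs; rewrite /divisor_prod -big_split /= big_seq big1// => b bs.
have zb : z - b != 0 by rewrite subr_eq0; apply: contraNneq zs => ->.
by rewrite -expfzDr// subrr expr0z.
Qed.

(** The quotient of f by its divisor has order 0 everywhere, hence agrees off
    the zeros and poles with a zero-free holomorphic function. *)
Theorem zero_pole_factorization f U rho : 0 < rho -> open U -> closed_disc rho `<=` U ->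
  meromorphic_on U f -> (forall a, U a -> exists n, local_order f a n) ->
  exists (rho' : R) s m h, [/\ rho < rho' /\ uniq s,
    {in s, forall b, modulus b <= rho},
    forall a, modulus a < rho' -> local_order f a (if a \in s then m a else 0),
    forall z, modulus z < rho' -> (exists l, cderiv h z l) /\ h z != 0 &
    forall z, modulus z < rho' -> z \notin s -> f z = divisor_prod s m z * h z].
Proof.
move=> rho0 oU dU fU fo.
have [V [s0 [oV dV s0d Vo]]] := local_order_nbhd (fun a ad => fo a (dU a ad)).
have [rho' rr' r'UV] := closed_disc_enlarge rho0 (openI oU oV) (fun z zd => conj (dU z zd) (dV z zd)).
have /choice[m mP] : forall a, exists n : int, modulus a < rho' -> local_order f a n /\ (n != 0 -> a \in s0).
  move=> a; have [ar|ar] := pselect (modulus a < rho'); last by exists 0.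
  by have [_ /Vo[n an ns]] := r'UV a ar; exists n.
pose s := undup s0; have us : uniq s by exact: undup_uniq.
have so a : modulus a < rho' -> local_order f a (if a \in s then m a else 0).
  move=> ar; have [am ms] := mP a ar; case: ifP => // /negbT; rewrite mem_undup => as0.
  have [m0|m0] := eqVneq (m a) 0; first by rewrite -m0.
  by move: as0; rewrite ms.
pose F z := f z * divisor_prod s (fun b => - m b) z.
have Fo a : modulus a < rho' -> local_order F a 0.
  move=> ar; have := local_orderM (so a ar) (local_order_prod (fun b => - m b) a us).
  by case: ifP => _; rewrite ?addr0 ?subrr.
have /choice[u uP] : forall a, exists u, modulus a < rho' -> exists r, [/\ 0 < r, cdiff_on_ball u a r,
    (forall z, modulus (z - a) < r -> u z != 0) &
    forall z, 0 < modulus (z - a) < r -> F z = u z].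
  move=> a; have [ar|ar] := pselect (modulus a < rho'); last by exists (fun=> 0).
  have [r [u [r0 ud u0 fu]]] := Fo a ar; exists u => _; exists r; split=> //.
  by move=> z /fu ->; rewrite expr0z mul1r.
(* The zero-free factor at z, evaluated at z: this discards the irrelevant
   values of f and of its divisor at the zeros and poles. *)
pose h z := u z z.
have aa a r : 0 < r -> modulus (a - a) < r by rewrite subrr modulus0.
have hE a : modulus a < rho' -> exists2 r, 0 < r & cdiff_on_ball (u a) a r /\
    forall z, modulus (z - a) < r -> h z = u a z.
  move=> ar; have [r [r0 ud u0 fu]] := uP a ar.
  exists (Num.min r (rho' - modulus a)); first by rewrite lt_min r0 subr_gt0.
  split; first by apply: cdiff_on_ballW ud; rewrite ge_min lexx.
  move=> z; rewrite lt_min => /andP[zr zr'].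
  have [->//|za] := eqVneq z a.
  have za0 : 0 < modulus (z - a) by rewrite modulus_gt0 subr_eq0.
  have zrho : modulus z < rho' by have := modulusD (z - a) a; rewrite subrK; lra.
  have [e [e0 vd v0 fv]] := uP z zrho.
  have [l1 h1] := vd z (aa z e e0); have [l2 h2] := ud z zr.
  have m0 : 0 < Num.min e (Num.min (modulus (z - a)) (r - modulus (z - a))).
    by rewrite !lt_min e0 za0 subr_gt0.
  apply: (cderiv_punctured_eq m0 h1 h2) => y; rewrite !lt_min => /and4P[y0 y1 y2 y3].
  rewrite -fv ?y0// -fu//.
  have h3 := modulus_distD z y a; have h4 := modulus_distD y z a.
  by rewrite [modulus (z - y)]modulus_distC in h4; apply/andP; split; lra.
exists rho', s, m, h; split=> //.
- by move=> b; rewrite mem_undup => /s0d /set_mem.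
- move=> z zr; have [r r0 [ud hz]] := hE z zr.
  have [l hl] := ud z (aa z r r0); split.
    exists l; apply: cderiv_near hl; apply/near_modulusP; exists r => // y yr.
    by rewrite hz.
  by have [e [e0 _ v0 _]] := uP z zr; apply: v0; exact: aa.
- move=> z zr zs; have fz0 := so z zr; rewrite (negbTE zs) in fz0.
  have [Uz _] := r'UV z zr.
  have [l fl] : exists l, cderiv f z l.
    case: (fU z Uz) => [/holomorphic_atP[r r0 rP]|[k /pole_local_order[k0 fk]]].
      by apply: rP; exact: aa.
    have := local_order_unique fz0 fk; case: (k) k0 => //.
  have [l' pl] := cderiv_divisor_prod (fun b => - m b) zs.
  have [e [e0 vd v0 fv]] := uP z zr; have [l1 h1] := vd z (aa z e e0).
  have Fz : F z = h z by exact: (cderiv_punctured_eq e0 (cderivM fl pl) h1).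
  by rewrite -Fz /F mulrCA divisor_prodN// mulr1.
Qed.

End Factorization.

(** * The differentiated Poisson-Jensen formula *)

Section CircleRepresentation.
Variable R : realType.
Local Notation C := (Cplx R).
Implicit Types (z w a b : C) (t : R).

Variables (f h : C -> C) (rho rho' : R) (s : seq C) (m : C -> int).
Hypothesis rho0 : 0 < rho.
Hypothesis rr' : rho < rho'.
Hypothesis us : uniq s.
Hypothesis srho : {in s, forall b, modulus b <= rho}.
Hypothesis hP : forall z, modulus z < rho' -> (exists l, cderiv h z l) /\ h z != 0.
Hypothesis fE : forall z, modulus z < rho' -> z \notin s -> f z = divisor_prod s m z * h z.

Let mem_cons_tail b c (q : seq C) : c \in q -> c \in b :: q.
Proof. by rewrite in_cons orbC => ->. Qed.

Let hd z : modulus z < rho' -> exists l, cderiv h z l. Proof. by move=> /hP[]. Qed.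
Let h0 z : modulus z < rho' -> h z != 0. Proof. by move=> /hP[]. Qed.

(** The logarithm of |f| on the circle, away from the zeros and poles. *)
Definition circle_log t : R :=
  \sum_(b <- s) (m b)%:~R * ln_dist rho b t + ln (modulus (h (circle_pt rho t))).

(** The logarithmic derivative at z of the Blaschke factor rho (z - b) /
    (rho^2 - conj b z). *)
Definition blaschke_term z b : C := (cR (rho ^+ 2 - modulus b ^+ 2)) /
  ((z - b) * (cR (rho ^+ 2) - cconj b * z)).

Let sum_ln_dist (q : seq C) : {subset q <= s} ->
  rmeanable (fun t => \sum_(b <- q) (m b)%:~R * ln_dist rho b t) /\
  rmean (fun t => \sum_(b <- q) (m b)%:~R * ln_dist rho b t) = \sum_(b <- q) (m b)%:~R * ln rho.
Proof.
elim: q => [_|b q IH sub].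
  have -> : (fun t => \sum_(b <- [::]) (m b)%:~R * ln_dist rho b t) = (fun=> 0).
    by apply/funext => t; rewrite big_nil.
  by rewrite big_nil rmean_cst; split=> //; exact: rmeanable_cst.
have [i1 e1] := IH (fun c cq => sub c (mem_cons_tail b cq)).
have [i2 e2 _] := ln_dist_means rho0 (srho (sub b (mem_head b q))).
have i3 : rmeanable (fun t => (m b)%:~R * ln_dist rho b t) := rintegrableZ _ i2.
have -> : (fun t => \sum_(b <- b :: q) (m b)%:~R * ln_dist rho b t) =
    (fun t => (m b)%:~R * ln_dist rho b t + \sum_(b <- q) (m b)%:~R * ln_dist rho b t).
  by apply/funext => t; rewrite big_cons.
rewrite big_cons; split; first exact: (rintegrableD i3 i1).
by rewrite rmeanD// e1 rmeanZ// e2.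
Qed.

Let cont_h t : continuous_at t (fun t => ln (modulus (h (circle_pt rho t)))).
Proof. exact: (continuous_ln_modulus rho0 rr' hd h0). Qed.

Let mean_h : rmeanable (fun t => ln (modulus (h (circle_pt rho t)))).
Proof. by apply: continuous_rintegrable => t _; exact: cont_h. Qed.

Lemma rmeanable_circle_log : rmeanable circle_log.
Proof. by apply: rintegrableD mean_h; have [] := sum_ln_dist (fun b => id). Qed.

Lemma rmean_circle_log :
  rmean circle_log = \sum_(b <- s) (m b)%:~R * ln rho + ln (modulus (h 0)).
Proof.
have [i1 e1] := sum_ln_dist (fun b => id).
by rewrite rmeanD// e1 (rmean_ln_zero_free rho0 rr' hd h0).
Qed.

(** The mean sees a zero b inside the circle only through its reflected
    factor. *)
Lemma cmean_circle_log z : modulus z < rho ->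
  cmeanable (fun t => cR (circle_log t) * schwarz_kernel rho z t) /\
  cmean (fun t => cR (circle_log t) * schwarz_kernel rho z t) =
  \sum_(b <- s) (m b)%:~R * (- cconj b / (cR (rho ^+ 2) - cconj b * z)) + log_deriv h z.
Proof.
move=> zr.
have S (q : seq C) : {subset q <= s} ->
    cmeanable (fun t => cR (\sum_(b <- q) (m b)%:~R * ln_dist rho b t) * schwarz_kernel rho z t) /\
    cmean (fun t => cR (\sum_(b <- q) (m b)%:~R * ln_dist rho b t) * schwarz_kernel rho z t) =
    \sum_(b <- q) (m b)%:~R * (- cconj b / (cR (rho ^+ 2) - cconj b * z)).
  elim: q => [_|b q IH sub].
    have -> : (fun t => cR (\sum_(b <- [::]) (m b)%:~R * ln_dist rho b t) * schwarz_kernel rho z t) = (fun=> 0).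
      by apply/funext => t; rewrite big_nil cR0 mul0r.
    rewrite big_nil cmean_cst; split=> //.
    by apply: continuous_cmeanable => t; exact: cvg_cst.
  have [i1 e1] := IH (fun c cq => sub c (mem_cons_tail b cq)).
  have [_ _ /(_ z zr)[i2 e2]] := ln_dist_means rho0 (srho (sub b (mem_head b q))).
  have -> : (fun t => cR (\sum_(b <- b :: q) (m b)%:~R * ln_dist rho b t) * schwarz_kernel rho z t) =
     (fun t => (m b)%:~R * (cR (ln_dist rho b t) * schwarz_kernel rho z t) +
       cR (\sum_(b <- q) (m b)%:~R * ln_dist rho b t) * schwarz_kernel rho z t).
    by apply/funext => t; rewrite big_cons cRD mulrDl cRM cR_int -mulrA.
  rewrite big_cons; split; first exact: (cintegrableD (cintegrableZ _ i2) i1).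
  by rewrite cmeanD ?e1 ?cmeanZ ?e2//; exact: cintegrableZ.
have [i1 e1] := S s (fun b => id).
have i2 : cmeanable (fun t => cR (ln (modulus (h (circle_pt rho t)))) * schwarz_kernel rho z t).
  apply: continuous_cmeanable => t; apply: continuous_atM.
    by apply: continuous_at_cR; exact: cont_h.
  exact: continuous_schwarz_kernel.
have -> : (fun t => cR (circle_log t) * schwarz_kernel rho z t) =
   (fun t => cR (\sum_(b <- s) (m b)%:~R * ln_dist rho b t) * schwarz_kernel rho z t +
     cR (ln (modulus (h (circle_pt rho t)))) * schwarz_kernel rho z t).
  by apply/funext => t; rewrite -mulrDl -cRD.
split; first exact: (cintegrableD i1 i2).
by rewrite cmeanD// e1 (cmean_ln_zero_free rho0 rr' hd h0 zr).
Qed.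

Lemma ln_modulus_divisor_prod (q : seq C) z : z \notin q ->
  ln (modulus (divisor_prod q m z)) = \sum_(b <- q) (m b)%:~R * ln (modulus (z - b)).
Proof.
rewrite /divisor_prod; elim: q => [_|b q IH]; first by rewrite !big_nil modulus1 ln1.
rewrite in_cons negb_or => /andP[zb zq]; rewrite !big_cons modulusM.
have zb0 : 0 < modulus (z - b) by rewrite modulus_gt0 subr_eq0.
rewrite lnM ?posrE; last 2 first.
- by rewrite modulus_exprz exprz_gt0.
- by rewrite modulus_gt0; exact: (divisor_prod_neq0 m zq).
rewrite IH// modulus_exprz; congr (_ + _).
case: (m b) => k; first by rewrite -exprnP lnXn// mulr_natl.
by rewrite NegzE -exprnN lnV ?posrE ?exprn_gt0// lnXn// mulrNz mulNr mulr_natl.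
Qed.

Lemma circle_logE t : circle_pt rho t \notin s -> ln (modulus (f (circle_pt rho t))) = circle_log t.
Proof.
move=> ts.
have tr : modulus (circle_pt rho t) < rho' by rewrite modulus_circle_pt// ltW.
rewrite fE// modulusM lnM ?posrE ?modulus_gt0 ?h0 ?divisor_prod_neq0//.
by rewrite ln_modulus_divisor_prod.
Qed.

Lemma countable_circle_preimage_seq (q : seq C) :
  countable [set t | 0 <= t <= 2 * pi /\ circle_pt rho t \in q].
Proof.
rewrite (_ : mkset _ = \bigcup_(b in [set` q]) [set t | 0 <= t <= 2 * pi /\ circle_pt rho t = b]).
  apply: bigcup_countable => [|b _]; last exact: countable_circle_preimage.
  by apply: finite_set_countable; exact: finite_seq.
apply/seteqP; split=> t /=; first by move=> [tT tq]; exists (circle_pt rho t).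
by move=> [b /= bq [tT tb]]; rewrite tb.
Qed.

Lemma log_deriv_divisor_prod z : modulus z < rho' -> z \notin s ->
  log_deriv f z = \sum_(b <- s) (m b)%:~R / (z - b) + log_deriv h z.
Proof.
move=> zr zs.
have D (q : seq C) : z \notin q -> exists2 l, cderiv (divisor_prod q m) z l &
    l = divisor_prod q m z * \sum_(b <- q) (m b)%:~R / (z - b).
  rewrite /divisor_prod; elim: q => [_|b q IH].
    exists 0; last by rewrite !big_nil mulr0.
    by under eq_fun do rewrite big_nil; exact: cderiv_cst.
  rewrite in_cons negb_or => /andP[zb /IH[l hl lE]].
  have zb0 : z - b != 0 by rewrite subr_eq0.
  have [l' hl' l'E] : exists2 l', cderiv (fun y => (y - b) ^ m b) z l' &
      l' = (z - b) ^ m b * ((m b)%:~R / (z - b)).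
    have X k : cderiv (fun y => (y - b) ^+ k) z (k%:R * (z - b) ^+ k.-1).
      elim: k => [|k IHk]; first by rewrite mul0r; exact: cderiv_cst.
      under eq_fun do rewrite exprS.
      have := cderivM (cderiv_subc b z) IHk.
      suff -> : k.+1%:R * (z - b) ^+ k.+1.-1 = (z - b) * (k%:R * (z - b) ^+ k.-1) + (z - b) ^+ k * 1 by [].
      by case: (k) => [|j] /=; rewrite -[in LHS]natr1 ?exprS ?expr0; ring.
    case: (m b) => k.
      exists (k%:R * (z - b) ^+ k.-1); first exact: X.
      rewrite -exprnP -pmulrn; case: (k) => [|j]; first by rewrite !mul0r mulr0.
      by rewrite [in RHS]exprS /=; move: (_ ^+ j) => q'; move: (j.+1%:R) => n'; field.
    exists (- ((z - b) ^+ k.+1) ^- 2 * (k.+1%:R * (z - b) ^+ k)).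
      by apply: cderivV (X k.+1); rewrite expf_neq0.
    rewrite NegzE mulrNz -pmulrn -exprnN !(exprS (z - b) k).
    have : (z - b) ^+ k != 0 by rewrite expf_neq0.
    by move: ((z - b) ^+ k) (k.+1%:R) => q' n' q0; field; rewrite zb0 q0.
  exists ((z - b) ^ m b * l + \prod_(c <- q) (z - c) ^ m c * l').
    by under eq_fun do rewrite big_cons; exact: (cderivM hl' hl).
  by rewrite !big_cons lE l'E; ring.
have [l hl lE] := D s zs; have [l' hl'] := hd zr.
have zs0 : divisor_prod s m z != 0 by exact: divisor_prod_neq0.
have hz := h0 zr.
have F : cderiv f z (divisor_prod s m z * l' + h z * l).
  apply: cderiv_near (cderivM hl hl').
  have nb (q : seq C) : z \notin q -> \forall y \near z, y \notin q.
    elim: q => [_|b q IH]; first by near=> y; rewrite in_nil.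
    rewrite in_cons negb_or => /andP[zb /IH IHq].
    near=> y; rewrite in_cons negb_or; apply/andP; split; last by near: y.
    near: y; apply/near_modulusP; exists (modulus (z - b)).
      by rewrite modulus_gt0 subr_eq0.
    by move=> y; apply: contraTneq => ->; rewrite modulus_distC ltxx.
  near=> y; rewrite fE//; last by near: y; exact: nb.
  near: y; apply/near_modulusP; exists (rho' - modulus z); first by rewrite subr_gt0.
  by move=> y yz; have := modulusD (y - z) z; rewrite subrK; lra.
have /cderivP[_ fl] := F; have /cderivP[_ hl2] := hl'.
rewrite /log_deriv fl fE// hl2 lE; field; by rewrite hz zs0.
Unshelve. all: by end_near. Qed.

Definition order0 : int := if 0 \in s then m 0 else 0.

(** The normalized boundary logarithm: dividing f by the power of z that makes
    it finite and nonzero at the origin subtracts a constant on the circle. *)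
Definition circle_log0 t := circle_log t - order0%:~R * ln rho.

(** The reflected contributions combine with the fractions m b / (z - b) into
    Blaschke terms, and the constant subtracted from the boundary logarithm
    has mean 0 against the kernel. *)
Lemma log_deriv_circle z : modulus z < rho -> z \notin s ->
  cmeanable (fun t => cR (circle_log0 t) * schwarz_kernel rho z t) /\
  log_deriv f z = cmean (fun t => cR (circle_log0 t) * schwarz_kernel rho z t) +
    \sum_(b <- s) (m b)%:~R * blaschke_term z b.
Proof.
move=> zr zs; have [i1 e1] := cmean_circle_log zr.
have cK t := @continuous_schwarz_kernel R rho z t zr.
have iK : cmeanable (schwarz_kernel rho z) by exact: continuous_cmeanable.
have E : (fun t => cR (circle_log0 t) * schwarz_kernel rho z t) =
   (fun t => cR (circle_log t) * schwarz_kernel rho z t - cR (order0%:~R * ln rho) * schwarz_kernel rho z t).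
  by apply/funext => t; rewrite /circle_log0 cRB mulrBl.
have i2 : cmeanable (fun t => cR (order0%:~R * ln rho) * schwarz_kernel rho z t) by exact: cintegrableZ.
rewrite E; split; first exact: cintegrableB.
rewrite cmeanB// cmeanZ//.
have -> : cmean (schwarz_kernel rho z) = 0.
  rewrite /schwarz_kernel cmeanZ; first by rewrite cmean_kernel0 ?mulr0.
  apply: continuous_cmeanable => t.
  apply: (@continuous_cauchy_kernel R 2 (circle_pt rho)); first exact: zr.
  by move=> x; exact: continuous_circle_pt.
rewrite mulr0 subr0 e1 log_deriv_divisor_prod//; last exact: lt_trans zr rr'.
rewrite addrAC -big_split /=; congr (_ + _); apply: eq_big_seq => b bs.
rewrite -mulrDr; congr (_ * _).
have zb : z - b != 0 by rewrite subr_eq0; apply: contraNneq zs => ->.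
have den : cR (rho ^+ 2) - cconj b * z != 0.
  rewrite subr_eq0; apply/eqP => /(congr1 (@modulus R)).
  rewrite modulus_cR modulusM modulus_conj ger0_norm ?sqr_ge0// expr2 => H.
  have : modulus b * modulus z <= rho * modulus z by rewrite ler_wpM2r ?modulus_ge0 ?srho.
  by rewrite -H ler_pM2l// leNgt zr.
rewrite /blaschke_term cRB -mul_conj; field; by rewrite zb den.
Qed.

End CircleRepresentation.

(** * Area of an annulus inside a disc *)

Section PlaneArea.
Variable R : realType.
Local Notation C := (Cplx R).
Local Notation mu := (@lebesgue_measure R).
Local Notation mu2 := (mu \x mu)%E.
Implicit Types (b : C) (p : R * R) (r t x y c : R).

Definition plane_pt p : C := Complex p.1 p.2.
Definition plane_dist b p : R := modulus (plane_pt p - b).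

Lemma plane_distE b p : plane_dist b p = Num.sqrt ((p.1 - cRe b) ^+ 2 + (p.2 - cIm b) ^+ 2).
Proof. by rewrite /plane_dist /plane_pt; case: b => u v; rewrite modulusE. Qed.

Lemma measurable_plane_dist b : measurable_fun [set: R * R] (plane_dist b).
Proof.
have -> : plane_dist b = fun p => Num.sqrt ((p.1 - cRe b) ^+ 2 + (p.2 - cIm b) ^+ 2).
  by apply/funext => p; exact: plane_distE.
apply: (measurableT_comp (f := @Num.sqrt R)).
  by apply: continuous_measurable_fun; exact: sqrt_continuous.
by apply: measurable_funD; apply: measurable_funX; apply: measurable_funB;
  [exact: measurable_fst|exact: measurable_cst|exact: measurable_snd|exact: measurable_cst].
Qed.

Lemma plane_dist_ge b p : `|p.1 - cRe b| <= plane_dist b p /\ `|p.2 - cIm b| <= plane_dist b p.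
Proof.
rewrite plane_distE -!sqrtr_sqr !ler_sqrt ?lerDl ?lerDr ?addr_ge0 ?sqr_ge0//.
Qed.

Lemma measurable_setlt (u v : R * R -> R) : measurable_fun setT u -> measurable_fun setT v ->
  measurable [set p | u p < v p].
Proof.
move=> mu' mv; have := measurable_fun_ltr mu' mv.
by move=> /(_ measurableT [set true] I); rewrite setTI; congr measurable; apply/seteqP; split.
Qed.

Lemma measurable_setle (u v : R * R -> R) : measurable_fun setT u -> measurable_fun setT v ->
  measurable [set p | u p <= v p].
Proof.
move=> mu' mv; have := measurable_fun_ler mu' mv.
by move=> /(_ measurableT [set true] I); rewrite setTI; congr measurable; apply/seteqP; split.
Qed.

Definition half_open_annulus (r' r : R) : set (R * R) := [set p | r' <= plane_dist 0 p < r].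
Definition plane_disc b t : set (R * R) := [set p | plane_dist b p < t].

Lemma measurable_half_open_annulus r' r : measurable (half_open_annulus r' r).
Proof.
rewrite (_ : half_open_annulus r' r = [set p | r' <= plane_dist 0 p] `&` [set p | plane_dist 0 p < r]).
  apply: measurableI; [apply: measurable_setle|apply: measurable_setlt];
    by [exact: measurable_cst|exact: measurable_plane_dist].
by apply/seteqP; split=> p; [move=> /andP[]|move=> [h1 h2]; apply/andP].
Qed.

Lemma measurable_plane_disc b t : measurable (plane_disc b t).
Proof. by apply: measurable_setlt; [exact: measurable_plane_dist|exact: measurable_cst]. Qed.

(** The product (u - v) (u + v) is at most r^2 - r'^2, and u + v is comparable
    to r when c is the smaller coordinate. *)
Lemma abs_strip (c r' r u v : R) : 0 <= r' -> r' < r -> 0 <= u -> 0 <= v -> `|c| <= u -> `|c| <= v ->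
  r' ^+ 2 <= c ^+ 2 + u ^+ 2 < r ^+ 2 -> r' ^+ 2 <= c ^+ 2 + v ^+ 2 < r ^+ 2 ->
  `|u - v| <= 3 * (r - r').
Proof.
move=> r'0 r'r u0 v0 cu cv.
wlog uv : u v u0 v0 cu cv / v <= u => [H hu hv|].
  have [vu|/ltW vu] := leP v u; first exact: H.
  by rewrite distrC; apply: H.
move=> /andP[_ hu] /andP[hv _]; rewrite ger0_norm ?subr_ge0//.
have r0 : 0 < r by exact: le_lt_trans r'r.
have ur : u < r.
  rewrite -(ltr_pXn2r (n := 2)) ?nnegrE ?(ltW r0)//; apply: le_lt_trans hu.
  by rewrite lerDr sqr_ge0.
have [h|h] := leP r' (2 * (r - r')); first by lra.
have cv2 : c ^+ 2 <= v ^+ 2 by rewrite -[c ^+ 2]real_normK ?num_real// lerXn2r ?nnegrE.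
have v2 : r' <= 2 * v.
  rewrite -(ler_pXn2r (n := 2)) ?nnegrE ?mulr_ge0// exprMn.
  have := sqr_ge0 v; lra.
rewrite -(ler_pM2r (x := r')); last by lra.
apply: (@le_trans _ _ ((u - v) * (u + v))).
  by apply: ler_wpM2l; [rewrite subr_ge0|lra].
have -> : (u - v) * (u + v) = u ^+ 2 - v ^+ 2 by ring.
have : u ^+ 2 - v ^+ 2 <= r ^+ 2 - r' ^+ 2 by lra.
have -> : r ^+ 2 - r' ^+ 2 = (r - r') * (r + r') by ring.
move=> /le_trans; apply; rewrite -mulrA mulrCA; apply: ler_wpM2l; [by lra|by lra].
Qed.

Lemma mu_interval (x t : R) : 0 <= t -> mu (`[x - t, x + t]%classic : set R) = (2 * t)%:E.
Proof.
move=> t0; rewrite lebesgue_measure_itv /= lte_fin; case: ifPn => h.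
  by rewrite -EFinB; congr EFin; ring.
by move: h; rewrite -leNgt => h; congr EFin; lra.
Qed.

Lemma strip_measure (c r' r : R) (X : set R) : 0 <= r' -> r' < r -> measurable X ->
  (forall y, X y -> `|c| <= `|y| /\ r' ^+ 2 <= c ^+ 2 + y ^+ 2 < r ^+ 2) ->
  (mu X <= (12 * (r - r'))%:E)%E.
Proof.
move=> r'0 r'r mX XP.
have [X0|/set0P[y0 Xy0]] := eqVneq X set0.
  by rewrite X0 measure0 lee_fin mulr_ge0// subr_ge0 ltW.
have d0 : 0 <= 3 * (r - r') by rewrite mulr_ge0// subr_ge0 ltW.
pose A1 : set R := `[`|y0| - 3 * (r - r'), `|y0| + 3 * (r - r')]%classic.
pose A2 : set R := `[- `|y0| - 3 * (r - r'), - `|y0| + 3 * (r - r')]%classic.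
have sub : X `<=` A1 `|` A2.
  move=> y Xy; have [cy hy] := XP y Xy; have [cy0 hy0] := XP y0 Xy0.
  rewrite -[y ^+ 2]real_normK ?num_real// in hy.
  rewrite -[y0 ^+ 2]real_normK ?num_real// in hy0.
  have := abs_strip r'0 r'r (normr_ge0 y) (normr_ge0 y0) cy cy0 hy hy0.
  rewrite ler_norml => /andP[h1 h2].
  have [y_ge0|y_lt0] := leP 0 y.
    by left; rewrite ger0_norm// in h1 h2; rewrite /A1 /= in_itv /=; apply/andP; split; lra.
  by right; rewrite ltr0_norm// in h1 h2; rewrite /A2 /= in_itv /=; apply/andP; split; lra.
have mA1 : measurable A1 by exact: measurable_itv.
have mA2 : measurable A2 by exact: measurable_itv.
apply: (@le_trans _ _ (mu (A1 `|` A2))).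
  by apply: le_measure; rewrite ?inE//; exact: measurableU.
apply: (@le_trans _ _ (mu A1 + mu A2)%E); first exact: measureU2.
rewrite (mu_interval `|y0| d0) (mu_interval (- `|y0|) d0) -EFinD lee_fin; lra.
Qed.

Lemma section_bound (F : R -> \bar R) (x0 t c : R) : 0 <= t -> 0 <= c ->
  measurable_fun [set: R] F -> (forall x, 0 <= F x)%E ->
  (forall x, `|x - x0| < t -> (F x <= c%:E)%E) -> (forall x, t <= `|x - x0| -> F x = 0%E) ->
  (\int[mu]_x F x <= (c * (2 * t))%:E)%E.
Proof.
move=> t0 c0 mF F0 Fc Fz.
have mD : measurable (`[x0 - t, x0 + t]%classic : set R) by [].
rewrite EFinM -(mu_interval x0 t0) -(integral_cst mu mD).
rewrite [leRHS]integral_mkcond; apply: ge0_le_integral => //.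
  by apply/measurable_restrict => //; rewrite ?setTI; exact: measurable_cst.
move=> x _; rewrite patchE; case: ifPn => [_|].
  by have [h|h] := ltP `|x - x0| t; [exact: Fc|rewrite Fz].
rewrite notin_setE /= in_itv /= => h; rewrite Fz//.
rewrite leNgt; apply/negP => h2; apply: h; move: h2; rewrite ltr_norml => /andP[? ?].
by apply/andP; split; lra.
Qed.

Lemma mu2_swap (E : set (R * R)) : measurable E -> mu2 E = (\int[mu]_y mu (ysection E y))%E.
Proof.
move=> mE; apply: (product_measure_unique (m' := (mu \x^ mu)%E)) => // A B mA mB.
exact: product_measure2E.
Qed.

(** The bound t^2 is that of the disc. For the bound (r - r') t the annulus is
    cut along the diagonals, and each part is sliced along its larger
    coordinate, where the sections have length comparable to r - r'. *)
Lemma area_annulus_disc (r' r : R) b t : 0 <= r' -> r' < r -> 0 <= t ->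
  (mu2 (half_open_annulus r' r `&` plane_disc b t) <= (48 * (Num.min (r - r') t * t))%:E)%E.
Proof.
move=> r'0 r'r t0; set E := _ `&` _.
have mE : measurable E.
  by apply: measurableI; [exact: measurable_half_open_annulus|exact: measurable_plane_disc].
have dd : 0 <= r - r' by rewrite subr_ge0 ltW.
have Eb p : E p -> [/\ r' ^+ 2 <= p.1 ^+ 2 + p.2 ^+ 2 < r ^+ 2,
    `|p.1 - cRe b| < t & `|p.2 - cIm b| < t].
  move=> [/= /andP[h1 h2] h3]; have [h4 h5] := plane_dist_ge b p.
  split; [|exact: le_lt_trans h4 h3|exact: le_lt_trans h5 h3].
  move: h1 h2; rewrite plane_distE /= !subr0.
  have s0 : 0 <= p.1 ^+ 2 + p.2 ^+ 2 by rewrite addr_ge0 ?sqr_ge0.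
  move=> h1 h2; rewrite -(sqr_sqrtr s0).
  by rewrite lerXn2r ?ltrXn2r ?nnegrE ?sqrtr_ge0// (le_trans r'0 (ltW r'r)).
rewrite minr_pMl//; have [mt|mt] := leP (r - r') t; last first.
  apply: (@le_trans _ _ ((2 * t) * (2 * t))%:E); last first.
    by rewrite lee_fin min_r ?ler_wpM2r ?(ltW mt)//; have := mulr_ge0 t0 t0; lra.
  apply: (@section_bound _ (cRe b)) => //; first by rewrite mulr_ge0.
  - exact: measurable_fun_xsection.
  - move=> x _; rewrite /= -(mu_interval (cIm b) t0); apply: le_measure; rewrite ?inE//.
      exact: measurable_xsection.
    move=> y; rewrite /xsection /= inE => /Eb[_ _]; rewrite /= ltr_norml => /andP[? ?].
    by rewrite in_itv /=; apply/andP; split; lra.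
  - move=> x h; rewrite /= (_ : xsection E x = set0) ?measure0//.
    by apply/seteqP; split=> y //; rewrite /xsection /= inE => /Eb[_ /= h1 _]; move: h1; rewrite ltNge h.
rewrite min_l ?ler_wpM2r//.
pose E1 := E `&` [set p | `|p.1| <= `|p.2|]; pose E2 := E `&` [set p | `|p.2| <= `|p.1|].
have mabs1 : measurable_fun [set: R * R] (fun p => `|p.1|).
  by apply: measurableT_comp => //; exact: measurable_fst.
have mabs2 : measurable_fun [set: R * R] (fun p => `|p.2|).
  by apply: measurableT_comp => //; exact: measurable_snd.
have mE1 : measurable E1 by apply: measurableI => //; exact: measurable_setle.
have mE2 : measurable E2 by apply: measurableI => //; exact: measurable_setle.
apply: (@le_trans _ _ (mu2 (E1 `|` E2))).
  apply: le_measure; rewrite ?inE//; first exact: measurableU.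
  by move=> p Ep; have [h|/ltW h] := leP `|p.1| `|p.2|; [left|right].
apply: (@le_trans _ _ (mu2 E1 + mu2 E2)%E); first exact: measureU2.
have c0 : 0 <= 12 * (r - r') by rewrite mulr_ge0.
have B1 : (mu2 E1 <= (12 * (r - r') * (2 * t))%:E)%E.
  apply: (@section_bound _ (cRe b)) => //.
  - exact: measurable_fun_xsection.
  - move=> x _ /=; apply: (@strip_measure x r' r) => //; first exact: measurable_xsection.
    by move=> y; rewrite /xsection /= inE => -[/Eb[? _ _] /= ?].
  - move=> x h; rewrite /= (_ : xsection E1 x = set0) ?measure0//.
    by apply/seteqP; split=> y //; rewrite /xsection /= inE => -[/Eb[_ /= h1 _] _]; move: h1; rewrite ltNge h.
have B2 : (mu2 E2 <= (12 * (r - r') * (2 * t))%:E)%E.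
  rewrite (mu2_swap mE2); apply: (@section_bound _ (cIm b)) => //.
  - exact: measurable_fun_ysection.
  - move=> y _ /=; apply: (@strip_measure y r' r) => //; first exact: measurable_ysection.
    by move=> x; rewrite /ysection /= inE => -[/Eb[/= h _ _] /= ?]; rewrite addrC.
  - move=> y h; rewrite /= (_ : ysection E2 y = set0) ?measure0//.
    by apply/seteqP; split=> x //; rewrite /ysection /= inE => -[/Eb[_ _ /= h1] _]; move: h1; rewrite ltNge h.
apply: le_trans (leeD B1 B2) _; rewrite -EFinD lee_fin; lra.
Qed.

End PlaneArea.

(** * Area integral of the kernel *)

Section KernelIntegral.
Variable R : realType.
Local Notation C := (Cplx R).
Local Notation mu := (@lebesgue_measure R).
Local Notation mu2 := (mu \x mu)%E.
Implicit Types (b : C) (p : R * R) (rho : R).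

(** The integral is a supremum over the simple functions below the integrand,
    so this applies to integrands such as f'/f as they stand. *)
Lemma le_integral_nonneg d (T : measurableType d) (m : {measure set T -> \bar R}) (D : set T)
    (f g : T -> \bar R) :
  (forall x, D x -> 0 <= f x)%E -> (forall x, D x -> f x <= g x)%E ->
  (\int[m]_(x in D) f x <= \int[m]_(x in D) g x)%E.
Proof.
move=> f0 fg; rewrite !ge0_integralE//; last by move=> x Dx; exact: le_trans (f0 x Dx) (fg x Dx).
apply: le_ereal_sup => _ [h hf <-]; exists h => // x.
apply: le_trans (hf x) _; rewrite !patchE; case: ifPn => // /set_mem; exact: fg.
Qed.

(** A function covered pointwise by the pieces g n is below their sum, which
    is integrated termwise. *)
Lemma integral_cover d (T : measurableType d) (m : {measure set T -> \bar R}) (A : set T)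
    (F : T -> R) (g : nat -> T -> R) (e : nat -> R) (B : R) : measurable A ->
  (forall x, A x -> 0 <= F x) -> (forall n, measurable_fun setT (g n)) ->
  (forall n x, 0 <= g n x) -> (forall x, A x -> exists n, F x <= g n x) ->
  (forall n, \int[m]_(x in A) (g n x)%:E <= (e n)%:E)%E ->
  (forall n, \sum_(k < n) e k <= B) -> (\int[m]_(x in A) (F x)%:E <= B%:E)%E.
Proof.
move=> mA F0 mg g0 Fg ge eB.
apply: (@le_trans _ _ (\int[m]_(x in A) (\sum_(0 <= n <oo) (g n x)%:E))%E).
  apply: le_integral_nonneg => p Ap; first by rewrite lee_fin F0.
  have [n Fn] := Fg p Ap.
  apply: (@le_trans _ _ (\sum_(0 <= k < n.+1) (g k p)%:E)%E); last first.
    by apply: nneseries_lim_ge => k _ _; rewrite lee_fin.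
  rewrite big_nat_recr//= -[leLHS]add0e; apply: leeD; last by rewrite lee_fin.
  by apply: sume_ge0 => k _; rewrite lee_fin.
rewrite integral_nneseries//; last 2 first.
- by move=> n; apply/measurable_EFinP; exact: measurable_funS (mg n).
- by move=> n p _; rewrite lee_fin.
apply: lime_le.
  by apply: is_cvg_nneseries => n _ _; apply: integral_ge0 => p _; rewrite lee_fin.
apply: nearW => n; apply: (@le_trans _ _ (\sum_(0 <= k < n) (e k)%:E)%E); first exact: lee_sum.
by rewrite sumEFin lee_fin big_mkord.
Qed.

Lemma measurable_inv : measurable_fun [set: R] (@GRing.inv R).
Proof.
rewrite -(setUv [set 0 : R]); apply/measurable_funU => //; first exact: measurableC.
split; first exact: measurable_fun_set1.
apply: open_continuous_measurable_fun; first by apply: closed_openC; exact: closed_eq.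
by move=> x; rewrite inE /= => /eqP x0; exact: inv_continuous.
Qed.

(** A common majorant for the Schwarz kernel, when b lies on the circle of
    radius rho, and for the Blaschke terms, where the maximum is a lower bound
    for |rho^2 - conj b z| / rho. *)
Definition kappa rho b p : R := (plane_dist b p * Num.max (plane_dist b p) (rho - plane_dist 0 p))^-1.

Lemma measurable_kappa rho b : measurable_fun [set: R * R] (kappa rho b).
Proof.
apply: (measurableT_comp (f := @GRing.inv R)); first exact: measurable_inv.
apply: measurable_funM; first exact: measurable_plane_dist.
apply: measurable_maxr; first exact: measurable_plane_dist.
by apply: measurable_funB; [exact: measurable_cst|exact: measurable_plane_dist].
Qed.

Lemma plane_dist_ge0 b p : 0 <= plane_dist b p.
Proof. exact: modulus_ge0. Qed.

Lemma kappa_ge0 rho b p : 0 <= kappa rho b p.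
Proof. by rewrite invr_ge0 mulr_ge0 ?le_max ?plane_dist_ge0. Qed.

Lemma ln2_ge_half : 1 / 2 <= ln 2 :> R.
Proof.
have := @le_ln1Dx R (- (1 / 2)); rewrite (_ : 1 + - (1 / 2) = 2^-1); last by field.
by rewrite lnV ?posrE// => /(_ ltac:(lra)); lra.
Qed.

Lemma geometric_half (n : nat) : \sum_(k < n) 2^-1 ^+ k <= 2 :> R.
Proof.
suff : \sum_(k < n) 2^-1 ^+ k + 2 * 2^-1 ^+ n = 2 :> R.
  have : 0 <= 2^-1 ^+ n :> R by rewrite exprn_ge0.
  lra.
elim: n => [|n IH]; first by rewrite big_ord0 expr0; ring.
by move: IH; rewrite big_ord_recr /= exprSr; lra.
Qed.

Lemma first_power (q : R) : 0 < q -> exists n : nat, [/\ 2^-1 ^+ n <= q &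
   forall k, (k < n)%N -> q < 2^-1 ^+ k].
Proof.
move=> q0; have ex : exists n : nat, 2^-1 ^+ n <= q.
  have h : 0 <= (2^-1 : R) < 1 by apply/andP; split; lra.
  by have [n /ltW] := ratio_exp_small h q0; exists n.
pose n := ex_minn ex; exists n; rewrite /n; case: ex_minnP => k kq kmin; split=> // j jk.
by rewrite ltNge; apply/negP => /kmin; rewrite leqNgt jk.
Qed.

Lemma first_power_ln (q : R) (n : nat) : 0 < q -> (forall k, (k < n)%N -> q < 2^-1 ^+ k) ->
  q <= 1 -> n%:R <= 1 + 2 * ln q^-1.
Proof.
move=> q0 H q1; have lq : 0 <= ln q^-1.
  by rewrite ln_ge0// invf_ge1.
case: n H => [_|n H]; first by rewrite mulr0n; lra.
have h : ln 2 *+ n <= ln q^-1.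
  rewrite -lnXn// ler_ln ?posrE ?exprn_gt0 ?invr_gt0// -[2 ^+ n]invrK.
  by rewrite lef_pV2 ?posrE ?invr_gt0 ?exprn_gt0// -exprVn ltW// H.
have : n%:R * (1 / 2) <= n%:R * ln 2 :> R by rewrite ler_wpM2l// ln2_ge_half.
by rewrite -[ln 2 *+ n]mulr_natl in h; rewrite -[n.+1%:R]natr1 => h1; lra.
Qed.

(** The number of scales above D is logarithmic in d / D, and below D the
    terms decrease geometrically. *)
Lemma sum_min_bound (D d : R) (n : nat) : 0 < D -> D <= d ->
  \sum_(k < n) Num.min D (2^-1 ^+ k * d) <= D * (3 + 2 * ln (d / D)).
Proof.
move=> D0 Dd; have d0 : 0 < d by exact: lt_le_trans Dd.
have [N [N1 N2]] := first_power (divr_gt0 D0 d0).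
have q1 : D / d <= 1 by rewrite ler_pdivrMr// mul1r.
have := first_power_ln (divr_gt0 D0 d0) N2 q1; rewrite invf_div => Nb.
have m0 k : 0 <= Num.min D (2^-1 ^+ k * d).
  by rewrite le_min (ltW D0) mulr_ge0 ?exprn_ge0 ?(ltW d0).
apply: (@le_trans _ _ (\sum_(k < N + n) Num.min D (2^-1 ^+ k * d))).
  rewrite addnC; rewrite -!(big_mkord xpredT (fun k => Num.min D (2^-1 ^+ k * d))).
  by rewrite (big_cat_nat (leq0n n) (leq_addr N n)) /= lerDl; apply: sumr_ge0.
rewrite -(big_mkord xpredT (fun k => Num.min D (2^-1 ^+ k * d))).
rewrite (big_cat_nat (leq0n N) (leq_addr n N)) /=.
have S1 : \sum_(0 <= k < N) Num.min D (2^-1 ^+ k * d) <= N%:R * D.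
  have -> : N%:R * D = \sum_(k < N) D by rewrite sumr_const card_ord mulr_natl.
  rewrite big_mkord; apply: ler_sum => k _.
  by rewrite ge_min lexx.
have S2 : \sum_(N <= k < N + n) Num.min D (2^-1 ^+ k * d) <= 2 * D.
  rewrite -{1}[N]add0n [(N + n)%N]addnC big_addn addnK big_mkord.
  apply: (@le_trans _ _ (\sum_(k < n) 2^-1 ^+ k * D)).
    apply: ler_sum => k _; rewrite ge_min exprD -mulrA; apply/orP; right.
    apply: ler_wpM2l; first by rewrite exprn_ge0.
    by rewrite -ler_pdivlMr.
  by rewrite -mulr_suml ler_wpM2r ?geometric_half// ltW.
have : N%:R * D <= (1 + 2 * ln (d / D)) * D by rewrite ler_wpM2r// ltW.
have -> : D * (3 + 2 * ln (d / D)) = (1 + 2 * ln (d / D)) * D + 2 * D by ring.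
by move=> h; lra.
Qed.

Lemma integral_disc_annulus (r' r : R) b (c t : R) : 0 <= r' -> r' < r -> 0 <= c -> 0 <= t ->
  (\int[mu2]_(p in half_open_annulus r' r) (c * \1_(plane_disc b t) p)%:E <=
   (c * (48 * (Num.min (r - r') t * t)))%:E)%E.
Proof.
move=> r'0 r'r c0 t0.
have mA := measurable_half_open_annulus r' r; have mP := measurable_plane_disc b t.
under eq_integral do rewrite EFinM.
rewrite ge0_integralZl_EFin//; last first.
  by apply/measurable_EFinP; exact: measurable_indic.
rewrite integral_indic// EFinM lee_wpmul2l ?lee_fin// setIC.
exact: area_annulus_disc.
Qed.

Section Thin.
Variables (rho r' r : R) (b : C).
Hypotheses (r'0 : 0 <= r') (r'r : r' < r) (rrho : r < rho).
Hypothesis thin : r - r' <= (rho - r') / 2.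

Let d := rho - r'.
Let D := r - r'.
Let A := half_open_annulus r' r.

Let d0 : 0 < d. Proof. by rewrite subr_gt0; exact: lt_trans rrho. Qed.
Let D0 : 0 < D. Proof. by rewrite subr_gt0. Qed.

(* Dyadic pieces at scales above and below d. On a thin annulus the distance
   to the outer circle, and so the second factor of the kernel, is at least d
   / 2. *)
Let far k p := (16 * (2^-1 ^+ k) ^+ 2 / d ^+ 2) * \1_(plane_disc b (2 ^+ k * d)) p.
Let near_ k p := (4 * 2 ^+ k / d ^+ 2) * \1_(plane_disc b (2^-1 ^+ k * d)) p.

Lemma kappa_cover p : A p -> exists k, kappa rho b p <= far k p + near_ k p.
Proof.
move=> /andP[_ pr]; set q := plane_dist b p.
have q0 : 0 <= q by exact: plane_dist_ge0.
have far0 k : 0 <= far k p.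
  apply: mulr_ge0; last by rewrite indicE.
  by apply: divr_ge0; [apply: mulr_ge0|]; rewrite ?sqr_ge0.
have near0 k : 0 <= near_ k p.
  apply: mulr_ge0; last by rewrite indicE.
  by apply: divr_ge0; [apply: mulr_ge0|]; rewrite ?sqr_ge0 ?exprn_ge0.
have md : d / 2 <= Num.max q (rho - plane_dist 0 p).
  by rewrite le_max; apply/orP; right; move: (pr : plane_dist 0 p < r) thin; rewrite /d; lra.
have [qE|qn0] := eqVneq q 0.
  by exists 0%N; rewrite /kappa -/q qE mul0r invr0 addr_ge0.
have qp : 0 < q by rewrite lt_def qn0.
have [qd|dq] := ltP q (d / 2).
  have [k [k1 k2]] := first_power (divr_gt0 qp d0).
  have k0 : (0 < k)%N.
    by case: k k1 {k2} => // ; rewrite expr0 ler_pdivlMr// mul1r => k1; exfalso; lra.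
  exists k.-1; rewrite -[leLHS]add0r; apply: lerD => //.
  rewrite /near_ indicE mem_set ?mulr1; last first.
    by have := k2 k.-1; rewrite prednK// => /(_ (leqnn _)); rewrite ltr_pdivrMr.
  move: k1; rewrite -(prednK k0) ler_pdivlMr// exprS => k1.
  have h : 0 < 2^-1 ^+ k.-1 :> R by rewrite exprn_gt0.
  have -> : 4 * 2 ^+ k.-1 / d ^+ 2 = ((2^-1 * 2^-1 ^+ k.-1 * d) * (d / 2))^-1.
    rewrite exprVn; have : 2 ^+ k.-1 != 0 :> R by rewrite expf_neq0.
    by move: (2 ^+ k.-1) => z z0; field; rewrite z0 lt0r_neq0.
  rewrite /kappa -/q lef_pV2 ?posrE; last 2 first.
  - by rewrite mulr_gt0//; apply: lt_le_trans md; rewrite divr_gt0.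
  - by rewrite !mulr_gt0 ?divr_gt0.
  by apply: ler_pM; rewrite ?mulr_ge0 ?(ltW h) ?(ltW d0) ?divr_ge0.
have kq : kappa rho b p <= (q * q)^-1.
  rewrite /kappa -/q lef_pV2 ?posrE ?mulr_gt0//; last first.
    by apply: lt_le_trans md; rewrite divr_gt0.
  by rewrite ler_wpM2l// le_max lexx.
have qq : 0 < 2 * q by rewrite mulr_gt0.
(* The first n with q <= 2^n d / 2, so that q lies between 2^n d / 4 and 2^n
   d. *)
have [n [n1 n2]] := first_power (divr_gt0 d0 qq).
exists n; rewrite -[leLHS]addr0; apply: lerD => //; apply: (le_trans kq).
have pn : 0 < 2 ^+ n :> R by rewrite exprn_gt0.
have qn : q < 2 ^+ n * d.
  move: n1; rewrite exprVn ler_pdivlMr// mulrC ler_pdivrMr// => n1.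
  by rewrite mulrC; lra.
rewrite /far indicE mem_set ?mulr1//.
have qn4 : 2 ^+ n * d <= 4 * q.
  case: n {n1 qn} n2 pn => [_ _|n /(_ n (leqnn _)) n2 _]; first by rewrite expr0; lra.
  have pn : 0 < 2 ^+ n :> R by rewrite exprn_gt0.
  move: n2; rewrite exprVn ltr_pdivrMr// mulrC ltr_pdivlMr// => n2.
  by rewrite exprS; lra.
have -> : 16 * (2^-1 ^+ n) ^+ 2 / d ^+ 2 = ((2 ^+ n * d / 4) * (2 ^+ n * d / 4))^-1.
  by rewrite exprVn; field; rewrite !lt0r_neq0.
rewrite lef_pV2 ?posrE ?mulr_gt0//.
have h : 2 ^+ n * d / 4 <= q by lra.
by apply: ler_pM; rewrite ?mulr_ge0 ?(ltW pn) ?(ltW d0).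
Qed.

(** By the area bound, the pieces of index k contribute at most a multiple of
    min (D, 2^-k d) / d. *)
Lemma thin_kernel_integral :
  (\int[mu2]_(p in A) (kappa rho b p)%:E <= (2880 * (D / d * (1 + ln (d / D))))%:E)%E.
Proof.
have p2 k : 0 < 2 ^+ k :> R by rewrite exprn_gt0.
have h2 k : 0 < 2^-1 ^+ k :> R by rewrite exprn_gt0.
have cf k : 0 <= 16 * (2^-1 ^+ k) ^+ 2 / d ^+ 2.
  by apply: divr_ge0; [apply: mulr_ge0|]; rewrite ?sqr_ge0.
have cn k : 0 <= 4 * 2 ^+ k / d ^+ 2.
  by apply: divr_ge0; [apply: mulr_ge0|]; rewrite ?sqr_ge0 ?(ltW (p2 k)).
have mf k : measurable_fun setT (far k).
  by apply: measurable_funM; [exact: measurable_cst|apply: measurable_indic; exact: measurable_plane_disc].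
have mn k : measurable_fun setT (near_ k).
  by apply: measurable_funM; [exact: measurable_cst|apply: measurable_indic; exact: measurable_plane_disc].
have f0 k p : 0 <= far k p by apply: mulr_ge0; [exact: cf|rewrite indicE].
have n0 k p : 0 <= near_ k p by apply: mulr_ge0; [exact: cn|rewrite indicE].
have mA : measurable A by exact: measurable_half_open_annulus.
have Dd : D <= d by move: rrho; rewrite /D /d; lra.
apply: (@integral_cover _ _ mu2 A (kappa rho b) (fun k p => far k p + near_ k p)
  (fun k => 960 / d * Num.min D (2^-1 ^+ k * d))).
- exact: mA.
- by move=> p _; exact: kappa_ge0.
- by move=> k; apply: measurable_funD; [exact: mf|exact: mn].
- by move=> k p; exact: addr_ge0.
- exact: kappa_cover.
- move=> k; under eq_integral do rewrite EFinD.
  rewrite ge0_integralD//; last 4 first.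
  + by move=> p _; rewrite lee_fin.
  + by apply/measurable_EFinP; exact: measurable_funS (mf k).
  + by move=> p _; rewrite lee_fin.
  + by apply/measurable_EFinP; exact: measurable_funS (mn k).
  have tf : 0 <= 2 ^+ k * d by rewrite mulr_ge0 ?ltW.
  have tn : 0 <= 2^-1 ^+ k * d by rewrite mulr_ge0 ?ltW.
  apply: le_trans (leeD (integral_disc_annulus b r'0 r'r (cf k) tf)
    (integral_disc_annulus b r'0 r'r (cn k) tn)) _.
  rewrite -EFinD lee_fin -/D; set M := Num.min D (2^-1 ^+ k * d).
  have -> : 4 * 2 ^+ k / d ^+ 2 * (48 * (M * (2^-1 ^+ k * d))) = 192 / d * M.
    by rewrite exprVn; field; rewrite !lt0r_neq0.
  have hk1 : 2^-1 ^+ k <= 1 :> R by apply: exprn_ile1; lra.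
  have hM : 2^-1 ^+ k * D <= M.
    rewrite le_min; apply/andP; split; last by apply: ler_wpM2l; rewrite // ltW.
    by rewrite ler_piMl// ltW.
  have : 16 * (2^-1 ^+ k) ^+ 2 / d ^+ 2 * (48 * (Num.min D (2 ^+ k * d) * (2 ^+ k * d)))
      <= 768 / d * M.
    have -> : 16 * (2^-1 ^+ k) ^+ 2 / d ^+ 2 * (48 * (Num.min D (2 ^+ k * d) * (2 ^+ k * d)))
      = 768 / d * (2^-1 ^+ k * Num.min D (2 ^+ k * d)).
      by move: (Num.min D _) => N; rewrite exprVn; field; rewrite !lt0r_neq0.
    apply: ler_wpM2l; first by apply: divr_ge0; [exact: ler0n|exact: ltW].
    by apply: le_trans hM; apply: ler_wpM2l; [exact: ltW|rewrite ge_min lexx].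
  have -> : 960 / d * M = 768 / d * M + 192 / d * M by ring.
  by move=> h; rewrite lerD2r.
move=> n; rewrite -mulr_sumr.
apply: le_trans (ler_wpM2l _ (sum_min_bound n D0 Dd)) _; first by apply: divr_ge0; [exact: ler0n|exact: ltW].
have x0 : 0 <= D / d by rewrite divr_ge0 ?ltW.
have -> : 960 / d * (D * (3 + 2 * ln (d / D))) = D / d * (2880 + 1920 * ln (d / D)) by ring.
have L0 : 0 <= ln (d / D) by rewrite ln_ge0// ler_pdivlMr// mul1r.
by rewrite mulrCA; apply: ler_wpM2l => //; lra.
Qed.

Lemma thin_kernel_integral_le : (\int[mu2]_(p in A) (kappa rho b p)%:E <= (2880 : R)%:E)%E.
Proof.
apply: le_trans thin_kernel_integral _; rewrite lee_fin ler_piMr ?ler0n//.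
have y0 : 0 < d / D by rewrite divr_gt0.
have := @le_ln1Dx R (d / D - 1); rewrite addrCA subrr addr0 => h.
have {}h : ln (d / D) <= d / D - 1 by apply: h; lra.
have E : D / d * (d / D) = 1 by field; rewrite !lt0r_neq0.
rewrite -[leRHS]E.
by apply: ler_wpM2l; [rewrite divr_ge0 ?ltW|lra].
Qed.

End Thin.

Lemma half_open_annulus_split (r' s r : R) : r' <= s -> s <= r ->
  half_open_annulus r' r = half_open_annulus r' s `|` half_open_annulus s r.
Proof.
move=> r's sr; apply/seteqP; split=> p.
  by move=> /andP[h1 h2]; have [h|h] := leP s (plane_dist 0 p); [right|left]; apply/andP.
move=> [|] /andP[h1 h2]; apply/andP; split=> //.
  exact: lt_le_trans sr.
exact: le_trans h1.
Qed.

(** Halving the distance to the outer circle repeatedly cuts the annulus into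
    n + 1 thin ones, each with a bounded integral. *)
Lemma thick_kernel_integral rho b (n : nat) (r' r : R) : 0 <= r' -> r' < r -> r < rho ->
  2^-1 ^+ n.+1 * (rho - r') <= rho - r ->
  (\int[mu2]_(p in half_open_annulus r' r) (kappa rho b p)%:E <= (2880 * n.+1%:R)%:E)%E.
Proof.
elim: n r' => [|n IH] r' r'0 r'r rr h.
  rewrite mulr1; apply: thin_kernel_integral_le => //.
  by move: h; rewrite expr1; lra.
have [thin|thick] := leP (r - r') ((rho - r') / 2).
  apply: (le_trans (thin_kernel_integral_le b r'0 r'r rr thin)).
  by rewrite lee_fin; apply: ler_peMr; [exact: ler0n|rewrite ler1n].
pose s := (rho + r') / 2.
have r's : r' < s by rewrite /s; lra.
have sr : s < r by rewrite /s; lra.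
have mK : measurable_fun [set: R * R] (EFin \o kappa rho b).
  by apply/measurable_EFinP; exact: measurable_kappa.
rewrite (half_open_annulus_split (ltW r's) (ltW sr)).
rewrite ge0_integral_setU; [|exact: measurable_half_open_annulus..| | |]; last 3 first.
- by apply: measurable_funS mK => //; exact: measurableT.
- by move=> p _; rewrite lee_fin kappa_ge0.
- apply/disj_setPS => p [/andP[_ h1] /andP[h2 _]].
  by move: (lt_le_trans h1 h2); rewrite ltxx.
have -> : 2880 * n.+2%:R = 2880 + 2880 * n.+1%:R :> R by rewrite -[n.+2%:R]natr1; ring.
rewrite EFinD; apply: leeD.
  by apply: thin_kernel_integral_le => //; [exact: lt_trans rr|rewrite /s; lra].
apply: IH => //; first by rewrite /s; lra.
move: h; rewrite exprS /s; lra.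
Qed.

Definition radial_factor (r' r rho : R) : R :=
  (r - r') / (rho - r') * (1 + ln ((rho - r') / (r - r'))) + ln ((rho - r') / (rho - r)).

(** A thick annulus needs a number of halvings that is logarithmic in (rho -
    r') / (rho - r). *)
Lemma kernel_integral rho b (r' r : R) : 0 <= r' -> r' < r -> r < rho ->
  (\int[mu2]_(p in half_open_annulus r' r) (kappa rho b p)%:E <=
   (5760 * radial_factor r' r rho)%:E)%E.
Proof.
move=> r'0 r'r rr; rewrite /radial_factor.
set x := (r - r') / (rho - r'); set y := (rho - r) / (rho - r').
have d0 : 0 < rho - r' by lra.
have D0 : 0 < r - r' by lra.
have x0 : 0 < x by exact: divr_gt0.
have y0 : 0 < y by apply: divr_gt0; lra.
have xy : x + y = 1 by rewrite /x /y; field; lra.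
have -> : ln ((rho - r') / (rho - r)) = ln y^-1 by rewrite /y invf_div.
have Ly : 0 <= ln y^-1 by rewrite ln_ge0// invf_ge1//; lra.
have Lx : 0 <= ln ((rho - r') / (r - r')) by rewrite ln_ge0// ler_pdivlMr// mul1r; lra.
have xL : 0 <= x * ln ((rho - r') / (r - r')) by apply: mulr_ge0; [exact: ltW|exact: Lx].
have [thin|thick] := leP (r - r') ((rho - r') / 2).
  apply: (le_trans (thin_kernel_integral b r'0 r'r rr thin)).
  rewrite lee_fin -/x [x * (1 + _)]mulrDr mulr1; lra.
have xh : 1 / 2 < x by rewrite /x ltr_pdivlMr//; lra.
have [[|n] [n1 n2]] := first_power y0; first by exfalso; move: n1; rewrite expr0; lra.
have := first_power_ln y0 n2 ltac:(lra) => hn.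
apply: (le_trans (@thick_kernel_integral rho b n r' r r'0 r'r rr _)).
  by move: n1; rewrite /y ler_pdivlMr.
rewrite lee_fin [x * (1 + _)]mulrDr mulr1; lra.
Qed.

End KernelIntegral.

(** * The area bound in terms of boundary data *)

Section AreaBound.
Variable R : realType.
Local Notation C := (Cplx R).
Local Notation mu := (@lebesgue_measure R).
Local Notation mu2 := (mu \x mu)%E.
Local Notation period := (`[0, (2 * pi)]%classic : set R).
Implicit Types (a b z : C) (p : R * R).

Lemma sigma_finite_area : sigma_finite [set: R * R] mu2.
Proof.
exists (fun n => half_open_annulus 0 n.+1%:R `&` plane_disc (0 : C) n.+1%:R).
  apply/seteqP; split=> // p _.
  exists (Num.truncn (plane_dist 0 p)) => //=.
  have h : plane_dist (0 : C) p < (Num.truncn (plane_dist (0 : C) p)).+1%:R.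
    by have /andP[] := truncn_itv (plane_dist_ge0 (0 : C) p).
  by split=> //; apply/andP; split=> //; exact: plane_dist_ge0.
move=> n; split.
  by apply: measurableI; [exact: measurable_half_open_annulus|exact: measurable_plane_disc].
by apply: le_lt_trans (area_annulus_disc _ _ _ _) _; rewrite ?ltr0n ?ler0n ?ltry.
Qed.

(** A named copy of the product measure that carries its sigma-finiteness,
    needed for Tonelli's theorem. *)
Definition plane_measure := (mu \x mu)%E.
HB.instance Definition _ := Measure.copy plane_measure (mu \x mu)%E.
HB.instance Definition _ := Measure_isSigmaFinite.Build _ _ _ plane_measure sigma_finite_area.

Lemma finite_plane_null (s : seq C) :
  measurable [set p | plane_pt p \in s] /\ mu2 [set p | plane_pt p \in s] = 0%E.
Proof.
elim: s => [|b s [ms ns]].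
  have -> : [set p : R * R | plane_pt p \in [::]] = set0 by apply/seteqP; split.
  by rewrite measure0.
have E : [set p | plane_pt p \in b :: s] =
    ([set cRe b] `*` [set cIm b]) `|` [set p | plane_pt p \in s].
  apply/seteqP; split=> p /=.
    by rewrite in_cons => /orP[/eqP <-|]; [left|right].
  case=> [[h1 h2]|h]; rewrite in_cons; last by rewrite h orbT.
  by apply/orP; left; apply/eqP/ceqP.
have mb : measurable ([set cRe b] `*` [set cIm b] : set (R * R)) by exact: measurableX.
have nb : mu2 ([set cRe b] `*` [set cIm b]) = 0%E.
  by rewrite product_measure1E// [X in (X * _)%E]lebesgue_measure_set1 mul0e.
rewrite E; split; first exact: measurableU.
apply/eqP; rewrite eq_le measure_ge0 andbT.
apply: (@le_trans _ _ (mu2 ([set cRe b] `*` [set cIm b]) + mu2 [set p | plane_pt p \in s])%E).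
  exact: measureU2.
by rewrite nb ns adde0.
Qed.

Lemma modulus_sqr z : modulus z ^+ 2 = cRe z ^+ 2 + cIm z ^+ 2.
Proof. by case: z => x y; rewrite modulusE sqr_sqrtr// addr_ge0 ?sqr_ge0. Qed.

Lemma subr_sqr_ge0 (x y : R) : 0 <= x -> x <= y -> 0 <= y ^+ 2 - x ^+ 2.
Proof.
by move=> x0 xy; rewrite subr_ge0; apply: lerXn2r; rewrite ?nnegrE// (le_trans x0).
Qed.

(** The bound by the first term of the maximum rests on the identity |rho^2 -
    conj b z|^2 - rho^2 |z - b|^2 = (rho^2 - |b|^2) (rho^2 - |z|^2). *)
Lemma reflected_dist_ge (rho : R) b p : 0 < rho -> modulus b <= rho -> plane_dist 0 p < rho ->
  rho * Num.max (plane_dist b p) (rho - plane_dist 0 p) <=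
  modulus (cR (rho ^+ 2) - cconj b * plane_pt p).
Proof.
move=> rho0 brho; rewrite /plane_dist subr0; set z := plane_pt p => zrho.
suff [F1 F2] : rho * modulus (z - b) <= modulus (cR (rho ^+ 2) - cconj b * z) /\
    rho * (rho - modulus z) <= modulus (cR (rho ^+ 2) - cconj b * z) by case: (leP (modulus (z - b))) => _.
split.
  rewrite -(ler_pXn2r (n := 2)) ?nnegrE ?mulr_ge0 ?modulus_ge0 ?(ltW rho0)//.
  rewrite exprMn -subr_ge0.
  suff -> : modulus (cR (rho ^+ 2) - cconj b * z) ^+ 2 - rho ^+ 2 * modulus (z - b) ^+ 2 =
      (rho ^+ 2 - modulus b ^+ 2) * (rho ^+ 2 - modulus z ^+ 2).
    by apply: mulr_ge0; apply: subr_sqr_ge0; rewrite ?modulus_ge0// ltW.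
  rewrite !modulus_sqr; case: (b) => u v; case: (z) => x y.
  rewrite !(cReB, cImB, cReM, cImM) /=; ring.
apply: le_trans (lerB_modulus _ _).
rewrite modulus_cR modulusM modulus_conj ger0_norm ?sqr_ge0// expr2 mulrBr lerB//.
by apply: ler_wpM2r; [exact: modulus_ge0|].
Qed.

Lemma kappa_circle (rho : R) b p : modulus b = rho ->
  kappa rho b p = (plane_dist b p ^+ 2)^-1.
Proof.
move=> br; rewrite /kappa max_l ?expr2// -br /plane_dist subr0 modulus_distC.
exact: lerB_modulus.
Qed.

Lemma modulus_blaschke_term_le (rho : R) b p : 0 < rho -> modulus b <= rho ->
  plane_dist 0 p < rho ->
  modulus (blaschke_term rho (plane_pt p) b) <= (rho ^+ 2 - modulus b ^+ 2) / rho * kappa rho b p.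
Proof.
move=> rho0 brho prho.
have [E|zb] := eqVneq (plane_pt p) b.
  rewrite /blaschke_term E subrr mul0r invr0 mulr0 modulus0.
  apply: mulr_ge0; last exact: kappa_ge0.
  apply: divr_ge0; last exact: ltW.
  by apply: subr_sqr_ge0; rewrite ?modulus_ge0.
have q0 : 0 < plane_dist b p by rewrite modulus_gt0 subr_eq0.
have c0 : 0 <= rho ^+ 2 - modulus b ^+ 2.
  by apply: subr_sqr_ge0; rewrite ?modulus_ge0.
have M0 : 0 < Num.max (plane_dist b p) (rho - plane_dist 0 p) by rewrite lt_max q0.
rewrite /blaschke_term modulus_div modulus_cR modulusM (ger0_norm c0) -mulrA.
apply: ler_wpM2l => //; rewrite /kappa -invfM.
rewrite lef_pV2 ?posrE; last 2 first.
- by apply: mulr_gt0 => //; apply: lt_le_trans (reflected_dist_ge rho0 brho prho); exact: mulr_gt0.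
- by do 2! apply: mulr_gt0 => //.
rewrite mulrCA; apply: ler_wpM2l; first exact: ltW.
exact: reflected_dist_ge.
Qed.

Lemma abs_rmean_le (u v : R -> R) : rmeanable u ->
  (forall t, 0 <= t <= 2 * pi -> `|u t| <= v t) ->
  (`|rmean u|%:E <= ((2 * pi)^-1)%:E * \int[mu]_(t in period) (v t)%:E)%E.
Proof.
move=> iu uv; have c0 : 0 <= (2 * pi)^-1 :> R by rewrite invr_ge0 ltW// twopi_gt0.
rewrite /rmean normrM (ger0_norm c0) EFinM; apply: lee_wpmul2l; first by rewrite lee_fin.
have mD : measurable (`[0, 2 * pi]%classic : set R) by exact: measurable_itv.
have [mf _] := integrableP _ _ _ iu.
rewrite /Rintegral -abse_EFin fineK; last exact: integrable_fin_num.
have H := le_abse_integral mu mD mf.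
apply: (le_trans H).
apply: le_integral_nonneg => t; first by move=> _; exact: abse_ge0.
by rewrite /= in_itv /= => /uv h; rewrite lee_fin.
Qed.

Lemma modulus_cmean_le (k : R -> C) (v : R -> R) : cmeanable k ->
  (forall t, 0 <= t <= 2 * pi -> modulus (k t) <= v t) ->
  ((modulus (cmean k))%:E <= (pi^-1)%:E * \int[mu]_(t in period) (v t)%:E)%E.
Proof.
move=> [kr ki] kv.
have br := abs_rmean_le kr (fun t ht => le_trans (cRe_le_modulus (k t)) (kv t ht)).
have bi := abs_rmean_le ki (fun t ht => le_trans (cIm_le_modulus (k t)) (kv t ht)).
apply: (@le_trans _ _ (`|cRe (cmean k)|%:E + `|cIm (cmean k)|%:E)%E).
  by rewrite -EFinD lee_fin modulus_le_ReIm.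
rewrite cRe_cmean cIm_cmean; apply: le_trans (leeD br bi) _.
have c0 : (0 <= ((2 * pi)^-1 : R)%:E)%E by rewrite lee_fin invr_ge0 ltW// twopi_gt0.
rewrite -(ge0_muleDl _ c0 c0) -EFinD.
suff -> : (2 * pi)^-1 + (2 * pi)^-1 = pi^-1 :> R by exact: lexx.
have := pi_gt0 R; move: (pi : R) => q q0; field; rewrite lt0r_neq0//.
Qed.

Lemma measurable_kappa_circle (rho : R) :
  measurable_fun [set: (R * R) * R] (fun x => kappa rho (circle_pt rho x.2) x.1).
Proof.
have mc : measurable_fun [set: (R * R) * R] (fun x => rho * cos x.2).
  apply: measurable_funM; first exact: measurable_cst.
  by apply: measurableT_comp (measurable_snd) => //; apply: continuous_measurable_fun; exact: continuous_cos.
have ms : measurable_fun [set: (R * R) * R] (fun x => rho * sin x.2).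
  apply: measurable_funM; first exact: measurable_cst.
  by apply: measurableT_comp (measurable_snd) => //; apply: continuous_measurable_fun; exact: continuous_sin.
have m1 : measurable_fun [set: (R * R) * R] (fun x => x.1.1).
  by apply: measurableT_comp measurable_fst; exact: measurable_fst.
have m2 : measurable_fun [set: (R * R) * R] (fun x => x.1.2).
  by apply: measurableT_comp measurable_fst; exact: measurable_snd.
have mq : measurable_fun [set: (R * R) * R] (fun x => plane_dist (circle_pt rho x.2) x.1).
  have -> : (fun x : (R * R) * R => plane_dist (circle_pt rho x.2) x.1) =
      (fun x => Num.sqrt ((x.1.1 - rho * cos x.2) ^+ 2 + (x.1.2 - rho * sin x.2) ^+ 2)).
    by apply/funext => x; rewrite plane_distE.
  apply: (measurableT_comp (f := @Num.sqrt R)).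
    by apply: continuous_measurable_fun; exact: sqrt_continuous.
  by apply: measurable_funD; apply: measurable_funX; apply: measurable_funB.
rewrite /kappa; apply: (measurableT_comp (f := @GRing.inv R)); first exact: measurable_inv.
apply: measurable_funM; first exact: mq.
apply: measurable_maxr; first exact: mq.
apply: measurable_funB; first exact: measurable_cst.
by apply: measurableT_comp measurable_fst; exact: measurable_plane_dist.
Qed.

End AreaBound.
Section AreaBound2.
Variable R : realType.
Local Notation C := (Cplx R).
Local Notation mu := (@lebesgue_measure R).
Local Notation mu2 := (mu \x mu)%E.
Local Notation period := (`[0, (2 * pi)]%classic : set R).
Implicit Types (a b z : C) (p : R * R).

(** Tonelli's theorem exchanges the circle mean and the area integral. The
    inner integral is replaced by a measurable majorant F, so that it can be
    added to other majorants. *)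
Lemma circle_kernel_integral (rho r' r : R) (W : R -> R) :
  0 < rho -> 0 <= r' -> r' < r -> r < rho -> rmeanable W -> (forall t, 0 <= W t) ->
  exists F : R * R -> \bar R, [/\ measurable_fun setT F, (forall p, 0 <= F p)%E,
    (forall p, half_open_annulus r' r p ->
      \int[mu]_(t in period) (W t * kappa rho (circle_pt rho t) p)%:E <= F p)%E &
    (\int[mu2]_(p in half_open_annulus r' r) F p <=
     (5760 * radial_factor r' r rho * (2 * pi * rmean W))%:E)%E].
Proof.
move=> rho0 r'0 r'r rr iW W0; set A := half_open_annulus r' r.
set B := 5760 * radial_factor r' r rho.
have mA : measurable A by exact: measurable_half_open_annulus.
have mD : measurable period by exact: measurable_itv.
have mW : measurable_fun period W by case/integrableP: iW => /measurable_EFinP.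
pose V : R -> R := W \_ period.
have V0 t : 0 <= V t by rewrite /V patchE; case: ifP.
have mV : measurable_fun setT V by apply/(measurable_restrictT _ mD).
pose f (x : (R * R) * R) : \bar R :=
  (V x.2 * kappa rho (circle_pt rho x.2) x.1 * \1_A x.1)%:E.
have f0 x : (0 <= f x)%E.
  rewrite lee_fin; apply: mulr_ge0; last by rewrite indicE.
  by apply: mulr_ge0 => //; exact: kappa_ge0.
have mf : measurable_fun setT f.
  apply/measurable_EFinP; apply: measurable_funM; last first.
    by apply: measurableT_comp measurable_fst; exact: measurable_indic.
  apply: measurable_funM; last exact: measurable_kappa_circle.
  by apply: measurableT_comp measurable_snd; exact: mV.
pose F p := (\int[mu]_t f (p, t))%E.
have mF : measurable_fun setT F by exact: measurable_fun_fubini_tonelli_F.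
exists F; split=> //.
- by move=> p; apply: integral_ge0 => t _.
- move=> p Ap; rewrite integral_mkcond /F; apply: le_integral_nonneg => t _.
    rewrite patchE; case: ifP => // _; rewrite lee_fin.
    by apply: mulr_ge0 => //; exact: kappa_ge0.
  rewrite /f /V /= !patchE indicE (mem_set Ap) mulr1; case: ifP => // _.
  by rewrite lee_fin mul0r.
have -> : (\int[mu2]_(p in A) F p = \int[mu2]_p F p)%E.
  rewrite integral_mkcond; apply: eq_integral => p _; rewrite patchE; case: ifPn => // pA.
  rewrite /F -[LHS](integral0 mu setT); apply: eq_integral => t _.
  by rewrite /f /= indicE (negbTE pA) mulr0.
have -> : (\int[mu2]_p F p = \int[mu]_t \int[mu2]_p f (p, t))%E.
  exact: (@fubini_tonelli _ _ _ _ _ (@plane_measure R) mu f mf f0).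
apply: (@le_trans _ _ (\int[mu]_t (B%:E * (V t)%:E))%E).
  apply: le_integral_nonneg => t _; first by apply: integral_ge0 => p _.
  have -> : (\int[mu2]_p f (p, t) =
      \int[mu2]_(p in A) ((V t)%:E * (kappa rho (circle_pt rho t) p)%:E))%E.
    rewrite [RHS]integral_mkcond; apply: eq_integral => p _; rewrite patchE /f /= indicE.
    by case: ifP => _; rewrite ?mulr1 ?mulr0 ?EFinM.
  rewrite ge0_integralZl_EFin//; last 2 first.
  - by move=> p _; rewrite lee_fin kappa_ge0.
  - by apply/measurable_EFinP; apply: measurable_funS (measurable_kappa _ _).
  by rewrite muleC; apply: lee_wpmul2r; [rewrite lee_fin|exact: kernel_integral].
have B0 : (0 <= B%:E)%E.
  apply: le_trans (kernel_integral (0 : C) r'0 r'r rr).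
  by apply: integral_ge0 => p _; rewrite lee_fin kappa_ge0.
rewrite ge0_integralZl//; last 2 first.
- exact/measurable_EFinP.
- by move=> t _; rewrite lee_fin.
rewrite [leRHS]EFinM; apply: lee_wpmul2l; first exact: B0.
have -> : (\int[mu]_t (V t)%:E = \int[mu]_(t in period) (W t)%:E)%E.
  rewrite [RHS]integral_mkcond; apply: eq_integral => t _.
  by rewrite /V !patchE; case: ifP.
rewrite /rmean mulrA divff ?mul1r; last by rewrite lt0r_neq0// twopi_gt0.
by rewrite /Rintegral fineK//; exact: integrable_fin_num.
Qed.

(** Off the zeros and poles the integrand is bounded by the kernel through the
    circle representation. The finitely many exceptional points are absorbed
    by a majorant that is infinite on a null set. *)
Lemma log_deriv_area_bound (f h : C -> C) (rho rho' : R) (s : seq C) (m : C -> int) (r' r : R) :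
  0 < rho -> rho < rho' -> {in s, forall b, modulus b <= rho} ->
  (forall z, modulus z < rho' -> (exists l, cderiv h z l) /\ h z != 0) ->
  (forall z, modulus z < rho' -> z \notin s -> f z = divisor_prod s m z * h z) ->
  0 <= r' -> r' < r -> r < rho ->
  (log_derivative_integral r' r f <=
   (5760 * radial_factor r' r rho * (4 * rho * rmean (fun t => `|circle_log0 h rho s m t|) +
      \sum_(b <- s) `|(m b)%:~R| * ((rho ^+ 2 - modulus b ^+ 2) / rho)))%:E)%E.
Proof.
move=> rho0 rr' srho hP fE r'0 r'r rrho; set A := half_open_annulus r' r.
set B := 5760 * radial_factor r' r rho.
have mA : measurable A by exact: measurable_half_open_annulus.
pose W t := 2 * rho * `|circle_log0 h rho s m t|.
have i0 : rmeanable (fun t => `|circle_log0 h rho s m t|).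
  have i1 := rmeanable_circle_log m rho0 rr' srho hP.
  have := integrable_abse (rintegrableB i1 (rmeanable_cst ((order0 s m)%:~R * ln rho))).
  by [].
have iW : rmeanable W by exact: rintegrableZ.
have W0 t : 0 <= W t by apply: mulr_ge0; [apply: mulr_ge0; [by []|exact: ltW]|exact: normr_ge0].
have [F [mF F0 FE Fint]] := circle_kernel_integral rho0 r'0 r'r rrho iW W0.
pose c b : R := `|(m b)%:~R| * ((rho ^+ 2 - modulus b ^+ 2) / rho).
have c0 b : b \in s -> 0 <= c b.
  move=> /srho bs; apply: mulr_ge0; first exact: normr_ge0.
  apply: divr_ge0; last exact: ltW.
  by apply: subr_sqr_ge0 => //; exact: modulus_ge0.
pose G p : \bar R := (\sum_(b <- s) c b * kappa rho b p)%:E.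
pose N : set (R * R) := [set p | plane_pt p \in s].
have [mN N0] := finite_plane_null s.
(* Infinite at the zeros and poles. *)
pose H : R * R -> \bar R := (cst +oo%E) \_ N.
have H0 p : (0 <= H p)%E by rewrite /H patchE; case: ifP => // _; rewrite leey.
have mH : measurable_fun setT H by apply/(measurable_restrictT _ mN); exact: measurable_cst.
have G0 p : (0 <= G p)%E.
  rewrite lee_fin big_seq; apply: sumr_ge0 => b bs.
  by apply: mulr_ge0; [exact: c0|exact: kappa_ge0].
have mG : measurable_fun setT G.
  apply/measurable_EFinP; apply: measurable_sum => b.
  by apply: measurable_funM; [exact: measurable_cst|exact: measurable_kappa].
have pi0 : (0 <= (pi^-1 : R)%:E)%E by rewrite lee_fin invr_ge0 pi_ge0.
have pF0 p : (0 <= (pi^-1)%:E * F p)%E by exact: mule_ge0.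
have mpF : measurable_fun setT (fun p => (pi^-1)%:E * F p)%E.
  by apply: emeasurable_funM => //; exact: measurable_cst.
apply: (@le_trans _ _ (\int[mu2]_(p in A) (((pi^-1)%:E * F p + G p) + H p))%E).
  rewrite /log_derivative_integral integral_mkcond [leRHS]integral_mkcond.
  apply: le_integral_nonneg => p _; first by rewrite patchE; case: ifP => // _; rewrite lee_fin modulus_ge0.
  have g0 : (0 <= (pi^-1)%:E * F p + G p)%E by exact: adde_ge0.
  rewrite !patchE; case: ifPn => [/set_mem /= /andP[pr' pr]|_]; last first.
    by case: ifP => // _; exact: adde_ge0.
  have Ap : A p by rewrite /A /half_open_annulus /= /plane_dist subr0; apply/andP; split=> //; exact: ltW.
  rewrite mem_set//.
  have [ps|ps] := boolP (plane_pt p \in s).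
    by rewrite /H patchE mem_set// addey ?leey//; apply: contraTneq g0 => ->.
  rewrite -[leLHS]adde0; apply: leeD => //.
  have prho : modulus (plane_pt p) < rho by exact: lt_trans pr rrho.
  have [ik lE] := log_deriv_circle rho0 rr' srho hP fE prho ps.
  rewrite -/(log_deriv f (plane_pt p)) lE.
  apply: (@le_trans _ _ ((modulus (cmean (fun t : R => cR (circle_log0 h rho s m t) *
      schwarz_kernel rho (plane_pt p) t)))%:E + (modulus (\sum_(b <- s) (m b)%:~R *
      blaschke_term rho (plane_pt p) b))%:E)%E).
    by rewrite -EFinD lee_fin modulusD.
  apply: leeD.
    apply: (le_trans (modulus_cmean_le (v := fun t => W t * kappa rho (circle_pt rho t) p) ik _)).
      move=> t _; rewrite modulusM modulus_cR kappa_circle ?modulus_circle_pt ?(ltW rho0)//.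
      rewrite /schwarz_kernel modulusM modulus_div modulusX modulus_circle_pt ?(ltW rho0)//.
      rewrite /W /plane_dist [modulus (plane_pt p - _)]modulus_distC.
      have -> : modulus (2 : C) = 2 by have := modulus_cR (2 : R); rewrite cR_nat ger0_norm.
      by rewrite ?(ltW rho0)// [2 * rho * _]mulrC -!mulrA.
    exact: (lee_wpmul2l pi0 (FE p Ap)).
  rewrite /G lee_fin.
  have prho' : plane_dist 0 p < rho by rewrite /plane_dist subr0.
  have : forall q : seq C, {subset q <= s} ->
    modulus (\sum_(b <- q) (m b)%:~R * blaschke_term rho (plane_pt p) b) <=
    \sum_(b <- q) c b * kappa rho b p.
    elim=> [|b q IH] qs; first by rewrite !big_nil modulus0.
    rewrite !big_cons; apply: le_trans (modulusD _ _) _; apply: lerD; last first.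
      by apply: IH => x xq; apply: qs; rewrite in_cons xq orbT.
    have bs : b \in s by apply: qs; rewrite in_cons eqxx.
    rewrite modulusM /c -mulrA.
    have -> : modulus ((m b)%:~R : C) = `|(m b)%:~R : R| by rewrite -cR_int modulus_cR.
    apply: ler_wpM2l; first exact: normr_ge0.
    by apply: modulus_blaschke_term_le => //; exact: srho.
  by apply=> x xs; exact: xs.
rewrite ge0_integralD//; last 3 first.
- by move=> p _; exact: adde_ge0.
- by apply: emeasurable_funD; [apply: measurable_funS mpF|apply: measurable_funS mG].
- exact: measurable_funS mH.
have -> : (\int[mu2]_(p in A) H p = 0)%E.
  apply/eqP; rewrite eq_le; apply/andP; split; last by apply: integral_ge0.
  apply: (@le_trans _ _ (\int[mu2]_(p in N) (cst +oo) p)%E).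
    rewrite integral_mkcond [leRHS]integral_mkcond; apply: le_integral_nonneg => p _.
      by rewrite patchE; case: ifP.
    by rewrite /H !patchE; case: ifP => // _; case: ifP => // _; rewrite leey.
  by rewrite (integral_cst mu2 mN) [X in (_ * X)%E](N0 : mu2 N = 0%E) mule0.
rewrite adde0 ge0_integralD//; last 2 first.
- exact: measurable_funS mpF.
- exact: measurable_funS mG.
rewrite ge0_integralZl_EFin ?invr_ge0 ?pi_ge0//; last exact: measurable_funS mF.
rewrite mulrDr EFinD; apply: leeD.
  apply: le_trans (lee_wpmul2l pi0 Fint) _; rewrite -EFinM lee_fin /W rmeanZ// -/B.
  have := pi_gt0 R; move: (pi : R) (rmean _) => q M q0.
  rewrite le_eqVlt; apply/orP; left; apply/eqP; field; exact: lt0r_neq0.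
have : forall q : seq C, {subset q <= s} ->
  (\int[mu2]_(p in A) (\sum_(b <- q) c b * kappa rho b p)%:E <= (B * \sum_(b <- q) c b)%:E)%E.
  elim=> [|b q IH] qs.
    rewrite big_nil mulr0; under eq_integral do rewrite big_nil.
    by rewrite integral0.
  have qs' : {subset q <= s} by move=> x xq; apply: qs; rewrite in_cons xq orbT.
  have bs : b \in s by apply: qs; rewrite in_cons eqxx.
  have mk a : measurable_fun A (fun p => (c a * kappa rho a p)%:E).
    apply/measurable_EFinP; apply: measurable_funM; first exact: measurable_cst.
    exact: measurable_funS (measurable_kappa _ _).
  under eq_integral do rewrite big_cons EFinD.
  rewrite ge0_integralD; [|exact: mA| |exact: mk| |]; last 3 first.
  - by move=> p _; rewrite lee_fin; apply: mulr_ge0; [exact: c0|exact: kappa_ge0].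
  - move=> p _; rewrite lee_fin big_seq; apply: sumr_ge0 => x xq.
    by apply: mulr_ge0; [apply: c0; exact: qs'|exact: kappa_ge0].
  - under eq_fun do rewrite -sumEFin.
    by apply: emeasurable_sum => x; exact: mk.
  rewrite big_cons mulrDr EFinD; apply: leeD; last exact: IH.
  under eq_integral do rewrite EFinM.
  rewrite ge0_integralZl_EFin//; last 3 first.
  - by move=> p _; rewrite lee_fin kappa_ge0.
  - by apply/measurable_EFinP; exact: measurable_funS (measurable_kappa _ _).
  - exact: c0.
  rewrite [B * c b]mulrC [(c b * B)%:E]EFinM; apply: lee_wpmul2l; first by rewrite lee_fin c0.
  exact: kernel_integral.
by apply.
Qed.

End AreaBound2.

(** * Jensen's formula *)

Section JensenBalance.
Variable R : realType.
Local Notation C := (Cplx R).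
Implicit Types (a b z : C) (t : R) (s : seq C) (m : C -> int).

Definition log_weight (rho : R) b : R := ln rho - ln (modulus b).

Definition zero_sum rho s m : R :=
  \sum_(b <- s | b != 0) Num.max (m b)%:~R 0 * log_weight rho b.
Definition pole_sum rho s m : R :=
  \sum_(b <- s | b != 0) Num.max (- (m b)%:~R) 0 * log_weight rho b.

(** The logarithm of the modulus of the leading Laurent coefficient of f at
    the origin. *)
Definition log_lead (h : C -> C) s m : R :=
  ln (modulus (h 0)) + \sum_(b <- s | b != 0) (m b)%:~R * ln (modulus b).

Lemma log_weight_ge0 (rho : R) b : modulus b <= rho -> b != 0 -> 0 <= log_weight rho b.
Proof.
move=> br b0; rewrite subr_ge0 ler_ln ?posrE ?modulus_gt0//.
by apply: lt_le_trans br; rewrite modulus_gt0.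
Qed.

Lemma big_order0 (F : C -> R) s m : uniq s ->
  \sum_(b <- s) (m b)%:~R * F b =
  (order0 s m)%:~R * F 0 + \sum_(b <- s | b != 0) (m b)%:~R * F b.
Proof.
move=> us; rewrite /order0; case: ifPn => s0.
  by rewrite (bigD1_seq 0 s0 us).
rewrite mul0r add0r big_seq_cond [RHS]big_seq_cond; apply: eq_bigl => b.
rewrite andbT; case: (boolP (b \in s)) => // bs /=.
by case: eqVneq bs => // -> bs; rewrite bs in s0.
Qed.

Lemma max_sub (x : R) : Num.max x 0 - Num.max (- x) 0 = x.
Proof. by case: (leP x 0); case: (leP (- x) 0); lra. Qed.

Lemma max_add (x : R) : Num.max x 0 + Num.max (- x) 0 = `|x|.
Proof.
by case: (ger0P x); case: (leP x 0); case: (leP (- x) 0); lra.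
Qed.

Section Balance.
Variables (h : C -> C) (rho rho' : R) (s : seq C) (m : C -> int).
Hypothesis rho0 : 0 < rho.
Hypothesis rr' : rho < rho'.
Hypothesis us : uniq s.
Hypothesis srho : {in s, forall b, modulus b <= rho}.
Hypothesis hP : forall z, modulus z < rho' -> (exists l, cderiv h z l) /\ h z != 0.

Local Notation Z := (zero_sum rho s m).
Local Notation P := (pole_sum rho s m).
Local Notation p := ((order0 s m)%:~R : R).
Local Notation lc := (log_lead h s m).
Local Notation G0 := (circle_log0 h rho s m).

Let zp_ge0 (c : R) b : b \in s -> b != 0 -> 0 <= Num.max c 0 * log_weight rho b.
Proof.
move=> /srho bs b0; apply: mulr_ge0; last exact: log_weight_ge0.
by rewrite le_max lexx orbT.
Qed.

Lemma zero_sum_ge0 : 0 <= Z.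
Proof. by rewrite /zero_sum big_seq_cond; apply: sumr_ge0 => b /andP[bs b0]; exact: zp_ge0. Qed.

Lemma pole_sum_ge0 : 0 <= P.
Proof. by rewrite /pole_sum big_seq_cond; apply: sumr_ge0 => b /andP[bs b0]; exact: zp_ge0. Qed.

Lemma rmeanable_circle_log0 : rmeanable G0.
Proof.
exact: (rintegrableB (rmeanable_circle_log m rho0 rr' srho hP) (rmeanable_cst _)).
Qed.

(** Jensen's formula for f divided by its leading power at the origin. *)
Lemma rmean_circle_log0 : rmean G0 = Z - P + lc.
Proof.
rewrite rmeanB ?rmeanable_cst//; last exact: rmeanable_circle_log hP.
rewrite rmean_cst (rmean_circle_log m rho0 rr' srho hP) (big_order0 (fun=> ln rho) m us).
have -> : Z - P = \sum_(b <- s | b != 0) (m b)%:~R * ln rho -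
    \sum_(b <- s | b != 0) (m b)%:~R * ln (modulus b).
  rewrite /zero_sum /pole_sum -!sumrB; apply: eq_bigr => b _.
  by rewrite -mulrBl max_sub /log_weight mulrBr.
rewrite /log_lead; ring.
Qed.

Lemma rmeanable_max0 (u : R -> R) : rmeanable u -> rmeanable (fun t => Num.max (u t) 0).
Proof.
move=> iu; have ia : rmeanable (fun t => `|u t|) by exact: integrable_abse iu.
have -> : (fun t => Num.max (u t) 0) = (fun t => 2^-1 * (`|u t| + u t)).
  apply/funext => t; have := max_add (u t); have := max_sub (u t); lra.
by apply: rintegrableZ; exact: rintegrableD.
Qed.

Lemma rmean_abs (u : R -> R) : rmeanable u ->
  rmean (fun t => `|u t|) = 2 * rmean (fun t => Num.max (u t) 0) - rmean u.
Proof.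
move=> iu; have im := rmeanable_max0 iu.
rewrite -rmeanZ// -rmeanB//; last exact: rintegrableZ.
apply: eq_rmean => t _; have := max_add (u t); have := max_sub (u t); lra.
Qed.

(** With y = |b| / rho this is 1 - y^2 <= - 2 ln y, up to the factor rho. *)
Lemma sqr_defect_le b : b \in s -> b != 0 ->
  (rho ^+ 2 - modulus b ^+ 2) / rho <= 2 * rho * log_weight rho b.
Proof.
move=> /srho bs b0; have mb : 0 < modulus b by rewrite modulus_gt0.
pose y := modulus b / rho; have y0 : 0 < y by exact: divr_gt0.
have -> : log_weight rho b = - ln y by rewrite /y ln_div ?posrE// /log_weight opprB.
have -> : (rho ^+ 2 - modulus b ^+ 2) / rho = rho * (1 - y ^+ 2).
  by rewrite /y; field; exact: lt0r_neq0.
rewrite [2 * rho]mulrC -mulrA; apply: ler_wpM2l; first exact: ltW.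
have := @le_ln1Dx R (y ^+ 2 - 1); rewrite addrCA subrr addr0 lnXn// => hl.
have : ln y *+ 2 <= y ^+ 2 - 1 by apply: hl; have := exprn_gt0 2 y0; lra.
by rewrite mulr2n; lra.
Qed.

(** Let A be the mean of the positive part of the normalized boundary
    logarithm, c the leading coefficient, and Z, P the zero and pole sums. By
    Jensen's formula the mean of the absolute value is 2 A - (Z - P + ln |c|),
    so that Z cancels from its sum with Z + P and only A, P and the germ at
    the origin remain. *)
Lemma log_deriv_weight_bound :
  4 * rho * rmean (fun t => `|G0 t|) +
    \sum_(b <- s) `|(m b)%:~R| * ((rho ^+ 2 - modulus b ^+ 2) / rho) <=
  4 * rho * (2 * (rmean (fun t => Num.max (G0 t) 0) + P) - lc + `|p|).
Proof.
have S : \sum_(b <- s) `|(m b)%:~R| * ((rho ^+ 2 - modulus b ^+ 2) / rho) <=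
    rho * `|p| + 2 * rho * (Z + P).
  have -> : \sum_(b <- s) `|(m b)%:~R| * ((rho ^+ 2 - modulus b ^+ 2) / rho) =
    \sum_(b <- s) ((fun b => `|m b|) b)%:~R * ((rho ^+ 2 - modulus b ^+ 2) / rho).
    by apply: eq_bigr => b _; rewrite intr_norm.
  rewrite (big_order0 (fun b => (rho ^+ 2 - modulus b ^+ 2) / rho) _ us).
  apply: lerD.
    rewrite /order0 modulus0; case: ifP => _; rewrite ?intr_norm ?normr0 ?mul0r ?mulr0//.
    by rewrite expr0n subr0 expr2 mulfK ?lt0r_neq0// mulrC.
  rewrite /zero_sum /pole_sum -big_split /= mulr_sumr big_seq_cond [leRHS]big_seq_cond.
  apply: ler_sum => b /andP[bs b0].
  rewrite intr_norm -mulrDl max_add [leRHS]mulrCA; apply: ler_wpM2l; first exact: normr_ge0.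
  exact: sqr_defect_le.
rewrite (rmean_abs rmeanable_circle_log0) rmean_circle_log0.
have := zero_sum_ge0; have := pole_sum_ge0; move: S (rmean _) => S A P0 Z0.
have rZ : 0 <= rho * Z by rewrite mulr_ge0// ltW.
have rP : 0 <= rho * P by rewrite mulr_ge0// ltW.
have rp : 0 <= rho * `|p| by rewrite mulr_ge0// ltW.
lra.
Qed.

End Balance.
End JensenBalance.

(** * Comparison with the Nevanlinna characteristic *)

Section NevanlinnaCounting.
Variable R : realType.
Local Notation C := (Cplx R).
Local Notation mu := (@lebesgue_measure R).
Implicit Types (a b z : C).

Lemma integral_step_inv (c rho : R) : 0 < c -> c <= rho ->
  rintegrable (fun t => (c <= t)%R%:R / t) 0 rho /\
  \int[mu]_(t in `[0, rho]) ((c <= t)%R%:R / t) = ln rho - ln c.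
Proof.
move=> c0 crho; have cont x : c <= x <= rho -> continuous_at x (@GRing.inv R).
  by move=> /andP[cx _]; apply: inv_continuous; rewrite lt0r_neq0// (lt_le_trans c0).
have inE (u : R -> R) : (fun t => (c <= t)%R%:R / t) \_ `[0, rho] = (@GRing.inv R) \_ `[c, rho].
  apply/funext => t; rewrite !patchE !mem_setE /= !in_itv /=.
  have [ct|tc] := leP c t; last by rewrite mul0r; case: ifP.
  by rewrite mul1r (le_trans (ltW c0) ct).
have iv := continuous_rintegrable cont.
split.
  move: iv; rewrite /rintegrable => /integrable_mkcond iv; apply/integrable_mkcond => //.
  move: iv => /(_ (measurable_itv _)); congr (_.-integrable _ _).
  apply/funext => t; have := congr1 (fun g => (g t)%:E) (inE id).
  by rewrite !patchE /=; case: ifP => _; case: ifP => _ E; exact: esym E.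
rewrite Rintegral_mkcond inE// -Rintegral_mkcond.
apply: rint_FTC => // x /andP[cx _]; apply: is_derive1_ln; exact: lt_le_trans cx.
Qed.

Section Counting.
Variables (f h : C -> C) (rho rho' : R) (s : seq C) (m : C -> int).
Hypothesis rho0 : 0 < rho.
Hypothesis rr' : rho < rho'.
Hypothesis us : uniq s.
Hypothesis srho : {in s, forall b, modulus b <= rho}.
Hypothesis hP : forall z, modulus z < rho' -> (exists l, cderiv h z l) /\ h z != 0.
Hypothesis fE : forall z, modulus z < rho' -> z \notin s -> f z = divisor_prod s m z * h z.
Hypothesis fO : forall a, modulus a < rho' -> local_order f a (if a \in s then m a else 0).

Definition pole_mult b : nat := if m b < 0 then `|m b|%N else 0%N.

Lemma pole_multE b : (pole_mult b)%:R = Num.max (- (m b)%:~R) 0 :> R.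
Proof.
rewrite /pole_mult; case: ltP => mb.
  rewrite max_l ?oppr_ge0 ?lerz0 ?(ltW mb)// -mulrNz pmulrn; congr (_ *~ _).
  by rewrite abszE ltr0_norm.
by rewrite max_r// oppr_le0 ler0z.
Qed.

Lemma nevanlinna_nE (t : R) : t <= rho ->
  nevanlinna_n t f = (\sum_(b <- s | (modulus b <= t)%R) pole_mult b)%N.
Proof.
move=> trho; rewrite /nevanlinna_n -[RHS]big_filter; set q := [seq b <- s | (modulus b <= t)%R].
have qE b : (b \in q) = (modulus b <= t) && (b \in s) by rewrite mem_filter.
have pE a : modulus a <= t -> pole_order f a = if a \in s then pole_mult a else 0%N.
  move=> at'; have := pole_orderE (fO (le_lt_trans (le_trans at' trho) rr')).
  by rewrite /pole_mult => ->; case: (a \in s).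
transitivity (\big[addn/0%N]_(a \in [set` q]) pole_order f a).
  symmetry; apply: fsbig_widen.
    by move=> b; rewrite /= qE => /andP[].
  move=> b [/= bt bq]; rewrite pE//; case: ifP => // bs; exfalso; apply: bq.
  by rewrite /= qE bt bs.
transitivity (\sum_(a <- q) pole_order f a)%N.
  by symmetry; apply: fsbig_seq; exact: filter_uniq.
rewrite big_seq [RHS]big_seq; apply: eq_bigr => b.
by rewrite qE => /andP[bt bs]; rewrite pE// bs.
Qed.

Let sum_steps (q : seq C) : {in q, forall b, 0 < modulus b <= rho} ->
  rintegrable (fun t => \sum_(b <- q) (pole_mult b)%:R * ((modulus b <= t)%R%:R / t)) 0 rho /\
  \int[mu]_(t in `[0, rho]) (\sum_(b <- q) (pole_mult b)%:R * ((modulus b <= t)%R%:R / t)) =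
  \sum_(b <- q) (pole_mult b)%:R * log_weight rho b.
Proof.
elim: q => [_|b q IH qP].
  have -> : (fun t : R => \sum_(b <- [::]) (pole_mult b)%:R * ((modulus b <= t)%R%:R / t)) = (fun=> 0).
    by apply/funext => t; rewrite big_nil.
  rewrite big_nil; split; last by rewrite /Rintegral integral0.
  by apply: continuous_rintegrable => x _; exact: cvg_cst.
have [i1 e1] : rintegrable (fun t => \sum_(b <- q) (pole_mult b)%:R * ((modulus b <= t)%R%:R / t)) 0 rho /\
  \int[mu]_(t in `[0, rho]) (\sum_(b <- q) (pole_mult b)%:R * ((modulus b <= t)%R%:R / t)) =
  \sum_(b <- q) (pole_mult b)%:R * log_weight rho b.
  by apply: IH => x xq; apply: qP; rewrite in_cons xq orbT.
have /andP[b0 br] : 0 < modulus b <= rho by apply: qP; rewrite in_cons eqxx.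
have [i2 e2] := integral_step_inv b0 br.
have i3 := rintegrableZ (pole_mult b)%:R i2.
have -> : (fun t : R => \sum_(b <- b :: q) (pole_mult b)%:R * ((modulus b <= t)%R%:R / t)) =
  (fun t => (pole_mult b)%:R * ((modulus b <= t)%R%:R / t) +
     \sum_(b <- q) (pole_mult b)%:R * ((modulus b <= t)%R%:R / t)).
  by apply/funext => t; rewrite big_cons.
split; first exact: rintegrableD.
by rewrite RintegralD// e1 RintegralZl// e2 big_cons.
Qed.

(** A pole b other than the origin contributes the integral of 1 / t from |b|
    to rho. *)
Lemma nevanlinna_NE :
  nevanlinna_N rho f = pole_sum rho s m + Num.max (- (order0 s m)%:~R) 0 * ln rho.
Proof.
rewrite /nevanlinna_N; congr (_ + _ * _).
  have [] := @sum_steps [seq b <- s | b != 0].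
    by move=> b; rewrite mem_filter => /andP[b0 bs]; rewrite modulus_gt0 b0 srho.
  move=> _; rewrite big_filter => E.
  transitivity (\sum_(b <- s | b != 0) (pole_mult b)%:R * log_weight rho b); last first.
    by apply: eq_bigr => b _; rewrite pole_multE.
  rewrite -E; apply: eq_Rintegral => t; rewrite inE /= in_itv /= => /andP[t0 tr].
  rewrite (nevanlinna_nE tr) (nevanlinna_nE (ltW rho0)) big_filter !natr_sum.
  have -> : \sum_(b <- s | modulus b <= t) (pole_mult b)%:R -
     \sum_(b <- s | modulus b <= 0) (pole_mult b)%:R =
     \sum_(b <- s | b != 0) (pole_mult b)%:R * (modulus b <= t)%R%:R :> R.
    rewrite big_mkcond [X in _ - X]big_mkcond -sumrB [RHS]big_mkcond; apply: eq_bigr => b _.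
    have -> : (modulus b <= 0) = (b == 0) by rewrite -modulus_eq0 eq_le modulus_ge0 andbT.
    have [->|b0] := eqVneq b 0; first by rewrite modulus0 t0 subrr.
    by rewrite subr0; case: ifP; rewrite ?mulr1 ?mulr0.
  by rewrite mulr_suml; apply: eq_bigr => b _; rewrite mulrA.
rewrite nevanlinna_nE ?ltW// natr_sum /order0.
have E b : (modulus b <= 0) = (b == 0) by rewrite -modulus_eq0 eq_le modulus_ge0 andbT.
under eq_bigl do rewrite E.
case: ifPn => s0.
  by rewrite -big_filter filter_pred1_uniq// big_seq1 pole_multE.
rewrite oppr0 maxxx big_seq_cond big1// => b /andP[bs /eqP b0].
by rewrite b0 in bs; rewrite bs in s0.
Qed.

Lemma nevanlinna_mE :
  nevanlinna_m rho f = rmean (fun t => Num.max (circle_log h rho s m t) 0).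
Proof.
rewrite -/(rmean (fun t => logp (modulus (f (circle_pt rho t))))).
have [] := @rmean_off_countable _ _ (fun t => logp (modulus (f (circle_pt rho t))))
  (fun t => Num.max (circle_log h rho s m t) 0) (countable_circle_preimage_seq rho0 s).
- move=> t t01 tN; rewrite /logp (circle_logE rho0 rr' hP fE)//.
  by apply/negP => ts; exact: tN.
- exact: rmeanable_max0 (rmeanable_circle_log m rho0 rr' srho hP).
by [].
Qed.

Local Notation P := (pole_sum rho s m).
Local Notation p := ((order0 s m)%:~R : R).
Local Notation lc := (log_lead h s m).
Local Notation G0 := (circle_log0 h rho s m).

Lemma ler_rmean_max0 (u v : R -> R) (c : R) : rmeanable u -> rmeanable v ->
  (forall t, Num.max (u t) 0 <= Num.max (v t) 0 + c) ->
  rmean (fun t => Num.max (u t) 0) <= rmean (fun t => Num.max (v t) 0) + c.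
Proof.
move=> iu iv uv; rewrite -[c in leRHS]rmean_cst -rmeanD ?rmeanable_cst//; last exact: rmeanable_max0.
apply: ler_rmean => //; first exact: rmeanable_max0.
by apply: rintegrableD; [exact: rmeanable_max0|exact: rmeanable_cst].
Qed.

(** Normalizing at the origin changes the proximity and the counting terms by
    multiples of ln rho, which compensate each other except for the negative
    part of ln rho. *)
Lemma proximity_le_nevanlinna_T :
  rmean (fun t => Num.max (G0 t) 0) + P <= nevanlinna_T rho f + `|p| * Num.max (- ln rho) 0.
Proof.
rewrite /nevanlinna_T nevanlinna_NE nevanlinna_mE.
have i1 := rmeanable_circle_log m rho0 rr' srho hP.
have i0 : rmeanable G0 by exact: rmeanable_circle_log0 hP.
have : rmean (fun t => Num.max (G0 t) 0) <=
    rmean (fun t => Num.max (circle_log h rho s m t) 0) + Num.max (- (p * ln rho)) 0.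
  apply: ler_rmean_max0 => // t; rewrite /circle_log0.
  case: (leP (circle_log h rho s m t - p * ln rho) 0);
  case: (leP (circle_log h rho s m t) 0); case: (leP (- (p * ln rho)) 0); lra.
suff : Num.max (- (p * ln rho)) 0 <= Num.max (- p) 0 * ln rho + `|p| * Num.max (- ln rho) 0 by lra.
have [hp|hp] := leP 0 p.
  rewrite ger0_norm// [Num.max (- p) 0]max_r ?oppr_le0// mul0r add0r.
  by rewrite maxr_pMr// mulr0 mulrN.
have np : 0 <= - p by rewrite oppr_ge0 ltW.
rewrite ltr0_norm// (max_l np) (maxr_pMr _ _ np).
rewrite mulr0 mulrNN mulNr; move: (p * ln rho) => x.
by case: (leP (- x) 0); case: (leP x 0); lra.
Qed.

(** If the origin is a pole, Jensen's formula turns the mean of ln |f| plus N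
    into the zero sum plus ln |c|, with c the leading coefficient; otherwise T
    is nonnegative. *)
Lemma nevanlinna_T_ge : - `|lc| <= nevanlinna_T rho f.
Proof.
have P0 : 0 <= P by exact: pole_sum_ge0.
have Z0 : 0 <= zero_sum rho s m by exact: zero_sum_ge0.
rewrite /nevanlinna_T nevanlinna_NE nevanlinna_mE.
have i1 := rmeanable_circle_log m rho0 rr' srho hP.
have m0 : 0 <= rmean (fun t => Num.max (circle_log h rho s m t) 0).
  by apply: rmean_ge0 => t; rewrite le_max lexx orbT.
have [hp|hp] := leP 0 p.
  rewrite [Num.max (- p) 0]max_r ?oppr_le0// mul0r.
  by have := normr_ge0 lc; lra.
have np : 0 <= - p by rewrite oppr_ge0 ltW.
rewrite (max_l np).
have : rmean (circle_log h rho s m) <= rmean (fun t => Num.max (circle_log h rho s m t) 0).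
  by apply: ler_rmean => //; [exact: rmeanable_max0|move=> t _; rewrite le_max lexx].
have := rmean_circle_log0 m rho0 rr' us srho hP.
rewrite /circle_log0 rmeanB ?rmeanable_cst// rmean_cst.
have := ler_norm (- lc); rewrite normrN; lra.
Qed.

End Counting.
End NevanlinnaCounting.

(** * The Laurent germ at the origin *)

Section LaurentGerm.
Variable R : realType.
Local Notation C := (Cplx R).
Implicit Types (f g u v : C -> C) (a b z : C).

(** Shift the Taylor coefficients of the numerator. *)
Lemma local_mero_laurent f : local_mero f 0 -> exists c, is_laurent_expansion0 f c.
Proof.
move=> [r [k [u [r0 ud fu]]]].
pose q := r / 2; have q0 : 0 < q by rewrite divr_gt0.
have qr : q < r by rewrite /q; lra.
have ud' z : modulus z <= q -> exists l, cderiv u z l.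
  by move=> zq; apply: ud; rewrite subr0; exact: le_lt_trans qr.
pose c (n : int) : C := if n + k%:Z is Posz j then taylor_rem u q j 0 else 0.
exists c, k; split.
  move=> n nk; rewrite /c; case E : (n + k%:Z) => [j|//].
  by exfalso; move: nk; rewrite -subr_lt0 opprK E.
have cE n z : z != 0 -> c (n%:Z - k%:Z) * z ^ (n%:Z - k%:Z) = z ^- k * (taylor_rem u q n 0 * z ^+ n).
  move=> z0; rewrite /c subrK expfzDr// -exprnP -exprnN; ring.
apply/near_puncturedP; exists q => // z; rewrite subr0 => /andP[z0 zq].
have zn : z != 0 by rewrite -modulus_gt0.
apply/cvg_modulusP => e e0.
have w0 : 0 < modulus (z ^- k) by rewrite modulus_gt0 invr_neq0// expf_neq0.
have [N NP] := taylor_tail ud' zq (divr_gt0 e0 w0).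
exists N => // n /= Nn; have := NP n Nn.
have -> : f z = z ^- k * u z by rewrite fu subr0 ?z0 ?(lt_trans zq).
rewrite (taylor_expansion ud' n zq).
have -> : series (fun n0 : nat => c (n0%:Z - k%:Z) * z ^ (n0%:Z - k%:Z)) n =
    z ^- k * \sum_(i < n) taylor_rem u q i 0 * z ^+ i.
  by rewrite /series /= big_mkord mulr_sumr; apply: eq_bigr => i _; exact: cE.
move: (\sum_(i < n) _) (z ^+ n * _) => S T.
have -> : z ^- k * S - z ^- k * (S + T) = - (z ^- k * T) by ring.
by rewrite ltr_pdivlMr// => h; rewrite modulusN modulusM mulrC.
Qed.

(** The lengths declared for the two principal parts may differ; this only
    puts zero terms in front of one of the series. *)
Lemma laurent_expansion_unique f g c : is_laurent_expansion0 f c -> is_laurent_expansion0 g c ->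
  exists2 r : R, 0 < r & forall z, 0 < modulus z < r -> f z = g z.
Proof.
move=> [k [ck /near_puncturedP[r r0 fz]]] [l [cl /near_puncturedP[d d0 gz]]].
wlog kl : k l f g r d ck cl r0 d0 fz gz / (k <= l)%N.
  move=> H; have [kl|/ltnW lk] := leqP k l; first exact: (H k l f g r d).
  have [x x0 xP] := H l k g f d r cl ck d0 r0 gz fz lk.
  by exists x => // z /xP.
exists (Num.min r d); first by rewrite lt_min r0.
move=> z /andP[z0]; rewrite lt_min => /andP[zr zd].
have {}fz : series (fun n : nat => c (n%:Z - k%:Z) * z ^ (n%:Z - k%:Z)) @ \oo --> f z.
  by apply: fz; rewrite subr0 z0.
have {}gz : series (fun n : nat => c (n%:Z - l%:Z) * z ^ (n%:Z - l%:Z)) @ \oo --> g z.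
  by apply: gz; rewrite subr0 z0.
move: gz; rewrite -(cvg_shiftn (l - k)).
have -> : (fun n : nat => series (fun n : nat => c (n%:Z - l%:Z) * z ^ (n%:Z - l%:Z)) (n + (l - k))%N) =
   series (fun n : nat => c (n%:Z - k%:Z) * z ^ (n%:Z - k%:Z)).
  apply/funext => n; rewrite /series /= addnC (big_cat_nat (leq0n _) (leq_addr n (l - k)))/=.
  rewrite [X in X + _]big_nat_cond [X in X + _]big1 ?add0r; last first.
    move=> i /andP[/andP[_ il] _]; rewrite ck ?mul0r//.
    rewrite ltrBlDr addrC ltrBrDr.
    by rewrite -PoszD ltz_nat addnC -ltn_subRL.
  rewrite -{1}[(l - k)%N]add0n big_addn addKn; apply: eq_bigr => i _.
  by congr (c _ * z ^ _); rewrite PoszD -subzn//; ring.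
by move=> gz; apply: (cvg_unique _ fz gz); exact: norm_hausdorff.
Qed.

(** The disc is a union of radii. *)
Lemma connected_open_disc (r : R) : connected (open_disc r : set C).
Proof.
have [r0|r0] := ltP 0 r; last first.
  rewrite (_ : open_disc r = set0); first exact: connected0.
  by apply/seteqP; split=> z //= zr; move: (le_lt_trans (modulus_ge0 z) zr); rewrite ltNge r0.
have -> : open_disc r = \bigcup_(w in (open_disc r : set C)) [set cR x * w | x in `[(0:R), 1]].
  apply/seteqP; split=> [z zr|z [w wr [x /=]]].
    by exists z => //; exists 1; rewrite ?cR1 ?mul1r//= in_itv /= ler01 lexx.
  rewrite in_itv /= => /andP[x0 x1] <-; rewrite /open_disc /= modulusM modulus_cR ger0_norm//.
  by apply: le_lt_trans wr; rewrite ler_piMl// modulus_ge0.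
apply: bigcup_connected.
  by exists 0 => w _; exists 0; rewrite ?cR0 ?mul0r//= in_itv /= lexx ler01.
move=> w _; apply: connected_continuous_connected; first exact: segment_connected.
apply: continuous_subspaceT => x; apply: continuous_atM; last exact: cvg_cst.
by apply: continuous_at_cR; exact: cvg_id.
Qed.

Lemma local_order_mero f a (m : int) : local_order f a m -> local_mero f a.
Proof.
move=> [r [u [r0 ud u0 fu]]]; case: m fu => k fu.
  exists r, 0%N, (fun z => (z - a) ^+ k * u z); split=> //.
    move=> z zr; have [l ul] := ud z zr; have [l' kl] := cderivX k (cderiv_subc a z).
    by eexists; exact: cderivM kl ul.
  by move=> z zr; rewrite expr0 invr1 mul1r fu.
by exists r, k.+1, u; split=> // z zr; rewrite fu// NegzE -exprnN.
Qed.

Lemma local_meroB f g a : local_mero f a -> local_mero g a -> local_mero (fun z => f z - g z) a.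
Proof.
move=> [r [k [u [r0 ud fu]]]] [d [l [v [d0 vd gv]]]].
exists (Num.min r d), (k + l)%N, (fun z => (z - a) ^+ l * u z - (z - a) ^+ k * v z); split.
- by rewrite lt_min r0.
- move=> z; rewrite lt_min => /andP[zr zd].
  have [u' hu] := ud z zr; have [v' hv] := vd z zd.
  have [p' hp] := cderivX l (cderiv_subc a z); have [q' hq] := cderivX k (cderiv_subc a z).
  by eexists; exact: cderivB (cderivM hp hu) (cderivM hq hv).
- move=> z /andP[z0]; rewrite lt_min => /andP[zr zd].
  rewrite fu ?z0// gv ?z0//.
  have : z - a != 0 by rewrite -modulus_gt0.
  move: (z - a) (u z) (v z) => x y y' x0; rewrite exprD mulrBr invfM.
  have xk : x ^+ k != 0 by rewrite expf_neq0.
  have xl : x ^+ l != 0 by rewrite expf_neq0.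
  move: (x ^+ k) (x ^+ l) xk xl => X Y X0 Y0; by field; rewrite X0 Y0.
Qed.

Lemma local_order_congr f g a (m : int) (d : R) : 0 < d ->
  (forall z, 0 < modulus (z - a) < d -> f z = g z) -> local_order g a m -> local_order f a m.
Proof.
move=> d0 fg [r [u [r0 ud u0 gu]]]; exists (Num.min d r), u; split.
- by rewrite lt_min d0.
- by apply: cdiff_on_ballW ud; rewrite ge_min lexx orbT.
- by move=> z; rewrite lt_min => /andP[_ zr]; exact: u0.
- by move=> z /andP[z0]; rewrite lt_min => /andP[zd zr]; rewrite fg ?z0// gu// z0.
Qed.

Lemma local_order_monomial u a (p : int) (r : R) : cdiff_on_ball u 0 r ->
  (forall z, modulus z < r -> u z != 0) -> modulus a < r ->
  local_order (fun z => z ^ p * u z) a (if a == 0 then p else 0).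
Proof.
move=> ud u0 ar; rewrite -[X in local_order _ _ X]addr0; apply: local_orderM.
  by have := local_order_factor a 0 p; under eq_fun do rewrite subr0.
exists (r - modulus a), u; split.
- by rewrite subr_gt0.
- move=> z za; apply: ud; rewrite subr0.
  by have := modulusD (z - a) a; rewrite subrK; lra.
- by move=> z za; apply: u0; have := modulusD (z - a) a; rewrite subrK; lra.
- by move=> z _; rewrite expr0z mul1r.
Qed.

Lemma punctured_avoids (s : seq C) a : exists2 d : R, 0 < d &
  forall z, 0 < modulus (z - a) < d -> z \notin s.
Proof.
elim: s => [|b s [d d0 dP]]; first by exists 1.
pose x := if a == b then d else Num.min d (modulus (b - a)).
exists x; rewrite /x; case: eqVneq => [ab|ab].
- exact: d0.
- by rewrite lt_min d0 modulus_gt0 subr_eq0 eq_sym.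
- move=> z zd; rewrite in_cons negb_or dP// andbT.
  by move: zd => /andP[+ _]; rewrite modulus_gt0 subr_eq0 ab.
- move=> z /andP[z0]; rewrite lt_min => /andP[zd zb].
  rewrite in_cons negb_or dP ?z0// andbT.
  by apply/eqP => E; move: zb; rewrite E ltxx.
Qed.

End LaurentGerm.

(** * Functions with a prescribed germ *)

Section GermConstant.
Variable R : realType.
Local Notation C := (Cplx R).
Implicit Types (a b z : C).

Lemma divisor_prod_order0 (s : seq C) (m : C -> int) z : uniq s ->
  divisor_prod s m z = z ^ order0 s m * divisor_prod [seq b <- s | b != 0] m z.
Proof.
move=> us; rewrite /divisor_prod big_filter /order0; case: ifPn => s0.
  by rewrite (bigD1_seq 0 s0 us) /= subr0.
rewrite expr0z mul1r big_seq_cond [RHS]big_seq_cond; apply: eq_bigl => b.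
rewrite andbT; case: (boolP (b \in s)) => // bs /=.
by case: eqVneq bs => // -> bs; rewrite bs in s0.
Qed.

Section Compare.
Variables (f h u : C -> C) (rho rho' r1 : R) (s : seq C) (m : C -> int) (p : int).
Hypothesis rho0 : 0 < rho.
Hypothesis rr' : rho < rho'.
Hypothesis us : uniq s.
Hypothesis srho : {in s, forall b, modulus b <= rho}.
Hypothesis hP : forall z, modulus z < rho' -> (exists l, cderiv h z l) /\ h z != 0.
Hypothesis fE : forall z, modulus z < rho' -> z \notin s -> f z = divisor_prod s m z * h z.
Hypothesis fO : forall a, modulus a < rho' -> local_order f a (if a \in s then m a else 0).
Hypothesis r10 : 0 < r1.
Hypothesis ud : cdiff_on_ball u 0 r1.
Hypothesis un0 : forall z, modulus z < r1 -> u z != 0.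
Hypothesis fu : exists2 d : R, 0 < d & forall z, 0 < modulus z < d -> f z = z ^ p * u z.

Let rho'0 : 0 < rho'. Proof. exact: lt_trans rr'. Qed.
Let in0 (r : R) : 0 < r -> modulus (0 : C) < r. Proof. by rewrite modulus0. Qed.

Lemma germ_order : order0 s m = p.
Proof.
have [d d0 dP] := fu; apply: (local_order_unique (fO (in0 rho'0))).
have := local_order_monomial p ud un0 (in0 r10); rewrite eqxx.
by apply: local_order_congr d0 _ => z; rewrite subr0; exact: dP.
Qed.

(** Two zero-free factors that agree on a punctured neighbourhood of 0 agree
    at 0. *)
Lemma germ_log_lead : log_lead h s m = ln (modulus (u 0)).
Proof.
have [d d0 dP] := fu; have [e e0 eP] := punctured_avoids s 0.
set q := [seq b <- s | b != 0].
have q0 : 0 \notin q by rewrite mem_filter eqxx.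
have [[l hl] hn] := hP (in0 rho'0).
have [l' ql] := cderiv_divisor_prod m q0.
have z0r : modulus (0 - 0 : C) < r1 by rewrite subr0; exact: in0.
have [l'' ul] := ud z0r.
pose x := Num.min d (Num.min e rho').
have x0 : 0 < x by rewrite !lt_min d0 e0.
have E : u 0 = divisor_prod q m 0 * h 0.
  apply: (cderiv_punctured_eq x0 ul (cderivM ql hl)) => z.
  rewrite subr0 !lt_min => /andP[z0 /andP[zd /andP[ze zr]]].
  have zn : z ^ p != 0 by rewrite expfz_neq0// -modulus_gt0.
  apply: (mulfI zn); rewrite -dP ?z0// fE//; last by apply: eP; rewrite subr0 z0.
  by rewrite divisor_prod_order0// germ_order mulrA.
rewrite E modulusM lnM ?posrE ?modulus_gt0//; last exact: divisor_prod_neq0.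
rewrite ln_modulus_divisor_prod// /log_lead addrC big_filter; congr (_ + _).
by apply: eq_bigr => b _; rewrite sub0r modulusN.
Qed.

(** By the identity theorem f coincides with z^p u on the whole disc, and so
    has neither zeros nor poles away from the origin. *)
Lemma germ_on_small_disc : rho < r1 -> {in s, forall b, b != 0 -> m b = 0} /\
  (forall z, modulus z = rho -> h z = u z).
Proof.
move=> rr1; pose x := Num.min rho' r1.
have inx z : open_disc x z -> modulus z < rho' /\ modulus z < r1.
  by rewrite /open_disc /= lt_min => /andP[].
have xin z : modulus z <= rho -> open_disc x z.
  by move=> zr; rewrite /open_disc /= lt_min !(le_lt_trans zr).
pose D z := f z - z ^ p * u z.
have Dz a : open_disc x a -> local_zero D a.
  move=> ax; have DM b : open_disc x b -> local_mero D b.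
    move=> /inx[b1 b2]; apply: local_meroB; first exact: local_order_mero (fO b1).
    exact: local_order_mero (local_order_monomial p ud un0 b2).
  apply: contrapT => nz.
  have zx : open_disc x (0 : C) by apply: xin; rewrite modulus0 ltW.
  have [k Dk] := local_order_on_connected (@connected_open_disc R x) DM ax nz zx.
  apply: (local_order_not_zero Dk); have [d d0 dP] := fu.
  by exists d => // z; rewrite subr0 => zd; rewrite /D dP// subrr.
have fn a : open_disc x a -> exists2 d : R, 0 < d &
    forall z, 0 < modulus (z - a) < d -> f z = z ^ p * u z.
  by move=> /Dz[d d0 dP]; exists d => // z /dP /eqP; rewrite subr_eq0 => /eqP.
have mb b : b \in s -> b != 0 -> m b = 0.
  move=> bs b0; have bx := xin b (srho bs); have [b1 b2] := inx b bx.
  have [d d0 dP] := fn b bx.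
  have := fO b1; rewrite bs => fb; apply: (local_order_unique fb).
  by have := local_order_congr d0 dP (local_order_monomial p ud un0 b2); rewrite (negbTE b0).
split=> // z zr; have zx : open_disc x z by apply: xin; rewrite zr.
have [z1 z2] := inx z zx; have [d d0 dP] := fn z zx.
have [e e0 eP] := punctured_avoids (0 :: s) z.
have [[l hl] _] := hP z1; have z2' : modulus (z - 0) < r1 by rewrite subr0.
have [l'' ul] := ud z2'.
pose y := Num.min d (Num.min e (rho' - modulus z)).
have y0 : 0 < y by rewrite !lt_min d0 e0 subr_gt0.
apply: (cderiv_punctured_eq y0 hl ul) => w.
rewrite !lt_min => /andP[w0 /andP[wd /andP[we wr]]].
have := eP w; rewrite w0 we => /(_ isT); rewrite in_cons negb_or => /andP[wn ws].
have wn' : w ^ p != 0 by rewrite expfz_neq0.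
have wr' : modulus w < rho' by have := modulusD (w - z) z; rewrite subrK; lra.
apply: (mulfI wn'); rewrite -dP ?w0// fE// divisor_prod_order0// germ_order.
rewrite [X in _ * X * _]/divisor_prod big_filter big_seq_cond big1 ?mulr1//.
by move=> b /andP[bs b0]; rewrite mb// expr0z.
Qed.

Lemma small_disc_weights (M : R) : rho < r1 -> 0 <= M ->
  (forall z, modulus z = rho -> ln (modulus (u z)) <= M) ->
  pole_sum rho s m = 0 /\
  rmean (fun t => Num.max (circle_log0 h rho s m t) 0) <= M.
Proof.
move=> rr1 M0 uM; have [mb hu] := germ_on_small_disc rr1; split.
  rewrite /pole_sum big_seq_cond big1// => b /andP[bs b0].
  by rewrite mb// oppr0 maxxx mul0r.
rewrite -[leRHS]rmean_cst; apply: ler_rmean; last 2 first.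
- exact: rmeanable_cst.
- move=> t _; rewrite ge_max M0 andbT.
  rewrite /circle_log0 /circle_log (big_order0 (fun b => ln_dist rho b t) m us).
  have -> : \sum_(b <- s | b != 0) (m b)%:~R * ln_dist rho b t = 0.
    by rewrite big_seq_cond big1// => b /andP[bs b0]; rewrite mb// mul0r.
  rewrite /ln_dist subr0 (modulus_circle_pt t (ltW rho0)) addr0 addrAC subrr add0r.
  by rewrite hu ?uM// (modulus_circle_pt t (ltW rho0)).
- exact: rmeanable_max0 (rmeanable_circle_log0 m rho0 rr' srho hP).
Qed.

End Compare.
End GermConstant.

(** * The area estimate *)

Section MainBound.
Variable R : realType.
Local Notation C := (Cplx R).

Lemma laurent_coef0P (f : C -> C) : local_mero f 0 ->
  is_laurent_expansion0 f (laurent_coef0 f).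
Proof. by move=> /local_mero_laurent ex; exact: (xgetPex _ ex). Qed.

(** The order p and the leading coefficient depend only on c. One function g
    with these Laurent coefficients provides a radius r2 on which g = z^p u
    with ln |u| <= M. If rho >= r2, the negative part of ln rho is bounded by
    that of ln r2. If rho < r2, then f = z^p u on the disc, so that the weight
    is bounded in terms of M, and the lower bound for T suffices. *)
Lemma germ_constant (c : int -> C) : exists K : R, 0 < K /\
  forall (f h : C -> C) (rho rho' : R) (s : seq C) (m : C -> int),
    0 < rho -> rho < rho' -> uniq s -> {in s, forall b, modulus b <= rho} ->
    (forall z, modulus z < rho' -> (exists l, cderiv h z l) /\ h z != 0) ->
    (forall z, modulus z < rho' -> z \notin s -> f z = divisor_prod s m z * h z) ->
    (forall a, modulus a < rho' -> local_order f a (if a \in s then m a else 0)) ->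
    laurent_coef0 f = c ->
    0 <= 2 * nevanlinna_T rho f + K /\
    2 * (rmean (fun t => Num.max (circle_log0 h rho s m t) 0) + pole_sum rho s m)
      - log_lead h s m + `|(order0 s m)%:~R| <= 2 * nevanlinna_T rho f + K.
Proof.
have [[g [p [gp gc]]]|no] := pselect (exists g p, local_order g 0 p /\ laurent_coef0 g = c); last first.
  exists 1; split=> // f h rho rho' s m rho0 rr' us srho hP fE fO fc; exfalso; apply: no.
  have zr : modulus (0 : C) < rho' by rewrite modulus0 (lt_trans rho0).
  by eexists; eexists; split; [exact: fO zr|].
have [r1 [u [r10 ud un0 gu]]] := gp.
have zr1 : modulus (0 - 0 : C) < r1 by rewrite subr0 modulus0.
have [l ul] := ud 0 zr1.
have [d d0 dP] := cderiv_cont ul ltr01.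
pose r2 := Num.min r1 d; have r20 : 0 < r2 by rewrite lt_min r10.
(* As ln x <= x - 1, this bounds ln |u| where u is within 1 of u 0. *)
pose M := modulus (u 0) + 1.
have M0 : 0 <= M by rewrite addr_ge0 ?modulus_ge0.
have un z : modulus z < r2 -> u z != 0.
  by rewrite lt_min => /andP[zr _]; apply: un0; rewrite subr0.
have uM z : modulus z < r2 -> ln (modulus (u z)) <= M.
  move=> zr2; move: (zr2); rewrite lt_min => /andP[_ zd].
  have u0 : 0 < modulus (u z) by rewrite modulus_gt0 un.
  have := @le_ln1Dx R (modulus (u z) - 1); rewrite addrCA subrr addr0 => H.
  have {}H : ln (modulus (u z)) <= modulus (u z) - 1 by apply: H; lra.
  have : modulus (u z - u 0) < 1 by apply: dP; rewrite subr0.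
  have := modulusD (u z - u 0) (u 0); rewrite subrK /M; lra.
have ud2 : cdiff_on_ball u 0 r2 by apply: cdiff_on_ballW ud; rewrite ge_min lexx.
pose L := ln (modulus (u 0)).
pose E := `|p%:~R : R| * Num.max (- ln r2) 0.
have E0 : 0 <= E by rewrite mulr_ge0// le_max lexx orbT.
(* Two of the three copies of |L| offset the possibly negative 2 T, which is
   at least - 2 |L|. *)
exists (2 * E + 2 * M + 3 * `|L| + `|p%:~R| + 1).
have aL := normr_ge0 L; have ap := normr_ge0 (p%:~R : R).
split; first by lra.
move=> f h rho rho' s m rho0 rr' us srho hP fE fO fc.
have zr : modulus (0 : C) < rho' by rewrite modulus0 (lt_trans rho0).
have fu : exists2 e : R, 0 < e & forall z, 0 < modulus z < e -> f z = z ^ p * u z.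
  have e1 := laurent_coef0P (local_order_mero (fO 0 zr)).
  have e2 := laurent_coef0P (local_order_mero gp).
  rewrite fc in e1; rewrite gc in e2.
  have [e e0 eP] := laurent_expansion_unique e1 e2.
  exists (Num.min e r1); first by rewrite lt_min e0.
  move=> z /andP[z0]; rewrite lt_min => /andP[ze zr'].
  by rewrite eP ?z0// gu subr0// z0.
have pE := germ_order rho0 rr' fO r20 ud2 un fu.
have lE := germ_log_lead rho0 rr' us hP fE fO r20 ud2 un fu.
have Tge := nevanlinna_T_ge rho0 rr' us srho hP fE fO.
rewrite lE -/L in Tge *; rewrite pE.
have nL : - L <= `|L| by rewrite -normrN ler_norm.
split; first by lra.
have [rr2|rr2] := ltP rho r2.
  have [P0 A0] := small_disc_weights rho0 rr' us srho hP fE fO r20 ud2 un fu rr2 M0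
    (fun z zr0 => uM z (eq_ind_r (fun x => x < r2) rr2 zr0)).
  by rewrite P0; lra.
have := proximity_le_nevanlinna_T rho0 rr' us srho hP fE fO; rewrite pE.
have : `|p%:~R : R| * Num.max (- ln rho) 0 <= E.
  apply: ler_wpM2l => //; rewrite ge_max; apply/andP; split; last by rewrite le_max lexx orbT.
  by rewrite le_max lerN2 ler_ln ?posrE ?rr2.
lra.
Qed.

(** All terms of the right-hand side are nonnegative, and those of the
    left-hand side occur among them with smaller coefficients. *)
Lemma radial_factor_le (rho r' r : R) : 0 <= r' -> r' < r -> r < rho ->
  0 <= radial_factor r' r rho /\
  rho * radial_factor r' r rho <=
  4 * rho * ((r - r') / (rho - r')) * (2 + ln 2 + ln ((rho - r') / (r - r')))
    + (2 * pi + 2) * (r - r') + 3 * rho * ln ((rho - r') / (rho - r)).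
Proof.
move=> r'0 r'r rr; rewrite /radial_factor.
have rho0 : 0 < rho by lra.
have x0 : 0 <= (r - r') / (rho - r') by apply: divr_ge0; lra.
have L0 : 0 <= ln ((rho - r') / (r - r')) by rewrite ln_ge0// ler_pdivlMr ?mul1r; lra.
have Y0 : 0 <= ln ((rho - r') / (rho - r)) by rewrite ln_ge0// ler_pdivlMr ?mul1r; lra.
have T0 : 0 <= ln 2 :> R by rewrite ln_ge0// ler1n.
have D0 : 0 <= (2 * pi + 2) * (r - r').
  by apply: mulr_ge0; [have := pi_ge0 R; lra|lra].
move: (_ / (rho - r')) (ln _) (ln _) (ln 2) x0 L0 Y0 T0 D0 => x L Y T x0 L0 Y0 T0.
move: ((2 * pi + 2) * _) => D D0.
have xL := mulr_ge0 x0 L0; split; first by lra.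
have rx := mulr_ge0 (ltW rho0) x0; have rxL := mulr_ge0 (ltW rho0) xL.
have rY := mulr_ge0 (ltW rho0) Y0; have rxT := mulr_ge0 rx T0.
lra.
Qed.

(** A function that is nonzero at one point is not locally zero there. *)
Lemma domain_local_order (U : set C) (f : C -> C) : is_domain U -> meromorphic_on U f ->
  (exists2 z, U z & f z != 0) -> forall a, U a -> exists n : int, local_order f a n.
Proof.
move=> [_ cU _] fU [z Uz fz].
apply: (local_order_on_connected cU (fun a Ua => meromorphic_local_mero (fU a Ua)) Uz).
case: (fU z Uz) => [/holomorphic_atP[r r0 rP]|[k /pole_local_order[_ fk]]]; last first.
  exact: local_order_not_zero fk.
move=> [d d0 dP]; have zr : modulus (z - z) < r by rewrite subrr modulus0.
have [l fl] := rP z zr.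
have E := cderiv_punctured_eq (g := fun=> 0) d0 fl (cderiv_cst _ _) dP.
by move: fz; rewrite E eqxx.
Qed.

End MainBound.

Theorem theorem5 (R : realType) :
  exists K : R, 0 < K /\
  exists C : (int -> Cplx R) -> R, (forall c, 0 < C c) /\
  forall (rho : R) (U : set (Cplx R)) (f : Cplx R -> Cplx R),
    0 < rho ->
    is_domain U -> closed_disc rho `<=` U ->
    meromorphic_on U f -> (exists2 z, U z & f z != 0) ->
    forall r' r : R, 0 <= r' -> r' < r -> r < rho ->
    (log_derivative_integral r' r f <=
     (K * ((4 * rho * ((r - r') / (rho - r'))
              * (2 + ln 2 + ln ((rho - r') / (r - r')))
            + (2 * pi + 2) * (r - r')
            + 3 * rho * ln ((rho - r') / (rho - r)))
           * (2 * nevanlinna_T rho f + C (laurent_coef0 f))))%:E)%E.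
Proof.
(* 5760 is the constant of the kernel integral, and the weight bound
   contributes the factor 4. *)
exists 23040; split; first by rewrite ltr0n.
have [Cst CstP] := choice (@germ_constant R).
exists Cst; split=> [c|rho U f rho0 dU discU fU fn r' r r'0 r'r rrho].
  by have [] := CstP c.
have [oU _ _] := dU.
have [rho' [s [m [h [[rr' us] srho fO hP fE]]]]] :=
  zero_pole_factorization rho0 oU discU fU (domain_local_order dU fU fn).
have [_ /(_ f h rho rho' s m rho0 rr' us srho hP fE fO erefl)[T0 W]] := CstP (laurent_coef0 f).
apply: le_trans (log_deriv_area_bound rho0 rr' srho hP fE r'0 r'r rrho) _.
have [rf0 rfB] := radial_factor_le r'0 r'r rrho.
have wb := log_deriv_weight_bound m rho0 rr' us srho hP.
rewrite lee_fin.
have rf1 : 0 <= 5760 * radial_factor r' r rho by apply: mulr_ge0; [exact: ler0n|].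
apply: (le_trans (ler_wpM2l rf1 wb)).
move: W T0 rfB; set V := _ + `|_|; set X := _ + Cst _.
move=> VX X0 rfB; have rr0 : 0 <= rho * radial_factor r' r rho by rewrite mulr_ge0// ltW.
have h1 : rho * radial_factor r' r rho * V <= rho * radial_factor r' r rho * X.
  exact: ler_wpM2l.
have h2 := ler_wpM2r X0 rfB.
have -> : 5760 * radial_factor r' r rho * (4 * rho * V) =
  23040 * (rho * radial_factor r' r rho * V) by ring.
apply: ler_wpM2l; first exact: ler0n.
exact: le_trans h1 h2.
Qed.
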